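(* Let $a,b\in\mathbb{C}$, $c,c'\in\mathbb{C}\setminus\mathbb{Z}_{\leqslant 0}$ and $a-b\notin\mathbb{Z}$. Let $N$ be any positive integer and fix $x\in\mathbb{C}\setminus\{0\}$. Then $$\Psi_1\left[a,b;c,c';\frac{x}{y},y\right]=\mathfrak{f}_c(b,a)\left(-\frac{x}{y}\right)^{-a}\sum_{m=0}^{N-1}a_1(m)y^m+\mathfrak{f}_c(a,b)\left(-\frac{x}{y}\right)^{-b}\sum_{m=0}^{N-1}a_2(m)y^m+\mathcal{O}\left(|y|^{\Re(a)+N}+|y|^{\Re(b)+N}\right)$$ as $y\to0$ in $\left|\arg\left(-\frac{x}{y}\right)\right|<\pi$, where $$\mathfrak{f}_{\gamma}(a,b)=\frac{\Gamma(\gamma)\Gamma(a-b)}{\Gamma(a)\Gamma(\gamma-b)},$$ $$a_1(m)=\sum_{\substack{k,\ell\geqslant0\\k+\ell=m}}\frac{(-k)_{\ell}(a)_k(1-c+a)_k}{(c')_{\ell}(1-b+a)_k\,\ell!\,k!}x^{-k},\qquad a_2(m)=\sum_{\substack{k,\ell\geqslant0\\k+\ell=m}}\frac{(a-b-k)_{\ell}(b)_k(1-c+b)_k}{(c')_{\ell}(1-a+b)_k\,\ell!\,k!}x^{-k}.$$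
   Context: The Humbert function $\Psi_1$ is defined for $a,b\in\mathbb{C}$, $c,c'\in\mathbb{C}\setminus\mathbb{Z}_{\leqslant 0}$, $|x|<1$, $y\in\mathbb{C}$ by $$\Psi_1[a,b;c,c';x,y]=\sum_{m,n=0}^{\infty}\frac{(a)_{m+n}(b)_m}{(c)_m(c')_n}\frac{x^m}{m!}\frac{y^n}{n!},$$ where $(a)_n=a(a+1)\cdots(a+n-1)$, $(a)_0=1$, and is extended by analytic continuation to the region $\{(x,y)\in\mathbb{C}^2: x\neq1,\ |\arg(1-x)|<\pi,\ |y|<\infty\}$. $1/\Gamma$ denotes the entire reciprocal Gamma function (zero at nonpositive integers). Complex powers have their principal values. *)

(* Defs.v *)
From Stdlib Require Export Reals Factorial.
From Coquelicot Require Export Coquelicot.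
Open Scope R_scope.

(** Principal argument, in (-PI, PI] for z <> 0; the value at 0 is
    meaningless. *)
Definition Arg (z : C) : R :=
  if Rle_dec 0 (Im z) then acos (Re z / Cmod z) else - acos (Re z / Cmod z).

Definition Cexp (z : C) : C := (exp (Re z) * cos (Im z), exp (Re z) * sin (Im z)).

Definition CLog (z : C) : C := (ln (Cmod z), Arg z).

(** Principal value of z^w, for z <> 0. *)
Definition Cpower (z w : C) : C := Cexp (w * CLog z)%C.

Fixpoint poch (a : C) (n : nat) : C :=
  match n with
  | O => RtoC 1
  | S k => (poch a k * (a + RtoC (INR k)))%C
  end.

(** Gauss' limit 1/Gamma(z) = lim_n z(z+1)...(z+n) / (n! n^z), which converges
    for every complex z and vanishes exactly at the nonpositive integers. *)
Definition rGamma_seq (z : C) (n : nat) : C :=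
  (poch z (S n) / (RtoC (INR (fact n)) * Cpower (RtoC (INR n)) z))%C.

Definition rGamma (z : C) : C :=
  (real (Lim_seq (fun n => Re (rGamma_seq z n))),
   real (Lim_seq (fun n => Im (rGamma_seq z n)))).

(** Only meaningful away from the nonpositive integers. *)
Definition Gamma (z : C) : C := (/ rGamma z)%C.

Definition not_nonpos_int (z : C) : Prop :=
  forall n : nat, z <> RtoC (- INR n).

Definition not_int (z : C) : Prop :=
  forall k : Z, z <> RtoC (IZR k).

(** The double series of general term [u m n] converges absolutely, with
    sum [s]. *)
Definition is_double_series (u : nat -> nat -> C) (s : C) : Prop :=
  (exists M : R, forall n : nat,
     sum_n (fun i => sum_n (fun j => Cmod (u i j)) n) n <= M) /\
  filterlim (fun n => sum_n (fun i => sum_n (fun j => u i j) n) n)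
    eventually (locally s).

(** [F] is analytic at [(x0, y0)]: near that point it is the sum of a
    convergent double power series. *)
Definition analytic2_at (F : C -> C -> C) (x0 y0 : C) : Prop :=
  exists (p : nat -> nat -> C) (r : R), 0 < r /\
    forall x y : C, Cmod (x - x0) < r -> Cmod (y - y0) < r ->
      is_double_series
        (fun j k => p j k * ((x - x0) ^ j * (y - y0) ^ k))%C (F x y).

Definition Psi1_term (a b c c' x y : C) (m n : nat) : C :=
  (poch a (m + n) * poch b m / (poch c m * poch c' n)
   * (x ^ m / RtoC (INR (fact m))) * (y ^ n / RtoC (INR (fact n))))%C.

Definition Psi1_region (x y : C) : Prop :=
  x <> RtoC 1 /\ Rabs (Arg (1 - x)%C) < PI.

(** [F] is Humbert's function Psi_1[a,b;c,c';.,.]: the sum of the defining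
    series for |x| < 1, continued analytically to [Psi1_region]. As this region
    is connected, [F] is uniquely determined on it; elsewhere its values are
    unconstrained. *)
Definition is_Psi1 (a b c c' : C) (F : C -> C -> C) : Prop :=
  (forall x y : C, Cmod x < 1 ->
     is_double_series (Psi1_term a b c c' x y) (F x y)) /\
  (forall x y : C, Psi1_region x y -> analytic2_at F x y).

Definition frakf (g a b : C) : C :=
  (Gamma g * Gamma (a - b) * rGamma a * rGamma (g - b))%C.

Definition coef1 (a b c c' x : C) (m : nat) : C :=
  sum_n (fun k =>
    let l := (m - k)%nat in
    (poch (- RtoC (INR k)) l * poch a k * poch (1 - c + a) k
     / (poch c' l * poch (1 - b + a) k
        * RtoC (INR (fact l)) * RtoC (INR (fact k)))
     * / (x ^ k))%C) m.

Definition coef2 (a b c c' x : C) (m : nat) : C :=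
  sum_n (fun k =>
    let l := (m - k)%nat in
    (poch (a - b - RtoC (INR k)) l * poch b k * poch (1 - c + b) k
     / (poch c' l * poch (1 - a + b) k
        * RtoC (INR (fact l)) * RtoC (INR (fact k)))
     * / (x ^ k))%C) m.

(* Main.v *)
Require Import Defs.
From Stdlib Require Import Lra Lia Psatz Compare_dec.

(** Idea of the proof.  Put X = x/y, so that X tends to infinity as y tends
    to 0.  Expanding Psi_1 in powers of y gives
      Psi_1(X, y) = sum_n (a)_n / ((c')_n n!) F_n(X) y^n,
    where F_n is the continuation of Gauss' series 2F1(a+n, b; c; X).  The
    connection formula writes F_n for large X as
      frakf c b (a+n) (-X)^(-a-n) 2F1(a+n, 1-c+a+n; 1-b+a+n; 1/X)
      + frakf c (a+n) b (-X)^(-b) 2F1(b, 1-c+b; 1-a-n+b; 1/X).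
    Summing over n, each of the two parts becomes a prefactor independent of n
    times one absolutely convergent double series in 1/X = y/x and y
    ([yexp_split]).  Re-indexed by total degree in y this is a power series in
    y whose coefficients are a_1(m), respectively a_2(m) ([antidiagonal_sum],
    [coef1_dcoef], [coef2_dcoef]).  Its tail after N terms is O(|y|^N)
    ([Cps_tail]), and |(-x/y)^(-a)| is O(|y|^(Re a)).

    Connection formula ([connection]).  Let t = -X > 0.  Gauss' equation in t
    has the solution f = 2F1(a, b; c; -t), defined for t < 1, and the two
    Frobenius solutions at infinity.  The latter, summed in the variable
    v = 1/(1+t), are defined for all t > 0 ([frob]).  After multiplication by
    an explicit weight all Wronskians are constant ([wronskian_constant]), and
    Cramer's rule expresses f by the other two with Wronskians as coefficients.
    The Wronskian of the two Frobenius solutions is read off at t = oo.  Those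
    with f are read off at t = 0, that is v = 1, where Abel's theorem
    ([abel_comparison]) applied to coefficient quotients produces Gamma
    functions directly in the form of Gauss' limit.  This requires Re c > 0;
    [connection_lower] extends the formula to all c by means of the operator
    z d/dz + c.  Pfaff's transformation ([pfaff]) passes from v to 1/X.

    Continuation.  The y-Taylor coefficients of the given function are analytic
    in X on the cut plane ([ycoef_analytic]) and known on the unit disc.  The
    identity theorem, in a form that follows a path ([identity_along_path]),
    carries the connection formula along the negative axis
    ([ycoef_negative_axis]), then around the circle |X| = T to every admissible
    argument ([ycoef_infinity]), and finally, at fixed X, from small y to the
    whole disc on which the series in y converges ([Psi1_taylor]). *)

(** * Limits of complex-valued functions *)

Lemma Ceq_of_plus0 (z w : C) : (0 + z)%C = (0 + w)%C -> z = w.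
Proof. rewrite !Cplus_0_l. auto. Qed.

(* [sum_n] over C is typed in the abstract monoid structure, where [ring] does
   not recognise C. *)
Ltac Cring := apply Ceq_of_plus0; ring.

Lemma C_eq (z w : C) : Re z = Re w -> Im z = Im w -> z = w.
Proof. destruct z, w; simpl; congruence. Qed.

Lemma Re_minus (z w : C) : Re (z - w)%C = Re z - Re w.
Proof. reflexivity. Qed.

Lemma Im_minus (z w : C) : Im (z - w)%C = Im z - Im w.
Proof. reflexivity. Qed.

Lemma im_le_Cmod (z : C) : Rabs (Im z) <= Cmod z.
Proof. eapply Rle_trans; [|apply Rmax_Cmod]. apply Rmax_r. Qed.

Lemma Cmod_le_re_im (z : C) : Cmod z <= Rabs (Re z) + Rabs (Im z).
Proof.
  destruct z as [x y]. simpl.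
  replace (x, y) with (RtoC x + Ci * RtoC y)%C
    by (apply C_eq; unfold Ci, RtoC, Cplus, Cmult; simpl; ring).
  eapply Rle_trans; [apply Cmod_triangle|].
  rewrite Cmod_mult, Cmod_Ci, !Cmod_R. lra.
Qed.

Lemma Cmod_minus_sym (z w : C) : Cmod (z - w) = Cmod (w - z).
Proof. rewrite <- Cmod_opp. f_equal. ring. Qed.

Lemma Cmod_triangle_rev (z w : C) : Cmod z - Cmod w <= Cmod (z - w).
Proof.
  assert (H := Cmod_triangle (z - w) w).
  replace (z - w + w)%C with z in H by ring. lra.
Qed.

(** Convergence to [locally l], with the metric of the modulus in place of the
    product structure (see [Clim_filterlim]). *)
Definition Clim {T} (F : (T -> Prop) -> Prop) (f : T -> C) (l : C) : Prop :=
  forall eps, 0 < eps -> F (fun x => Cmod (f x - l) < eps).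

Section Clim.
Context {T : Type} (F : (T -> Prop) -> Prop) {FF : Filter F}.

Lemma Clim_filterlim (f : T -> C) (l : C) :
  Clim F f l <-> filterlim f F (locally l).
Proof.
  split; intros H.
  - intros P [eps HP]. unfold filtermap.
    apply (filter_imp (fun x => Cmod (f x - l) < eps)).
    + intros x Hx. apply HP. apply C_NormedModule_mixin_compat1. exact Hx.
    + apply H, cond_pos.
  - intros eps Heps.
    assert (He : 0 < eps / sqrt 2)
      by (apply Rdiv_lt_0_compat; [exact Heps|apply sqrt_lt_R0; lra]).
    apply (H (fun y => Cmod (y - l) < eps)).
    exists (mkposreal _ He). intros y Hy.
    apply C_NormedModule_mixin_compat2 in Hy. simpl in Hy.
    replace eps with (sqrt 2 * (eps / sqrt 2)). exact Hy.
    field. apply Rgt_not_eq, sqrt_lt_R0; lra.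
Qed.

Lemma Clim_ext_loc (f g : T -> C) (l : C) :
  F (fun x => f x = g x) -> Clim F f l -> Clim F g l.
Proof.
  intros He Hf eps Heps. generalize (filter_and _ _ He (Hf eps Heps)).
  apply filter_imp. intros x [-> H]; exact H.
Qed.

Lemma Clim_ext (f g : T -> C) (l : C) :
  (forall x, f x = g x) -> Clim F f l -> Clim F g l.
Proof. intros He. apply Clim_ext_loc, filter_forall, He. Qed.

Lemma Clim_const (l : C) : Clim F (fun _ => l) l.
Proof.
  intros eps Heps. apply filter_forall. intros _.
  replace (l - l)%C with (RtoC 0) by ring. rewrite Cmod_0. exact Heps.
Qed.

Lemma Clim_squeeze (f : T -> C) (l : C) (g : T -> R) :
  F (fun x => Cmod (f x - l) <= g x) -> filterlim g F (locally 0) -> Clim F f l.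
Proof.
  intros Hb Hg eps Heps.
  assert (H : F (fun x => Rabs (g x) < eps)).
  { apply (Hg (fun y => Rabs y < eps)). exists (mkposreal _ Heps).
    intros y Hy. unfold ball in Hy; simpl in Hy. unfold AbsRing_ball in Hy.
    unfold minus, plus, opp, abs in Hy; simpl in Hy.
    rewrite Ropp_0, Rplus_0_r in Hy. exact Hy. }
  generalize (filter_and _ _ Hb H). apply filter_imp. intros x [H1 H2].
  assert (H3 := Rle_abs (g x)). lra.
Qed.

Lemma Clim_plus (f g : T -> C) (l m : C) :
  Clim F f l -> Clim F g m -> Clim F (fun x => f x + g x)%C (l + m)%C.
Proof.
  intros Hf Hg eps Heps.
  assert (He : 0 < eps / 2) by lra.
  generalize (filter_and _ _ (Hf (eps / 2) He) (Hg (eps / 2) He)).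
  apply filter_imp. intros x [H1 H2].
  replace (f x + g x - (l + m))%C with ((f x - l) + (g x - m))%C by ring.
  assert (H := Cmod_triangle (f x - l) (g x - m)). lra.
Qed.

Lemma Clim_mult (f g : T -> C) (l m : C) :
  Clim F f l -> Clim F g m -> Clim F (fun x => f x * g x)%C (l * m)%C.
Proof.
  intros Hf Hg eps Heps.
  set (K := Cmod l + Cmod m + 1).
  assert (Hl := Cmod_ge_0 l); assert (Hm := Cmod_ge_0 m).
  assert (HK : 0 < K) by (unfold K; lra).
  set (d := Rmin 1 (eps / (2 * K))).
  assert (Hd : 0 < d).
  { apply Rmin_glb_lt; [lra|]. apply Rdiv_lt_0_compat; lra. }
  assert (Hd1 : d <= 1) by apply Rmin_l.
  assert (Hd2 : d * K <= eps / 2).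
  { apply Rle_trans with (eps / (2 * K) * K).
    - apply Rmult_le_compat_r; [lra|apply Rmin_r].
    - right; field; lra. }
  generalize (filter_and _ _ (Hf d Hd) (Hg d Hd)).
  apply filter_imp. intros x [H1 H2].
  replace (f x * g x - l * m)%C
    with ((f x - l) * (g x - m) + ((f x - l) * m + l * (g x - m)))%C by ring.
  eapply Rle_lt_trans; [apply Cmod_triangle|].
  eapply Rle_lt_trans; [apply Rplus_le_compat_l, Cmod_triangle|].
  rewrite !Cmod_mult.
  assert (G1 := Cmod_ge_0 (f x - l)); assert (G2 := Cmod_ge_0 (g x - m)).
  unfold K in Hd2. nra.
Qed.

Lemma Clim_opp (f : T -> C) (l : C) : Clim F f l -> Clim F (fun x => - f x)%C (- l)%C.
Proof.
  intros Hf eps Heps. generalize (Hf eps Heps). apply filter_imp. intros x H.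
  replace (- f x - - l)%C with (- (f x - l))%C by ring. now rewrite Cmod_opp.
Qed.

Lemma Clim_minus (f g : T -> C) (l m : C) :
  Clim F f l -> Clim F g m -> Clim F (fun x => f x - g x)%C (l - m)%C.
Proof. intros Hf Hg. apply Clim_plus; [exact Hf|]. now apply Clim_opp. Qed.

Lemma Clim_inv (f : T -> C) (l : C) :
  l <> 0 -> Clim F f l -> Clim F (fun x => / f x)%C (/ l)%C.
Proof.
  intros Hl Hf eps Heps.
  assert (Hm : 0 < Cmod l) by now apply Cmod_gt_0.
  set (d := Rmin (Cmod l / 2) (eps * (Cmod l * Cmod l) / 2)).
  assert (Hd : 0 < d).
  { apply Rmin_glb_lt; [lra|]. apply Rdiv_lt_0_compat; [|lra].
    apply Rmult_lt_0_compat; nra. }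
  generalize (Hf d Hd). apply filter_imp. intros x H1.
  assert (D1 : d <= Cmod l / 2) by apply Rmin_l.
  assert (D2 : d <= eps * (Cmod l * Cmod l) / 2) by apply Rmin_r.
  assert (H2 := Cmod_triangle_rev l (f x)). rewrite Cmod_minus_sym in H2.
  assert (Hx : Cmod l / 2 < Cmod (f x)) by lra.
  assert (Hx0 : f x <> 0) by (apply Cmod_gt_0; lra).
  replace (/ f x - / l)%C with ((l - f x) * / (f x * l))%C by now field.
  rewrite Cmod_mult, Cmod_inv, Cmod_mult by now apply Cmult_neq_0.
  rewrite Cmod_minus_sym.
  apply Rmult_lt_reg_r with (Cmod (f x) * Cmod l); [nra|].
  rewrite Rmult_assoc, Rinv_l, Rmult_1_r by nra.
  apply Rlt_le_trans with d; [exact H1|]. apply Rle_trans with (1:=D2).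
  assert (0 < eps * Cmod l) by nra. nra.
Qed.

Lemma Clim_Lipschitz (phi : C -> R) (f : T -> C) (l : C) :
  (forall z w, Rabs (phi z - phi w) <= Cmod (z - w)) ->
  Clim F f l -> filterlim (fun x => phi (f x)) F (locally (phi l)).
Proof.
  intros Hphi Hf P [eps HP]. unfold filtermap.
  generalize (Hf eps (cond_pos eps)). apply filter_imp. intros x Hx. apply HP.
  eapply Rle_lt_trans; [apply Hphi|exact Hx].
Qed.

Lemma Clim_Re (f : T -> C) (l : C) :
  Clim F f l -> filterlim (fun x => Re (f x)) F (locally (Re l)).
Proof. apply (Clim_Lipschitz Re). intros z w. rewrite <- Re_minus. apply re_le_Cmod. Qed.

Lemma Clim_Im (f : T -> C) (l : C) :
  Clim F f l -> filterlim (fun x => Im (f x)) F (locally (Im l)).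
Proof. apply (Clim_Lipschitz Im). intros z w. rewrite <- Im_minus. apply im_le_Cmod. Qed.

Lemma Clim_Cmod (f : T -> C) (l : C) :
  Clim F f l -> filterlim (fun x => Cmod (f x)) F (locally (Cmod l)).
Proof.
  apply (Clim_Lipschitz Cmod). intros z w.
  assert (H1 := Cmod_triangle_rev z w). assert (H2 := Cmod_triangle_rev w z).
  rewrite Cmod_minus_sym in H2. apply Rabs_le. lra.
Qed.

Lemma Clim_Re_Im (f : T -> C) (l : C) :
  filterlim (fun x => Re (f x)) F (locally (Re l)) ->
  filterlim (fun x => Im (f x)) F (locally (Im l)) -> Clim F f l.
Proof.
  intros Hr Hi eps Heps.
  assert (He : 0 < eps / 2) by lra.
  assert (H1 : F (fun x => ball (Re l) (eps/2) (Re (f x))))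
    by (apply (Hr (fun y => ball (Re l) (eps/2) y)); now exists (mkposreal _ He)).
  assert (H2 : F (fun x => ball (Im l) (eps/2) (Im (f x))))
    by (apply (Hi (fun y => ball (Im l) (eps/2) y)); now exists (mkposreal _ He)).
  generalize (filter_and _ _ H1 H2). apply filter_imp.
  unfold ball; simpl; unfold AbsRing_ball, minus, plus, opp, abs; simpl.
  intros x [G1 G2].
  eapply Rle_lt_trans; [apply Cmod_le_re_im|]. simpl.
  unfold Re, Im in *. lra.
Qed.

Lemma Clim_RtoC (f : T -> R) (l : R) :
  filterlim f F (locally l) -> Clim F (fun x => RtoC (f x)) (RtoC l).
Proof.
  intros H. apply Clim_Re_Im; simpl; [exact H|]. apply filterlim_const.
Qed.

End Clim.

(* The hypotheses are matched syntactically: unifying two different limits up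
   to conversion would unfold the series inside them. *)
Ltac clim :=
  match goal with
  | |- Filter _ => typeclasses eauto
  | H : Clim ?F ?f ?l |- Clim ?F ?f ?l => exact H
  | |- Clim _ (fun _ => ?l) ?l => apply Clim_const; clim
  | |- Clim _ (fun _ => (_ + _)%C) _ => apply Clim_plus; clim
  | |- Clim _ (fun _ => (_ - _)%C) _ => apply Clim_minus; clim
  | |- Clim _ (fun _ => (_ * _)%C) _ => apply Clim_mult; clim
  | |- Clim _ (fun _ => (- _)%C) _ => apply Clim_opp; clim
  | |- _ => idtac
  end.

Lemma Clim_unique {T} (F : (T -> Prop) -> Prop) {FF : ProperFilter F}
  (f : T -> C) (l m : C) : Clim F f l -> Clim F f m -> l = m.
Proof.
  intros Hl Hm.
  assert (Hz : Cmod (l - m) = 0).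
  { apply Rle_antisym; [|apply Cmod_ge_0]. apply Rnot_lt_le. intros Hlt.
    assert (He : 0 < Cmod (l - m) / 2) by lra.
    destruct (filter_ex _ (filter_and _ _ (Hl _ He) (Hm _ He))) as [x [H1 H2]].
    assert (H := Cmod_triangle (l - f x) (f x - m)).
    replace (l - f x + (f x - m))%C with (l - m)%C in H by ring.
    rewrite (Cmod_minus_sym l (f x)) in H. lra. }
  apply Cmod_eq_0 in Hz. replace l with (l - m + m)%C by ring. rewrite Hz. ring.
Qed.

Lemma Clim_comp {T U} (F : (T -> Prop) -> Prop) (G : (U -> Prop) -> Prop)
  (h : T -> U) (f : U -> C) (l : C) :
  filterlim h F G -> Clim G f l -> Clim F (fun x => f (h x)) l.
Proof. intros Hh Hf eps Heps. exact (Hh _ (Hf eps Heps)). Qed.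

(** * Absolutely convergent series *)

Definition summable (u : nat -> C) : Prop := ex_series (fun n => Cmod (u n)).

(** A total sum, as [Series]; it is meaningful for [summable] families. *)
Definition CSeries (u : nat -> C) : C :=
  (Series (fun n => Re (u n)), Series (fun n => Im (u n))).

Lemma sum_n_C (u : nat -> C) (n : nat) :
  sum_n u n = (sum_n (fun k => Re (u k)) n, sum_n (fun k => Im (u k)) n).
Proof.
  induction n as [|n IH].
  - rewrite !sum_O. now destruct (u 0%nat).
  - rewrite !sum_Sn, IH. reflexivity.
Qed.

Lemma sum_n_Cplus_S (u : nat -> C) (n : nat) :
  sum_n u (S n) = (sum_n u n + u (S n))%C.
Proof. rewrite sum_Sn. reflexivity. Qed.

Lemma sum_n_R_S (u : nat -> R) (n : nat) : sum_n u (S n) = sum_n u n + u (S n).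
Proof. rewrite sum_Sn. reflexivity. Qed.

Lemma summable_Re (u : nat -> C) : summable u -> ex_series (fun n => Re (u n)).
Proof. apply (ex_series_le (V := R_CompleteNormedModule)). intros n. apply re_le_Cmod. Qed.

Lemma summable_Im (u : nat -> C) : summable u -> ex_series (fun n => Im (u n)).
Proof. apply (ex_series_le (V := R_CompleteNormedModule)). intros n. apply im_le_Cmod. Qed.

Lemma CSeries_correct (u : nat -> C) : summable u -> Clim eventually (sum_n u) (CSeries u).
Proof.
  intros Hu.
  apply (Clim_Re_Im eventually); unfold CSeries.
  - apply filterlim_ext with (sum_n (fun k => Re (u k))).
    { intros n. now rewrite sum_n_C. }
    apply (Series_correct _ (summable_Re u Hu)).
  - apply filterlim_ext with (sum_n (fun k => Im (u k))).
    { intros n. now rewrite sum_n_C. }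
    apply (Series_correct _ (summable_Im u Hu)).
Qed.

Lemma CSeries_unique (u : nat -> C) (s : C) :
  summable u -> Clim eventually (sum_n u) s -> CSeries u = s.
Proof.
  intros Hu Hs. apply (Clim_unique eventually (sum_n u)); [|exact Hs].
  now apply CSeries_correct.
Qed.

Lemma CSeries_ext (u v : nat -> C) : (forall n, u n = v n) -> CSeries u = CSeries v.
Proof.
  intros H. unfold CSeries. f_equal; apply Series_ext; intros n; now rewrite H.
Qed.

Lemma summable_ext (u v : nat -> C) : (forall n, u n = v n) -> summable u -> summable v.
Proof. intros H. apply ex_series_ext. intros n; now rewrite H. Qed.

Lemma summable_le (u : nat -> C) (b : nat -> R) :
  (forall n, Cmod (u n) <= b n) -> ex_series b -> summable u.
Proof.
  intros H. apply (ex_series_le (V := R_CompleteNormedModule)). intros n.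
  unfold norm; simpl. unfold abs; simpl. rewrite Rabs_pos_eq; [apply H|apply Cmod_ge_0].
Qed.

Lemma summable_plus (u v : nat -> C) : summable u -> summable v -> summable (fun n => u n + v n)%C.
Proof.
  intros Hu Hv. apply summable_le with (fun n => Cmod (u n) + Cmod (v n)).
  - intros n. apply Cmod_triangle.
  - now apply (ex_series_plus (V := R_NormedModule)).
Qed.

Lemma summable_scal (c : C) (u : nat -> C) : summable u -> summable (fun n => c * u n)%C.
Proof.
  intros Hu. apply summable_le with (fun n => scal (Cmod c) (Cmod (u n))).
  - intros n. rewrite Cmod_mult. apply Rle_refl.
  - now apply (ex_series_scal (V := R_NormedModule)).
Qed.

Lemma CSeries_plus (u v : nat -> C) : summable u -> summable v ->
  CSeries (fun n => u n + v n)%C = (CSeries u + CSeries v)%C.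
Proof.
  intros Hu Hv. apply C_eq; simpl.
  - apply Series_plus; now apply summable_Re.
  - apply Series_plus; now apply summable_Im.
Qed.

Lemma sum_n_Cscal (c : C) (u : nat -> C) n :
  sum_n (fun k => c * u k)%C n = (c * sum_n u n)%C.
Proof.
  induction n as [|n IH]; [now rewrite !sum_O|].
  rewrite !sum_n_Cplus_S, IH. Cring.
Qed.

Lemma CSeries_scal (c : C) (u : nat -> C) : summable u ->
  CSeries (fun n => c * u n)%C = (c * CSeries u)%C.
Proof.
  intros Hu. apply CSeries_unique; [now apply summable_scal|].
  apply (Clim_ext eventually (fun n => c * sum_n u n)%C).
  { intros n. symmetry; apply sum_n_Cscal. }
  clim. now apply CSeries_correct.
Qed.

Lemma Cmod_sum_n (u : nat -> C) n : Cmod (sum_n u n) <= sum_n (fun k => Cmod (u k)) n.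
Proof.
  induction n as [|n IH]; [rewrite !sum_O; apply Rle_refl|].
  rewrite sum_n_Cplus_S, sum_n_R_S. eapply Rle_trans; [apply Cmod_triangle|]. lra.
Qed.

Lemma filterlim_le_R {T} (F : (T -> Prop) -> Prop) {FF : ProperFilter F}
  (f : T -> R) (l M : R) :
  F (fun x => f x <= M) -> filterlim f F (locally l) -> l <= M.
Proof.
  intros H Hf. apply Rnot_lt_le. intros Hlt.
  assert (He : 0 < l - M) by lra.
  assert (H1 : F (fun x => ball l (l - M) (f x)))
    by (apply (Hf (fun y => ball l (l-M) y)); now exists (mkposreal _ He)).
  destruct (filter_ex _ (filter_and _ _ H H1)) as [x [G1 G2]].
  unfold ball in G2; simpl in G2; unfold AbsRing_ball, minus, plus, opp, abs in G2; simpl in G2.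
  apply Rabs_def2 in G2. lra.
Qed.

Lemma Clim_Cmod_le {T} (F : (T -> Prop) -> Prop) {FF : ProperFilter F}
  (f : T -> C) (l : C) (M : R) :
  F (fun x => Cmod (f x) <= M) -> Clim F f l -> Cmod l <= M.
Proof.
  intros H Hf. apply (filterlim_le_R F (fun x => Cmod (f x))); [exact H|].
  apply Clim_Cmod; [typeclasses eauto|exact Hf].
Qed.

Lemma sum_n_nonneg (a : nat -> R) n : (forall k, 0 <= a k) -> 0 <= sum_n a n.
Proof.
  intros H. induction n as [|n IH]; [rewrite sum_O; apply H|].
  rewrite sum_n_R_S. assert (Hgen := H (S n)). lra.
Qed.

Lemma sum_n_incr (a : nat -> R) n m :
  (forall k, 0 <= a k) -> (n <= m)%nat -> sum_n a n <= sum_n a m.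
Proof.
  intros H Hm. induction Hm as [|m Hm IH]; [apply Rle_refl|].
  rewrite sum_n_R_S. assert (Hgen := H (S m)). lra.
Qed.

Lemma sum_n_le_Series (a : nat -> R) n :
  (forall k, 0 <= a k) -> ex_series a -> sum_n a n <= Series a.
Proof.
  intros H Ha. apply (is_lim_seq_incr_compare (sum_n a) (Series a)).
  - exact (Series_correct a Ha).
  - intros k. apply sum_n_incr; [exact H|lia].
Qed.

Lemma ex_series_bounded (a : nat -> R) (M : R) :
  (forall n, 0 <= a n) -> (forall n, sum_n a n <= M) -> ex_series a.
Proof.
  intros H0 HM.
  destruct (ex_finite_lim_seq_incr (sum_n a) M) as [l Hl].
  - intros n. apply sum_n_incr; [exact H0|lia].
  - exact HM.
  - exists l. exact Hl.
Qed.

Lemma Cmod_CSeries (u : nat -> C) : summable u ->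
  Cmod (CSeries u) <= Series (fun n => Cmod (u n)).
Proof.
  intros Hu. apply (Clim_Cmod_le eventually (sum_n u)); [|now apply CSeries_correct].
  exists 0%nat. intros n _. eapply Rle_trans; [apply Cmod_sum_n|].
  apply (sum_n_le_Series (fun k => Cmod (u k))); [|exact Hu].
  intros; apply Cmod_ge_0.
Qed.

Lemma Cmod_CSeries_le (u : nat -> C) (b : nat -> R) :
  (forall n, Cmod (u n) <= b n) -> ex_series b -> Cmod (CSeries u) <= Series b.
Proof.
  intros H Hb. eapply Rle_trans; [apply Cmod_CSeries; now apply summable_le with b|].
  apply Series_le; [|exact Hb]. intros n; split; [apply Cmod_ge_0|apply H].
Qed.

Lemma summable_incr_1 (u : nat -> C) : summable u <-> summable (fun n => u (S n)).
Proof. apply (ex_series_incr_1 (V := R_NormedModule) (fun n => Cmod (u n))). Qed.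

Lemma CSeries_incr_1 (u : nat -> C) : summable u ->
  CSeries u = (u 0%nat + CSeries (fun n => u (S n)))%C.
Proof.
  intros Hu. apply C_eq; simpl.
  - apply (Series_incr_1 (fun n => Re (u n))). now apply summable_Re.
  - apply (Series_incr_1 (fun n => Im (u n))). now apply summable_Im.
Qed.

Lemma summable_finite (u : nat -> C) (m : nat) : (forall n, (m < n)%nat -> u n = 0) -> summable u.
Proof.
  intros H. apply (ex_series_bounded _ (sum_n (fun k => Cmod (u k)) m)).
  { intros; apply Cmod_ge_0. }
  intros n. destruct (le_lt_dec n m) as [Hn|Hn].
  - apply sum_n_incr; [intros; apply Cmod_ge_0|exact Hn].
  - induction Hn as [|n Hn IH].
    + rewrite sum_n_R_S, (H (S m)), Cmod_0 by lia. lra.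
    + rewrite sum_n_R_S, (H (S n)), Cmod_0 by lia. lra.
Qed.

Lemma CSeries_finite (u : nat -> C) (m : nat) :
  (forall n, (m < n)%nat -> u n = 0) -> CSeries u = sum_n u m.
Proof.
  intros H. apply CSeries_unique; [now apply summable_finite with m|].
  apply (Clim_ext_loc eventually (fun _ => sum_n u m)); [|clim].
  exists m. intros n Hn. induction Hn as [|n Hn IH]; [reflexivity|].
  rewrite sum_n_Cplus_S, (H (S n)), <- IH by lia. Cring.
Qed.

Lemma CSeries_zero (u : nat -> C) : (forall n, u n = 0) -> CSeries u = 0.
Proof. intros H. rewrite (CSeries_finite u 0) by auto. rewrite sum_O. apply H. Qed.

Lemma summable_shift (u : nat -> C) (k : nat) :
  summable (fun n => u (k + n)%nat) -> summable u.
Proof.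
  revert u. induction k as [|k IH]; intros u H; [exact H|].
  apply summable_incr_1. apply IH. exact H.
Qed.

Lemma CSeries_shift (u : nat -> C) (k : nat) :
  (forall n, (n < k)%nat -> u n = 0) -> summable (fun n => u (k + n)%nat) ->
  CSeries u = CSeries (fun n => u (k + n)%nat).
Proof.
  revert u. induction k as [|k IH]; intros u H Ha; [reflexivity|].
  rewrite CSeries_incr_1 by now apply summable_shift with (S k).
  rewrite H by lia. rewrite (IH (fun n => u (S n))).
  - ring_simplify. reflexivity.
  - intros n Hn. apply H. lia.
  - exact Ha.
Qed.

(** * Absolutely convergent double series *)

Definition square {V : AbelianMonoid} (u : nat -> nat -> V) (n : nat) : V :=
  sum_n (fun i => sum_n (fun j => u i j) n) n.

(** The bound on square partial sums is the form in which absolute convergence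
    enters [is_double_series]; it is visibly symmetric in the two indices. *)
Definition summable2 (u : nat -> nat -> C) : Prop :=
  exists M, forall n, square (V := R_AbelianMonoid) (fun i j => Cmod (u i j)) n <= M.

Lemma square_incr (a : nat -> nat -> R) n m :
  (forall i j, 0 <= a i j) -> (n <= m)%nat ->
  square (V := R_AbelianMonoid) a n <= square (V := R_AbelianMonoid) a m.
Proof.
  intros H Hnm. unfold square.
  apply Rle_trans with (sum_n (fun i => sum_n (fun j => a i j) m) n).
  - apply sum_n_m_le. intros i. apply sum_n_incr; auto.
  - apply sum_n_incr; [|exact Hnm]. intros i. now apply sum_n_nonneg.
Qed.

Lemma term_le_sum_n (a : nat -> R) n k :
  (forall i, 0 <= a i) -> (k <= n)%nat -> a k <= sum_n a n.
Proof.
  intros H Hk. apply Rle_trans with (sum_n a k); [|now apply sum_n_incr].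
  destruct k; [rewrite sum_O; apply Rle_refl|].
  rewrite sum_n_R_S. assert (Hgen := sum_n_nonneg a k H). lra.
Qed.

Lemma summable2_le (u : nat -> nat -> C) (b : nat -> nat -> R) (M : R) :
  (forall i j, Cmod (u i j) <= b i j) ->
  (forall n, square (V := R_AbelianMonoid) b n <= M) -> summable2 u.
Proof.
  intros H HM. exists M. intros n. eapply Rle_trans; [|apply (HM n)].
  apply sum_n_m_le. intros i. apply sum_n_m_le. intros j. apply H.
Qed.

Lemma summable2_sym (u : nat -> nat -> C) : summable2 u -> summable2 (fun i j => u j i).
Proof.
  intros [M HM]. exists M. intros n. unfold square. rewrite sum_n_switch. apply HM.
Qed.

Lemma summable2_row (u : nat -> nat -> C) : summable2 u -> forall i, summable (u i).
Proof.
  intros [M HM] i.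
  apply (ex_series_bounded _ M); [intros; apply Cmod_ge_0|].
  intros n. set (K := max i n).
  apply Rle_trans with (2 := HM K).
  apply Rle_trans with (sum_n (fun j => Cmod (u i j)) K).
  - apply sum_n_incr; [intros; apply Cmod_ge_0|unfold K; lia].
  - apply (term_le_sum_n (fun i => sum_n (fun j => Cmod (u i j)) K) K i);
      [|unfold K; lia].
    intros; apply sum_n_nonneg. intros; apply Cmod_ge_0.
Qed.

Lemma sum_n_filterlim (f : nat -> nat -> R) (l : nat -> R) n :
  (forall i, filterlim (f i) eventually (locally (l i))) ->
  filterlim (fun J => sum_n (fun i => f i J) n) eventually (locally (sum_n l n)).
Proof.
  intros H. induction n as [|n IH].
  - rewrite sum_O. apply filterlim_ext with (2 := H 0%nat). intros; now rewrite sum_O.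
  - rewrite sum_Sn.
    apply filterlim_ext with (fun J => plus (sum_n (fun i => f i J) n) (f (S n) J)).
    { intros J. now rewrite sum_Sn. }
    eapply filterlim_comp_2; [exact IH|apply H|].
    apply (filterlim_plus (V := R_NormedModule)).
Qed.

Lemma summable2_rows (u : nat -> nat -> C) : summable2 u ->
  ex_series (fun i => Series (fun j => Cmod (u i j))).
Proof.
  intros Hu. destruct (Hu) as [M HM].
  assert (P : forall i j, 0 <= Cmod (u i j)) by (intros; apply Cmod_ge_0).
  apply (ex_series_bounded _ M).
  - intros i. apply Rle_trans with (sum_n (fun j => Cmod (u i j)) 0).
    + rewrite sum_O; apply P.
    + apply sum_n_le_Series; [auto|]. apply (summable2_row u Hu i).
  - intros n.
    apply (filterlim_le_R eventually
      (fun J => sum_n (fun i => sum_n (fun j => Cmod (u i j)) J) n)).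
    + exists n. intros J HJ. apply Rle_trans with (2 := HM J). unfold square.
      apply sum_n_incr; [|exact HJ]. intros; now apply sum_n_nonneg.
    + apply (sum_n_filterlim (fun i J => sum_n (fun j => Cmod (u i j)) J)).
      intros i. apply (Series_correct _ (summable2_row u Hu i)).
Qed.

Lemma summable2_rows_summable (u : nat -> nat -> C) : summable2 u -> summable (fun i => CSeries (u i)).
Proof.
  intros Hu. apply summable_le with (2 := summable2_rows u Hu).
  intros i. apply Cmod_CSeries. now apply summable2_row.
Qed.

Lemma sum_n_Clim (f : nat -> nat -> C) (l : nat -> C) n :
  (forall i, Clim eventually (f i) (l i)) ->
  Clim eventually (fun J => sum_n (fun i => f i J) n) (sum_n l n).
Proof.
  intros H. induction n as [|n IH].
  - rewrite sum_O. apply Clim_ext with (3 := H 0%nat); [typeclasses eauto|].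
    intros; now rewrite sum_O.
  - rewrite sum_n_Cplus_S.
    apply (Clim_ext eventually (fun J => sum_n (fun i => f i J) n + f (S n) J)%C).
    { intros J. now rewrite sum_n_Cplus_S. }
    clim. apply H.
Qed.

Lemma sum_n_Cminus (u v : nat -> C) n :
  (sum_n u n - sum_n v n)%C = sum_n (fun k => u k - v k)%C n.
Proof.
  induction n as [|n IH]; [now rewrite !sum_O|].
  rewrite !sum_n_Cplus_S, <- IH. Cring.
Qed.

Lemma sum_n_Rminus (u v : nat -> R) n :
  sum_n u n - sum_n v n = sum_n (fun k => u k - v k) n.
Proof.
  induction n as [|n IH]; [now rewrite !sum_O|].
  rewrite !sum_n_R_S, <- IH. ring.
Qed.

Lemma sum_n_tail_le (u : nat -> C) n J : (n <= J)%nat ->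
  Cmod (sum_n u J - sum_n u n)
  <= sum_n (fun k => Cmod (u k)) J - sum_n (fun k => Cmod (u k)) n.
Proof.
  intros H. induction H as [|J H IH].
  - replace (sum_n u n - sum_n u n)%C with (RtoC 0) by ring. rewrite Cmod_0. lra.
  - rewrite sum_n_Cplus_S, sum_n_R_S.
    replace (sum_n u J + u (S J) - sum_n u n)%C
      with ((sum_n u J - sum_n u n) + u (S J))%C by ring.
    assert (H1 := Cmod_triangle (sum_n u J - sum_n u n) (u (S J))). lra.
Qed.

(** What a square misses of its first n rows is bounded by what the squares of
    the moduli still gain, and this tends to 0. *)
Lemma summable2_square (u : nat -> nat -> C) : summable2 u ->
  Clim eventually (square (V := C_AbelianMonoid) u) (CSeries (fun i => CSeries (u i))).
Proof.
  intros Hu. destruct (Hu) as [M HM].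
  assert (P : forall i j, 0 <= Cmod (u i j)) by (intros; apply Cmod_ge_0).
  set (A := square (V := R_AbelianMonoid) (fun i j => Cmod (u i j))) in *.
  destruct (ex_finite_lim_seq_incr A M) as [L HL].
  { intros n. apply square_incr; [exact P|lia]. }
  { exact HM. }
  assert (HAL : forall n, A n <= L).
  { intros n. apply (is_lim_seq_incr_compare A L HL).
    intros k. apply square_incr; [exact P|lia]. }
  assert (Hd : forall n, Cmod (sum_n (fun i => CSeries (u i)) n
                 - square (V := C_AbelianMonoid) u n) <= L - A n).
  { intros n.
    apply (Clim_Cmod_le eventually
      (fun J => sum_n (fun i => sum_n (u i) J) n - square (V := C_AbelianMonoid) u n)%C).
    - exists n. intros J HJ. apply Rle_trans with (A J - A n).
      2:{ assert (Hgen := HAL J). lra. }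
      apply Rle_trans with
        (sum_n (fun i => sum_n (fun j => Cmod (u i j)) J) n - A n).
      + unfold A, square. rewrite sum_n_Cminus, sum_n_Rminus.
        eapply Rle_trans; [apply Cmod_sum_n|].
        apply sum_n_m_le. intros i. apply sum_n_tail_le; exact HJ.
      + apply Rplus_le_compat_r. unfold A, square.
        apply sum_n_incr; [|exact HJ]. intros; now apply sum_n_nonneg.
    - clim.
      apply (sum_n_Clim (fun i J => sum_n (u i) J)). intros i.
      apply CSeries_correct. now apply summable2_row. }
  apply (Clim_ext eventually (fun n =>
     sum_n (fun i => CSeries (u i)) n
     - (sum_n (fun i => CSeries (u i)) n - square (V := C_AbelianMonoid) u n))%C).
  { intros n; ring. }
  replace (CSeries (fun i => CSeries (u i)))
    with (CSeries (fun i => CSeries (u i)) - 0)%C by ring.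
  clim.
  - apply CSeries_correct. now apply summable2_rows_summable.
  - apply Clim_squeeze with (fun n => L - A n); [typeclasses eauto| |].
    + exists 0%nat. intros n _.
      match goal with |- Cmod ?x <= _ =>
        replace x with (sum_n (fun i => CSeries (u i)) n - square (V := C_AbelianMonoid) u n)%C by ring end.
      apply Hd.
    + change (is_lim_seq (fun n => L - A n) 0).
      replace (Finite 0) with (Finite (L - L)) by (f_equal; ring).
      apply is_lim_seq_minus'; [apply is_lim_seq_const|exact HL].
Qed.

Lemma square_sym (u : nat -> nat -> C) n :
  square (V := C_AbelianMonoid) (fun i j => u j i) n = square (V := C_AbelianMonoid) u n.
Proof. unfold square. apply sum_n_switch. Qed.

(** Squares do not distinguish rows from columns, and they converge to both
    iterated sums. *)
Lemma Fubini (u : nat -> nat -> C) : summable2 u ->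
  CSeries (fun i => CSeries (fun j => u i j)) = CSeries (fun j => CSeries (fun i => u i j)).
Proof.
  intros Hu. apply (Clim_unique eventually (square (V := C_AbelianMonoid) u)).
  - exact (summable2_square u Hu).
  - apply (Clim_ext eventually (square (V := C_AbelianMonoid) (fun i j => u j i))).
    { intros n; apply square_sym. }
    apply (summable2_square (fun i j => u j i)). now apply summable2_sym.
Qed.

Lemma is_double_series_iff (u : nat -> nat -> C) (s : C) :
  is_double_series u s <-> summable2 u /\ s = CSeries (fun i => CSeries (u i)).
Proof.
  split.
  - intros [Hu Hs]. split; [exact Hu|].
    apply (Clim_unique eventually (square (V := C_AbelianMonoid) u)).
    + apply Clim_filterlim; [typeclasses eauto|exact Hs].
    + now apply summable2_square.
  - intros [Hu ->]. split; [exact Hu|].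
    apply Clim_filterlim; [typeclasses eauto|]. now apply summable2_square.
Qed.

Lemma summable2_of_rows (u : nat -> nat -> C) (b : nat -> R) :
  (forall i, summable (u i)) -> (forall i, Series (fun j => Cmod (u i j)) <= b i) ->
  ex_series b -> summable2 u.
Proof.
  intros Hr Hb Hs.
  assert (P : forall i j, 0 <= Cmod (u i j)) by (intros; apply Cmod_ge_0).
  assert (Hb0 : forall i, 0 <= b i).
  { intros i. apply Rle_trans with (2 := Hb i).
    apply Rle_trans with (sum_n (fun j => Cmod (u i j)) 0); [rewrite sum_O; apply P|].
    apply sum_n_le_Series; [auto|apply Hr]. }
  exists (Series b). intros n. unfold square.
  apply Rle_trans with (sum_n b n); [|now apply sum_n_le_Series].
  apply sum_n_m_le. intros i. apply Rle_trans with (2 := Hb i).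
  apply sum_n_le_Series; [auto|apply Hr].
Qed.

Lemma ex_series_geom_scal (M q : R) : Rabs q < 1 -> ex_series (fun n => M * q ^ n).
Proof.
  intros Hq. apply (ex_series_scal (V := R_NormedModule) M (fun n => q ^ n)).
  exists (/ (1 - q)). now apply is_series_geom.
Qed.

Lemma summable2_geom (u : nat -> nat -> C) (M q p : R) :
  0 <= q < 1 -> 0 <= p < 1 ->
  (forall i j, Cmod (u i j) <= M * q ^ i * p ^ j) -> summable2 u.
Proof.
  intros Hq Hp H.
  assert (Aq : Rabs q < 1) by (rewrite Rabs_pos_eq; lra).
  assert (Ap : Rabs p < 1) by (rewrite Rabs_pos_eq; lra).
  apply (summable2_of_rows u (fun i => (M / (1 - p)) * q ^ i)).
  - intros i. apply summable_le with (1 := H i). now apply ex_series_geom_scal.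
  - intros i.
    apply Rle_trans with (Series (fun j => M * q ^ i * p ^ j)).
    + apply Series_le; [|now apply ex_series_geom_scal].
      intros j; split; [apply Cmod_ge_0|apply H].
    + rewrite Series_scal_l, Series_geom by exact Ap. right. field. lra.
  - now apply ex_series_geom_scal.
Qed.

(** * Power series and the identity theorem *)

Definition Cps (p : nat -> C) (z : C) : C := CSeries (fun n => p n * z ^ n)%C.

Lemma Cpow_0_S (n : nat) : (RtoC 0 ^ S n)%C = 0.
Proof. rewrite Cpow_S. ring. Qed.

Lemma summable_pow_le (p : nat -> C) (w z : C) :
  Cmod z <= Cmod w -> summable (fun n => p n * w ^ n)%C -> summable (fun n => p n * z ^ n)%C.
Proof.
  intros H Hw. apply summable_le with (2 := Hw). intros n.
  rewrite !Cmod_mult, !Cmod_pow. apply Rmult_le_compat_l; [apply Cmod_ge_0|].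
  apply pow_incr. split; [apply Cmod_ge_0|exact H].
Qed.

Lemma summable_pow_geom (p : nat -> C) (M q : R) (z : C) :
  0 <= q -> (forall n, Cmod (p n) <= M * q ^ n) -> q * Cmod z < 1 ->
  summable (fun n => p n * z ^ n)%C.
Proof.
  intros Hq H Hz. assert (Hc := Cmod_ge_0 z).
  apply summable_le with (fun n => M * (q * Cmod z) ^ n).
  - intros n. rewrite Cmod_mult, Cmod_pow, Rpow_mult_distr, <- Rmult_assoc.
    apply Rmult_le_compat_r; [now apply pow_le|apply H].
  - apply ex_series_geom_scal. rewrite Rabs_pos_eq; [exact Hz|nra].
Qed.

Lemma Cps_shift (p : nat -> C) (z : C) :
  summable (fun n => p n * z ^ n)%C -> summable (fun n => p (S n) * z ^ n)%C ->
  Cps p z = (p 0%nat + z * Cps (fun n => p (S n)) z)%C.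
Proof.
  intros H H'. unfold Cps. rewrite CSeries_incr_1 by exact H.
  rewrite <- CSeries_scal by exact H'. f_equal; [simpl; ring|].
  apply CSeries_ext. intros n. rewrite Cpow_S. ring.
Qed.

Lemma summable_pow_shift (p : nat -> C) (z : C) :
  z <> 0 -> summable (fun n => p n * z ^ n)%C -> summable (fun n => p (S n) * z ^ n)%C.
Proof.
  intros Hz H. apply summable_incr_1 in H. apply (summable_scal (/ z)%C) in H.
  revert H. apply summable_ext. intros n. rewrite Cpow_S. now field.
Qed.

Lemma Cps_at_0 (p : nat -> C) : Cps p 0 = p 0%nat.
Proof.
  unfold Cps. rewrite (CSeries_finite _ 0%nat).
  - rewrite sum_O. simpl. ring.
  - intros [|n] Hn; [lia|]. rewrite Cpow_0_S. ring.
Qed.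

Lemma Cps_near_0 (p : nat -> C) (w : C) : w <> 0 -> summable (fun n => p n * w ^ n)%C ->
  exists B, 0 <= B /\
    forall z, Cmod z <= Cmod w -> Cmod (Cps p z - p 0%nat) <= B * Cmod z.
Proof.
  intros Hw0 Hw.
  assert (Hw' := summable_pow_shift p w Hw0 Hw).
  exists (Series (fun n => Cmod (p (S n) * w ^ n))). split.
  - apply Rle_trans with (2 := Cmod_CSeries _ Hw'). apply Cmod_ge_0.
  - intros z Hz. rewrite Cps_shift by now apply summable_pow_le with w.
    replace (p 0%nat + z * Cps (fun n => p (S n)) z - p 0%nat)%C
      with (z * Cps (fun n => p (S n)) z)%C by ring.
    rewrite Cmod_mult, Rmult_comm. apply Rmult_le_compat_r; [apply Cmod_ge_0|].
    apply Cmod_CSeries_le; [|exact Hw']. intros n.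
    rewrite !Cmod_mult, !Cmod_pow. apply Rmult_le_compat_l; [apply Cmod_ge_0|].
    apply pow_incr. split; [apply Cmod_ge_0|exact Hz].
Qed.

(** Were p_0 nonzero, |p_0| <= B |z| would exclude zeros near 0. *)
Lemma Cps_zeros_head (p : nat -> C) (w : C) :
  w <> 0 -> summable (fun n => p n * w ^ n)%C ->
  (forall eps, 0 < eps -> exists z, 0 < Cmod z < eps /\ Cps p z = 0) ->
  p 0%nat = 0.
Proof.
  intros Hw0 Hw Hz.
  destruct (Cps_near_0 p w Hw0 Hw) as [B [HB0 HB]].
  apply Cmod_eq_0. apply Rle_antisym; [|apply Cmod_ge_0].
  apply Rnot_lt_le. intros Hlt.
  assert (Hwp : 0 < Cmod w) by now apply Cmod_gt_0.
  destruct (Hz (Rmin (Cmod w) (Cmod (p 0%nat) / (B + 1)))) as [z [[Hz1 Hz2] Hz3]].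
  { apply Rmin_glb_lt; [exact Hwp|]. apply Rdiv_lt_0_compat; lra. }
  assert (H1 := Rmin_l (Cmod w) (Cmod (p 0%nat) / (B + 1))).
  assert (H2 := Rmin_r (Cmod w) (Cmod (p 0%nat) / (B + 1))).
  specialize (HB z ltac:(lra)). rewrite Hz3 in HB.
  replace (0 - p 0%nat)%C with (- p 0%nat)%C in HB by ring.
  rewrite Cmod_opp in HB.
  assert (H3 : (B + 1) * Cmod z < Cmod (p 0%nat)).
  { apply Rlt_le_trans with ((B + 1) * (Cmod (p 0%nat) / (B + 1))).
    - apply Rmult_lt_compat_l; lra.
    - right; field; lra. }
  nra.
Qed.

(** The lowest coefficient is the limit along the zeros, so it vanishes, and
    dividing by z gives the next one. *)
Lemma Cps_zeros_cluster (p : nat -> C) (w : C) :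
  w <> 0 -> summable (fun n => p n * w ^ n)%C ->
  (forall eps, 0 < eps -> exists z, 0 < Cmod z < eps /\ Cps p z = 0) ->
  forall n, p n = 0.
Proof.
  intros Hw0 Hw Hz n. revert p Hw Hz. induction n as [|n IH]; intros p Hw Hz.
  - exact (Cps_zeros_head p w Hw0 Hw Hz).
  - apply (IH (fun n => p (S n))); [now apply summable_pow_shift|].
    assert (Hp0 := Cps_zeros_head p w Hw0 Hw Hz).
    intros eps Heps.
    assert (Hwp : 0 < Cmod w) by now apply Cmod_gt_0.
    destruct (Hz (Rmin eps (Cmod w))) as [z [[Hz1 Hz2] Hz3]].
    { now apply Rmin_glb_lt. }
    assert (H1 := Rmin_l eps (Cmod w)). assert (H2 := Rmin_r eps (Cmod w)).
    exists z. split; [lra|].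
    assert (Hz0 : z <> 0) by now apply Cmod_gt_0.
    assert (Hzw : summable (fun n => p n * z ^ n)%C) by (apply summable_pow_le with w; [lra|exact Hw]).
    rewrite Cps_shift, Hp0 in Hz3 by (try exact Hzw; now apply summable_pow_shift).
    rewrite Cplus_0_l in Hz3.
    destruct (Ceq_dec (Cps (fun n => p (S n)) z) 0) as [E|E]; [exact E|].
    exfalso. now apply (Cmult_neq_0 _ _ Hz0 E).
Qed.

(** Convergence on an open disc is automatically absolute; asking for absolute
    convergence makes the sums freely rearrangeable. *)
Definition analytic1_at (f : C -> C) (z0 : C) : Prop :=
  exists (p : nat -> C) (r : R), 0 < r /\ forall z, Cmod (z - z0) < r ->
    summable (fun n => p n * (z - z0) ^ n)%C /\ f z = Cps p (z - z0).

Lemma analytic1_ext (f g : C -> C) (z0 : C) (r : R) : 0 < r ->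
  (forall z, Cmod (z - z0) < r -> f z = g z) ->
  analytic1_at f z0 -> analytic1_at g z0.
Proof.
  intros Hr He [p [s [Hs H]]]. exists p, (Rmin r s).
  split; [now apply Rmin_glb_lt|]. intros z Hz.
  assert (H1 := Rmin_l r s). assert (H2 := Rmin_r r s).
  rewrite <- He by lra. apply H. lra.
Qed.

Lemma analytic1_plus (f g : C -> C) (z0 : C) :
  analytic1_at f z0 -> analytic1_at g z0 -> analytic1_at (fun z => f z + g z)%C z0.
Proof.
  intros [p [r [Hr H]]] [q [s [Hs H']]].
  exists (fun n => p n + q n)%C, (Rmin r s).
  split; [now apply Rmin_glb_lt|]. intros z Hz.
  assert (H1 := Rmin_l r s). assert (H2 := Rmin_r r s).
  destruct (H z ltac:(lra)) as [A1 ->]. destruct (H' z ltac:(lra)) as [A2 ->].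
  assert (E : forall n, (p n * (z - z0) ^ n + q n * (z - z0) ^ n
     = (p n + q n) * (z - z0) ^ n)%C) by (intros; ring).
  split.
  - apply summable_ext with (1 := E). now apply summable_plus.
  - unfold Cps. rewrite <- CSeries_plus by assumption. now apply CSeries_ext.
Qed.

Lemma analytic1_scal (c : C) (f : C -> C) (z0 : C) :
  analytic1_at f z0 -> analytic1_at (fun z => c * f z)%C z0.
Proof.
  intros [p [r [Hr H]]]. exists (fun n => c * p n)%C, r. split; [exact Hr|].
  intros z Hz. destruct (H z Hz) as [A ->].
  assert (E : forall n, (c * (p n * (z - z0) ^ n) = c * p n * (z - z0) ^ n)%C)
    by (intros; ring).
  split.
  - apply summable_ext with (1 := E). now apply summable_scal.
  - unfold Cps. rewrite <- CSeries_scal by assumption. now apply CSeries_ext.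
Qed.

(** Only points clustering at z0 are needed, because the difference is a power
    series whose zeros cannot cluster. *)
Lemma analytic1_coincide (f g : C -> C) (z0 : C) :
  analytic1_at f z0 -> analytic1_at g z0 ->
  (forall eps, 0 < eps -> exists z, 0 < Cmod (z - z0) < eps /\ f z = g z) ->
  exists r, 0 < r /\ forall z, Cmod (z - z0) < r -> f z = g z.
Proof.
  intros Hf Hg Hz.
  destruct (analytic1_plus _ _ _ Hf (analytic1_scal (-1) _ _ Hg)) as [p [r [Hr H]]].
  exists r. split; [exact Hr|].
  assert (Hp : forall n, p n = 0).
  { apply (Cps_zeros_cluster p (RtoC (r / 2))).
    - apply Cmod_gt_0. rewrite Cmod_R, Rabs_pos_eq; lra.
    - destruct (H (z0 + RtoC (r / 2))%C) as [A _].
      + replace (z0 + RtoC (r/2) - z0)%C with (RtoC (r/2)) by ring.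
        rewrite Cmod_R, Rabs_pos_eq; lra.
      + revert A. apply summable_ext. intros n. f_equal. f_equal. ring.
    - intros eps Heps. destruct (Hz (Rmin eps r)) as [z [[Hz1 Hz2] Hz3]].
      { now apply Rmin_glb_lt. }
      assert (H1 := Rmin_l eps r). assert (H2 := Rmin_r eps r).
      exists (z - z0)%C. split; [lra|].
      destruct (H z ltac:(lra)) as [_ <-]. rewrite Hz3. ring. }
  intros z Hzr. destruct (H z Hzr) as [_ E].
  unfold Cps in E. rewrite CSeries_zero in E.
  - replace (f z) with (f z + -1 * g z + g z)%C by ring. rewrite E. ring.
  - intros n. rewrite Hp. ring.
Qed.

(** Identity theorem along a path: the set of parameters up to which f and g
    agree is closed upwards because at its supremum they agree on points of the
    path clustering there, hence on a whole disc. *)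
Lemma identity_along_path (f g : C -> C) (gam : R -> C) (eta : R) :
  (forall t, 0 <= t <= 1 -> analytic1_at f (gam t)) ->
  (forall t, 0 <= t <= 1 -> analytic1_at g (gam t)) ->
  (forall t, 0 <= t <= 1 -> forall eps, 0 < eps -> exists d, 0 < d /\
     forall s, 0 <= s <= 1 -> Rabs (s - t) < d -> Cmod (gam s - gam t) < eps) ->
  (forall s t, 0 <= s < t -> t <= 1 -> gam s <> gam t) ->
  0 < eta -> (forall t, 0 <= t <= eta -> t <= 1 -> f (gam t) = g (gam t)) ->
  f (gam 1) = g (gam 1).
Proof.
  intros Hf Hg Hc Hi Heta He.
  set (E := fun t => 0 <= t <= 1 /\ forall s, 0 <= s <= t -> f (gam s) = g (gam s)).
  assert (Hmin : 0 < Rmin eta 1) by (apply Rmin_glb_lt; lra).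
  assert (HE0 : E (Rmin eta 1)).
  { assert (H1 := Rmin_l eta 1). assert (H2 := Rmin_r eta 1).
    split; [lra|]. intros s Hs. apply He; lra. }
  destruct (completeness E) as [m [Hub Hlub]].
  - exists 1. intros t [Ht _]. lra.
  - exists (Rmin eta 1). exact HE0.
  - assert (Hm0 : 0 < m) by (apply Rlt_le_trans with (1 := Hmin); now apply Hub).
    assert (Hm1 : m <= 1) by (apply Hlub; intros t [Ht _]; lra).
    assert (Hbelow : forall s, 0 <= s < m -> f (gam s) = g (gam s)).
    { intros s Hs.
      destruct (Classical_Prop.classic (exists t, E t /\ s < t)) as [[t [[_ Ht] Hst]]|Hn].
      - apply Ht. lra.
      - exfalso. assert (m <= s); [|lra]. apply Hlub. intros t Ht.
        apply Rnot_lt_le. intros Hst. apply Hn. now exists t. }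
    destruct (analytic1_coincide f g (gam m)) as [r [Hr H]].
    + apply Hf; lra.
    + apply Hg; lra.
    + intros eps Heps. destruct (Hc m ltac:(lra) eps Heps) as [d [Hd HH]].
      set (s := Rmax 0 (m - d / 2)).
      assert (Hs : 0 <= s < m).
      { unfold s. split; [apply Rmax_l|]. apply Rmax_lub_lt; lra. }
      assert (Hs2 : m - d / 2 <= s) by apply Rmax_r.
      exists (gam s). split; [split|].
      * apply Cmod_gt_0. intros E0. apply (Hi s m); [lra|lra|].
        replace (gam s) with (gam s - gam m + gam m)%C by ring. rewrite E0. ring.
      * apply HH; [lra|]. apply Rabs_def1; lra.
      * now apply Hbelow.
    + destruct (Rle_lt_or_eq_dec m 1 Hm1) as [Hlt| ->].
      * exfalso. destruct (Hc m ltac:(lra) r Hr) as [d [Hd HH]].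
        set (t := Rmin 1 (m + d / 2)).
        assert (Ht1 : t <= 1) by apply Rmin_l.
        assert (Ht2 : t <= m + d / 2) by apply Rmin_r.
        assert (Ht3 : m < t) by (apply Rmin_glb_lt; lra).
        assert (HEt : E t); [|assert (Htm := Hub t HEt); lra].
        split; [lra|]. intros s Hs. destruct (Rlt_le_dec s m) as [G|G].
        { apply Hbelow; lra. }
        apply H. apply HH; [lra|]. apply Rabs_def1; lra.
      * apply H. replace (gam 1 - gam 1)%C with (RtoC 0) by ring. now rewrite Cmod_0.
Qed.

Lemma summable2_pow_le (u : nat -> nat -> C) (w z : C) : Cmod z <= Cmod w ->
  summable2 (fun k j => u k j * w ^ j)%C -> summable2 (fun k j => u k j * z ^ j)%C.
Proof.
  intros H [M HM]. apply summable2_le with (2 := HM). intros i j.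
  rewrite !Cmod_mult, !Cmod_pow. apply Rmult_le_compat_l; [apply Cmod_ge_0|].
  apply pow_incr. split; [apply Cmod_ge_0|exact H].
Qed.

Lemma Cps_double (u : nat -> nat -> C) (z : C) :
  summable2 (fun k j => u k j * z ^ j)%C -> (forall j, summable (fun k => u k j)) ->
  summable (fun j => CSeries (fun k => u k j) * z ^ j)%C /\
  CSeries (fun k => Cps (u k) z) = Cps (fun j => CSeries (fun k => u k j)) z.
Proof.
  intros H Hc.
  assert (E : forall j, CSeries (fun k => u k j * z ^ j)%C
             = (CSeries (fun k => u k j) * z ^ j)%C).
  { intros j. rewrite Cmult_comm, <- CSeries_scal by apply Hc.
    apply CSeries_ext; intros; ring. }
  split.
  - apply summable_ext with (1 := E). apply (summable2_rows_summable _ (summable2_sym _ H)).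
  - unfold Cps. rewrite (Fubini (fun k j => u k j * z ^ j)%C) by exact H.
    now apply CSeries_ext.
Qed.

(** A series of functions is analytic once its terms can be expanded about z0
    with an absolutely convergent double series of coefficients. *)
Lemma analytic1_double (f : C -> C) (z0 : C) (u : nat -> nat -> C) (r : R) :
  0 < r -> summable2 (fun k j => u k j * RtoC r ^ j)%C ->
  (forall z, Cmod (z - z0) < r -> f z = CSeries (fun k => Cps (u k) (z - z0))) ->
  analytic1_at f z0.
Proof.
  intros Hr H Hf. exists (fun j => CSeries (fun k => u k j)), r.
  split; [exact Hr|]. intros z Hz.
  destruct (Cps_double u (z - z0)) as [H1 H2].
  - apply summable2_pow_le with (2 := H). rewrite Cmod_R, Rabs_pos_eq; lra.
  - intros j. assert (Hj := summable2_row _ (summable2_sym _ H) j). simpl in Hj.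
    apply (summable_scal (/ RtoC r ^ j)%C) in Hj. revert Hj. apply summable_ext.
    intros k. field. apply Cpow_nz. intros E. apply RtoC_inj in E. lra.
  - split; [exact H1|]. rewrite Hf by exact Hz. exact H2.
Qed.

(** Coefficients of (z0 + X)^n, by the recursion of Pascal's triangle, which
    gives the majorant with |z0| in place of z0 for free. *)
Fixpoint binom_coef (z0 : C) (n j : nat) : C :=
  match n, j with
  | O, O => RtoC 1
  | O, S _ => RtoC 0
  | S n, O => (z0 * binom_coef z0 n 0)%C
  | S n, S j => (z0 * binom_coef z0 n (S j) + binom_coef z0 n j)%C
  end.

Lemma binom_coef_high (z0 : C) (n j : nat) : (n < j)%nat -> binom_coef z0 n j = 0.
Proof.
  revert j. induction n as [|n IH]; intros [|j] H; try lia; [reflexivity|].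
  simpl. rewrite !IH by lia. ring.
Qed.

Lemma binom_coef_sum (z0 h : C) (n : nat) :
  Cps (binom_coef z0 n) h = ((z0 + h) ^ n)%C.
Proof.
  induction n as [|n IH].
  - unfold Cps. rewrite (CSeries_finite _ 0%nat).
    + rewrite sum_O; simpl; ring.
    + intros [|k] Hk; [lia|]. simpl. ring.
  - assert (A : summable (fun j => binom_coef z0 n j * h ^ j)%C).
    { apply summable_finite with n. intros j Hj. rewrite binom_coef_high by exact Hj. ring. }
    assert (A' : summable (fun j => binom_coef z0 (S n) j * h ^ j)%C).
    { apply summable_finite with (S n). intros j Hj. rewrite binom_coef_high by exact Hj. ring. }
    assert (AS : summable (fun j => binom_coef z0 n (S j) * h ^ S j)%C)
      by (apply (summable_incr_1 (fun j => binom_coef z0 n j * h ^ j)%C); exact A).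
    rewrite Cpow_S, <- IH. unfold Cps.
    rewrite CSeries_incr_1 by exact A'.
    rewrite (CSeries_ext _ (fun j => z0 * (binom_coef z0 n (S j) * h ^ S j)
                         + h * (binom_coef z0 n j * h ^ j))%C).
    2:{ intros j. simpl binom_coef. rewrite Cpow_S. ring. }
    rewrite (CSeries_plus _ _ (summable_scal z0 _ AS) (summable_scal h _ A)).
    rewrite (CSeries_scal z0 _ AS), (CSeries_scal h _ A).
    rewrite (CSeries_incr_1 (fun j => binom_coef z0 n j * h ^ j)%C A).
    set (s := CSeries (fun j => binom_coef z0 n (S j) * h ^ S j)%C).
    simpl. ring.
Qed.

Lemma binom_coef_Cmod (z0 : C) (n j : nat) :
  Cmod (binom_coef z0 n j) <= Re (binom_coef (RtoC (Cmod z0)) n j)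
  /\ Im (binom_coef (RtoC (Cmod z0)) n j) = 0.
Proof.
  revert j. induction n as [|n IH]; intros [|j].
  - simpl. rewrite Cmod_1. split; [apply Rle_refl|reflexivity].
  - simpl. rewrite Cmod_0. split; [apply Rle_refl|reflexivity].
  - destruct (IH 0%nat) as [H1 H2]. simpl in *. rewrite Cmod_mult. unfold Re, Im in *.
    rewrite H2. split; [|ring].
    rewrite Rmult_0_l, Rminus_0_r. apply Rmult_le_compat_l; [apply Cmod_ge_0|exact H1].
  - destruct (IH (S j)) as [H1 H2]. destruct (IH j) as [H3 H4]. simpl in *.
    unfold Re, Im in *. rewrite H2, H4. split; [|ring].
    eapply Rle_trans; [apply Cmod_triangle|]. rewrite Cmod_mult.
    assert (Hz := Cmod_ge_0 z0). nra.
Qed.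

(** Every power z^n = (z0 + (z - z0))^n is re-expanded; the double series is
    dominated by the original one at |z0| + r, inside the disc. *)
Lemma analytic1_Cps (f : C -> C) (p : nat -> C) (R0 : R) (z0 : C) :
  Cmod z0 < R0 ->
  (forall z, Cmod z < R0 -> summable (fun n => p n * z ^ n)%C /\ f z = Cps p z) ->
  analytic1_at f z0.
Proof.
  intros Hz0 H. set (r := (R0 - Cmod z0) / 2).
  assert (Hr : 0 < r) by (unfold r; lra). assert (Hz0' := Cmod_ge_0 z0).
  apply (analytic1_double f z0 (fun n j => p n * binom_coef z0 n j)%C r Hr).
  - assert (Hpos : forall n j, 0 <= Re (binom_coef (RtoC (Cmod z0)) n j) * r ^ j).
    { intros n j. apply Rmult_le_pos; [|apply pow_le; lra].
      eapply Rle_trans; [apply Cmod_ge_0|]. apply (binom_coef_Cmod z0 n j). }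
    assert (Hrow : forall n, ex_series (fun j => Re (binom_coef (RtoC (Cmod z0)) n j) * r ^ j)
        /\ Series (fun j => Re (binom_coef (RtoC (Cmod z0)) n j) * r ^ j) = (Cmod z0 + r) ^ n).
    { intros n.
      assert (A : summable (fun j => binom_coef (RtoC (Cmod z0)) n j * RtoC r ^ j)%C).
      { apply summable_finite with n. intros j Hj. rewrite binom_coef_high by exact Hj. ring. }
      assert (E : forall j, Re (binom_coef (RtoC (Cmod z0)) n j * RtoC r ^ j)%C
          = Re (binom_coef (RtoC (Cmod z0)) n j) * r ^ j).
      { intros j. rewrite <- RtoC_pow. unfold Re; simpl. ring. }
      split.
      - apply ex_series_ext with (1 := E). now apply summable_Re.
      - rewrite <- (Series_ext _ _ E).
        change (Re (Cps (binom_coef (RtoC (Cmod z0)) n) (RtoC r)) = (Cmod z0 + r) ^ n).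
        rewrite binom_coef_sum, <- RtoC_plus, <- RtoC_pow. reflexivity. }
    assert (Hle : forall n j, Cmod (p n * binom_coef z0 n j * RtoC r ^ j)
        <= Cmod (p n) * (Re (binom_coef (RtoC (Cmod z0)) n j) * r ^ j)).
    { intros n j. rewrite !Cmod_mult, Cmod_pow, Cmod_R, Rabs_pos_eq, Rmult_assoc by lra.
      apply Rmult_le_compat_l; [apply Cmod_ge_0|].
      apply Rmult_le_compat_r; [apply pow_le; lra|]. apply binom_coef_Cmod. }
    assert (Hex : forall n, ex_series
       (fun j => Cmod (p n) * (Re (binom_coef (RtoC (Cmod z0)) n j) * r ^ j))).
    { intros n. apply (ex_series_scal (V := R_NormedModule) (Cmod (p n))
         (fun j => Re (binom_coef (RtoC (Cmod z0)) n j) * r ^ j)). apply Hrow. }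
    apply (summable2_of_rows _ (fun n => Cmod (p n * RtoC (Cmod z0 + r) ^ n))).
    + intros n. apply summable_le with (1 := Hle n). apply Hex.
    + intros n. eapply Rle_trans.
      * apply Series_le; [|apply (Hex n)]. intros j; split; [apply Cmod_ge_0|apply Hle].
      * rewrite Series_scal_l. rewrite (proj2 (Hrow n)).
        rewrite Cmod_mult, Cmod_pow, Cmod_R, Rabs_pos_eq by lra. apply Rle_refl.
    + apply (H (RtoC (Cmod z0 + r))). rewrite Cmod_R, Rabs_pos_eq; unfold r; lra.
  - intros z Hz.
    assert (Hz' : Cmod z < R0).
    { assert (Ht := Cmod_triangle (z - z0) z0).
      replace (z - z0 + z0)%C with z in Ht by ring. unfold r in Hz. lra. }
    destruct (H z Hz') as [_ ->]. unfold Cps. apply CSeries_ext. intros n.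
    rewrite (CSeries_ext _ (fun j => p n * (binom_coef z0 n j * (z - z0) ^ j))%C)
      by (intros; ring).
    rewrite CSeries_scal.
    + change (p n * z ^ n = p n * Cps (binom_coef z0 n) (z - z0))%C.
      rewrite binom_coef_sum. f_equal. f_equal. ring.
    + apply summable_finite with n. intros j Hj. rewrite binom_coef_high by exact Hj. ring.
Qed.

(** Restricting to real arguments makes the coefficients definable without
    choice, through the real iterated derivatives of the two parts. *)
Definition taylor_coef (f : C -> C) (k : nat) : C :=
  (Derive_n (fun t : R => Re (f (RtoC t))) k 0 / INR (fact k),
   Derive_n (fun t : R => Im (f (RtoC t))) k 0 / INR (fact k)).

Lemma CV_radius_ge (a : nat -> R) (r : R) : 0 <= r ->
  ex_series (fun n => Rabs (a n) * r ^ n) -> Rbar_le r (CV_radius a).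
Proof.
  intros Hr H. destruct (CV_radius a) as [x| |] eqn:E.
  - simpl. apply Rnot_lt_le. intros Hlt.
    assert (HH : Rbar_le r (CV_radius a)); [|rewrite E in HH; simpl in HH; lra].
    unfold CV_radius. apply Lub_Rbar_correct. unfold CV_disk.
    revert H. apply ex_series_ext. intros n. rewrite Rabs_mult, <- RPow_abs, (Rabs_pos_eq r Hr).
    reflexivity.
  - exact I.
  - assert (HH := CV_radius_ge_0 a). rewrite E in HH. exact HH.
Qed.

Lemma Re_mult_RtoC (z : C) (t : R) : Re (z * RtoC t)%C = Re z * t.
Proof. unfold Re; simpl; ring. Qed.

Lemma Im_mult_RtoC (z : C) (t : R) : Im (z * RtoC t)%C = Im z * t.
Proof. unfold Im; simpl; ring. Qed.

Lemma Re_Cps (p : nat -> C) (t : R) : Re (Cps p (RtoC t)) = PSeries (fun n => Re (p n)) t.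
Proof.
  unfold Cps, CSeries, PSeries. apply Series_ext. intros n.
  rewrite <- RtoC_pow. apply Re_mult_RtoC.
Qed.

Lemma Im_Cps (p : nat -> C) (t : R) : Im (Cps p (RtoC t)) = PSeries (fun n => Im (p n)) t.
Proof.
  unfold Cps, CSeries, PSeries. apply Series_ext. intros n.
  rewrite <- RtoC_pow. apply Im_mult_RtoC.
Qed.

Lemma summable_CV_radius (p : nat -> C) (r : R) : 0 <= r ->
  summable (fun n => p n * RtoC r ^ n)%C ->
  Rbar_le r (CV_radius (fun n => Re (p n))) /\ Rbar_le r (CV_radius (fun n => Im (p n))).
Proof.
  intros Hr H.
  split; apply CV_radius_ge; try exact Hr;
  (eapply (ex_series_le (V := R_CompleteNormedModule)); [|exact H]); intros n; simpl;
    rewrite Cmod_mult, Cmod_pow, Cmod_R, (Rabs_pos_eq r Hr);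
    unfold norm; simpl; unfold abs; simpl; rewrite Rabs_pos_eq;
    try (apply Rmult_le_pos; [apply Rabs_pos|now apply pow_le]);
    (apply Rmult_le_compat_r; [now apply pow_le|]).
  - apply re_le_Cmod.
  - apply im_le_Cmod.
Qed.

Lemma taylor_coef_unique (f : C -> C) (q : nat -> C) (r : R) (k : nat) : 0 < r ->
  (forall y, Cmod y < r -> summable (fun n => q n * y ^ n)%C /\ f y = Cps q y) ->
  taylor_coef f k = q k.
Proof.
  intros Hr H.
  destruct (summable_CV_radius q (r / 2)) as [H1 H2]; [lra| |].
  { apply H. rewrite Cmod_R, Rabs_pos_eq; lra. }
  assert (L : forall a, Rbar_le (r / 2) (CV_radius a) -> Rbar_lt 0 (CV_radius a)).
  { intros a Ha. apply Rbar_lt_le_trans with (2 := Ha). simpl. lra. }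
  assert (Hf : forall t : R, Rabs (t - 0) < r -> f (RtoC t) = Cps q (RtoC t)).
  { intros t Ht. apply H. rewrite Cmod_R. now rewrite Rminus_0_r in Ht. }
  assert (Hk : INR (fact k) <> 0) by apply INR_fact_neq_0.
  apply C_eq; unfold taylor_coef; simpl.
  - rewrite (Derive_n_ext_loc _ (PSeries (fun n => Re (q n)))).
    + rewrite Derive_n_coef by now apply L. now field.
    + exists (mkposreal _ Hr). intros t Ht. now rewrite Hf, Re_Cps.
  - rewrite (Derive_n_ext_loc _ (PSeries (fun n => Im (q n)))).
    + rewrite Derive_n_coef by now apply L. now field.
    + exists (mkposreal _ Hr). intros t Ht. now rewrite Hf, Im_Cps.
Qed.

(** * Complex exponential, argument and powers *)

Lemma Cexp_plus (z w : C) : Cexp (z + w)%C = (Cexp z * Cexp w)%C.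
Proof.
  apply C_eq; unfold Cexp; destruct z as [a b], w as [c d]; simpl;
    rewrite exp_plus, ?cos_plus, ?sin_plus; ring.
Qed.

Lemma Cexp_0 : Cexp 0 = 1.
Proof. apply C_eq; simpl; rewrite exp_0, ?cos_0, ?sin_0; ring. Qed.

Lemma Cmod_Cexp (z : C) : Cmod (Cexp z) = exp (Re z).
Proof.
  unfold Cmod, Cexp; simpl.
  replace (_ + _) with (exp (Re z) * exp (Re z) * ((cos (Im z))² + (sin (Im z))²))
    by (unfold Rsqr; ring).
  rewrite (Rplus_comm (cos _)²), sin2_cos2, Rmult_1_r.
  apply sqrt_square. left; apply exp_pos.
Qed.

Lemma Cexp_neq_0 (z : C) : Cexp z <> 0.
Proof. apply Cmod_gt_0. rewrite Cmod_Cexp. apply exp_pos. Qed.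

Lemma CLog_Cexp (w : C) : - PI < Im w <= PI -> CLog (Cexp w) = w.
Proof.
  intros Hw. unfold CLog. rewrite Cmod_Cexp. apply C_eq; simpl; [apply ln_exp|].
  unfold Arg. rewrite Cmod_Cexp.
  assert (He := exp_pos (Re w)).
  replace (Re (Cexp w) / exp (Re w)) with (cos (Im w)) by (simpl; field; lra).
  destruct (Rle_dec 0 (Im (Cexp w))) as [H|H]; simpl in H.
  - assert (0 <= Im w).
    { apply Rnot_lt_le. intros Hlt.
      assert (sin (Im w) < 0) by (apply sin_lt_0_var; lra). nra. }
    apply acos_cos; lra.
  - assert (Im w < 0).
    { apply Rnot_le_lt. intros Hle. apply H.
      apply Rmult_le_pos; [lra|]. apply sin_ge_0; lra. }
    rewrite <- cos_neg, acos_cos by lra. ring.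
Qed.

Lemma Re_div_Cmod (z : C) : z <> 0 -> -1 <= Re z / Cmod z <= 1.
Proof.
  intros Hz. assert (Hm := proj1 (Cmod_gt_0 z) Hz).
  assert (H := re_le_Cmod z). apply Rabs_le_between in H.
  split; apply Rmult_le_reg_r with (Cmod z); try exact Hm;
    unfold Rdiv; rewrite Rmult_assoc, Rinv_l by lra; lra.
Qed.

Lemma Arg_bound (z : C) : Rabs (Arg z) <= PI.
Proof.
  unfold Arg. assert (H := acos_bound (Re z / Cmod z)).
  destruct (Rle_dec 0 (Im z)); rewrite ?Rabs_Ropp, Rabs_pos_eq; lra.
Qed.

Lemma Arg_gt (z : C) : z <> 0 -> - PI < Arg z.
Proof.
  intros Hz. unfold Arg. assert (H := acos_bound (Re z / Cmod z)).
  assert (HPI := PI_RGT_0).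
  destruct (Rle_dec 0 (Im z)) as [Hi|Hi]; [lra|].
  destruct (proj2 H) as [Hlt|Heq]; [lra|]. exfalso.
  assert (Hc : cos (acos (Re z / Cmod z)) = -1) by (rewrite Heq; apply cos_PI).
  rewrite cos_acos in Hc by now apply Re_div_Cmod.
  assert (Hm := proj1 (Cmod_gt_0 z) Hz).
  assert (Hr : Re z = - Cmod z).
  { replace (Re z) with (Re z / Cmod z * Cmod z) by (field; lra). rewrite Hc. ring. }
  assert (H2 := Cmod2_alt z). rewrite Hr in H2. nra.
Qed.

Lemma Cexp_CLog (z : C) : z <> 0 -> Cexp (CLog z) = z.
Proof.
  intros Hz. assert (Hm := proj1 (Cmod_gt_0 z) Hz).
  assert (Hb := Re_div_Cmod z Hz).
  assert (Hs : Cmod z * sqrt (1 - (Re z / Cmod z)²) = Rabs (Im z)).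
  { rewrite <- (sqrt_Rsqr (Cmod z)) at 1 by lra.
    rewrite <- sqrt_mult_alt by apply Rle_0_sqr.
    rewrite <- sqrt_Rsqr_abs. f_equal.
    assert (H2 := Cmod2_alt z). unfold Rsqr.
    replace (Cmod z * Cmod z * (1 - Re z / Cmod z * (Re z / Cmod z)))
      with (Cmod z ^ 2 - Re z ^ 2) by (field; lra). rewrite H2. ring. }
  unfold Cexp, CLog; apply C_eq; simpl; rewrite exp_ln by exact Hm; unfold Arg;
    destruct (Rle_dec 0 (Im z)) as [Hi|Hi].
  - rewrite cos_acos by exact Hb. field; lra.
  - rewrite cos_neg, cos_acos by exact Hb. field; lra.
  - rewrite sin_acos, Hs by exact Hb. apply Rabs_pos_eq, Hi.
  - rewrite sin_neg, sin_acos by exact Hb.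
    replace (Cmod z * - sqrt (1 - (Re z / Cmod z)²))
      with (- (Cmod z * sqrt (1 - (Re z / Cmod z)²))) by ring.
    rewrite Hs, Rabs_left by lra. ring.
Qed.

(** Principal logarithms add up unless the arguments leave the principal strip. *)
Lemma CLog_mult (z w : C) : z <> 0 -> w <> 0 -> Rabs (Arg z + Arg w) < PI ->
  CLog (z * w)%C = (CLog z + CLog w)%C.
Proof.
  intros Hz Hw H. apply Rabs_def2 in H.
  rewrite <- (Cexp_CLog z Hz) at 1. rewrite <- (Cexp_CLog w Hw) at 1.
  rewrite <- Cexp_plus. apply CLog_Cexp. simpl. lra.
Qed.

Lemma Cpower_mult (z w s : C) : z <> 0 -> w <> 0 -> Rabs (Arg z + Arg w) < PI ->
  Cpower (z * w) s = (Cpower z s * Cpower w s)%C.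
Proof.
  intros Hz Hw H. unfold Cpower. rewrite CLog_mult by assumption.
  rewrite <- Cexp_plus. f_equal. ring.
Qed.

Lemma Cpower_plus (z s t : C) : Cpower z (s + t) = (Cpower z s * Cpower z t)%C.
Proof. unfold Cpower. rewrite <- Cexp_plus. f_equal. ring. Qed.

Lemma Cpower_neq_0 (z s : C) : Cpower z s <> 0.
Proof. apply Cexp_neq_0. Qed.

Lemma Cpower_0 (z : C) : Cpower z 0 = 1.
Proof. unfold Cpower. rewrite Cmult_0_l. apply Cexp_0. Qed.

Lemma Cpower_1 (z : C) : z <> 0 -> Cpower z 1 = z.
Proof. intros Hz. unfold Cpower. rewrite Cmult_1_l. now apply Cexp_CLog. Qed.

Lemma Cpower_opp (z s : C) : Cpower z (- s) = (/ Cpower z s)%C.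
Proof.
  assert (H : (Cpower z s * Cpower z (- s))%C = 1).
  { rewrite <- Cpower_plus, <- (Cpower_0 z). f_equal. ring. }
  assert (H0 := Cpower_neq_0 z s).
  replace (Cpower z (- s)) with (/ Cpower z s * (Cpower z s * Cpower z (- s)))%C
    by now field.
  rewrite H. ring.
Qed.

Lemma Cpower_INR (z : C) (n : nat) : z <> 0 -> Cpower z (RtoC (INR n)) = (z ^ n)%C.
Proof.
  intros Hz. induction n as [|n IH]; [apply Cpower_0|].
  rewrite S_INR, RtoC_plus, Cpower_plus, IH, Cpower_1, Cpow_S by exact Hz. ring.
Qed.

Lemma Cpower_minus_INR (z s : C) (n : nat) : z <> 0 ->
  Cpower z (s - RtoC (INR n)) = (Cpower z s * (/ z) ^ n)%C.
Proof.
  intros Hz. unfold Cminus. rewrite Cpower_plus, Cpower_opp, Cpower_INR, Cpow_inv by exact Hz.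
  reflexivity.
Qed.

Lemma Arg_pos (t : R) : 0 < t -> Arg (RtoC t) = 0.
Proof.
  intros Ht. unfold Arg. rewrite Cmod_R, Rabs_pos_eq by lra. simpl.
  destruct (Rle_dec 0 0) as [_|n]; [|lra].
  replace (t / t) with 1 by (field; lra). apply acos_1.
Qed.

Lemma CLog_pos (t : R) : 0 < t -> CLog (RtoC t) = RtoC (ln t).
Proof.
  intros Ht. unfold CLog. rewrite Arg_pos, Cmod_R, Rabs_pos_eq by lra. reflexivity.
Qed.

Lemma Cpower_mult_pos (s t : R) (z : C) : 0 < s -> 0 < t ->
  Cpower (RtoC (s * t)) z = (Cpower (RtoC s) z * Cpower (RtoC t) z)%C.
Proof.
  intros Hs Ht. unfold Cpower. rewrite <- Cexp_plus, !CLog_pos, ln_mult, RtoC_plus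
    by (try apply Rmult_lt_0_compat; assumption). f_equal. ring.
Qed.

Lemma Cmod_Cpower (z s : C) : z <> 0 ->
  Cmod (Cpower z s) <= Rpower (Cmod z) (Re s) * exp (PI * Rabs (Im s)).
Proof.
  intros Hz. unfold Cpower. rewrite Cmod_Cexp. unfold Rpower. rewrite <- exp_plus.
  assert (H : Re (s * CLog z)%C <= Re s * ln (Cmod z) + PI * Rabs (Im s)).
  { replace (Re (s * CLog z)%C) with (Re s * ln (Cmod z) - Im s * Arg z)
      by (unfold CLog; destruct s; simpl; reflexivity).
    assert (H1 := Arg_bound z). assert (H2 := Rle_abs (- (Im s * Arg z))).
    rewrite Rabs_Ropp, Rabs_mult in H2. assert (H3 := Rabs_pos (Im s)). nra. }
  destruct H as [H|H]; [left; now apply exp_increasing|right; now rewrite H].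
Qed.

(** Unlike the definition through [acos], this form is differentiable. *)
Lemma Arg_atan (z : C) : 0 < Re z -> Arg z = atan (Im z / Re z).
Proof.
  intros Hz. set (x := Im z / Re z). assert (Hb := atan_bound x).
  assert (Hp : 0 < sqrt (1 + x²)) by (apply sqrt_lt_R0; generalize (Rle_0_sqr x); lra).
  assert (HPI := PI_RGT_0).
  assert (E : z = Cexp (ln (Re z * sqrt (1 + x²)), atan x)).
  { unfold Cexp; simpl.
    rewrite exp_ln by (apply Rmult_lt_0_compat; assumption).
    rewrite cos_atan, sin_atan. apply C_eq; simpl.
    - field; lra.
    - unfold x at 2. field. split; lra. }
  change (Arg z) with (Im (CLog z)). rewrite E, CLog_Cexp; [reflexivity|]. simpl; lra.
Qed.

Lemma Arg_near_1 (eps : R) : 0 < eps ->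
  exists d, 0 < d /\ forall u, Cmod (u - 1) < d -> Rabs (Arg u) < eps.
Proof.
  intros Heps. set (e := Rmin eps 1).
  assert (He : 0 < e) by (apply Rmin_glb_lt; lra).
  assert (He1 : e <= 1) by apply Rmin_r. assert (He2 : e <= eps) by apply Rmin_l.
  assert (Ht : 0 < tan e).
  { apply tan_gt_0; [exact He|]. assert (H := PI2_1). lra. }
  exists (Rmin (1/2) (tan e / 4)). split; [apply Rmin_glb_lt; lra|].
  intros u Hu. assert (H1 := Rmin_l (1/2) (tan e / 4)). assert (H2 := Rmin_r (1/2) (tan e / 4)).
  assert (H3 := re_le_Cmod (u - 1)%C). assert (H4 := im_le_Cmod (u - 1)%C).
  rewrite Re_minus in H3. rewrite Im_minus in H4. simpl in H3, H4.
  assert (H5 : Rabs (Re u - 1) < 1/2) by lra. apply Rabs_def2 in H5.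
  assert (H6 : Rabs (Im u - 0) < tan e / 4) by lra. apply Rabs_def2 in H6.
  rewrite Arg_atan by lra.
  assert (Hq : - tan e < Im u / Re u < tan e).
  { split; apply Rmult_lt_reg_r with (Re u); try lra;
      unfold Rdiv; rewrite Rmult_assoc, Rinv_l by lra; nra. }
  assert (HPI := PI2_1).
  assert (Hat : atan (tan e) = e) by (apply atan_tan; lra).
  apply Rlt_le_trans with (2 := He2). apply Rabs_def1.
  - rewrite <- Hat. now apply atan_increasing.
  - rewrite <- Hat, <- atan_opp. now apply atan_increasing.
Qed.

(** * Rising factorials: growth *)

Lemma poch_S (a : C) (n : nat) : poch a (S n) = (poch a n * (a + RtoC (INR n)))%C.
Proof. reflexivity. Qed.

Lemma poch_S_l (a : C) (n : nat) : poch a (S n) = (a * poch (a + 1) n)%C.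
Proof.
  induction n as [|n IH].
  - simpl. ring.
  - rewrite poch_S, IH, poch_S, S_INR, RtoC_plus. ring.
Qed.

Lemma poch_plus (a : C) (m n : nat) :
  poch a (m + n) = (poch a m * poch (a + RtoC (INR m)) n)%C.
Proof.
  induction n as [|n IH].
  - rewrite Nat.add_0_r. simpl. ring.
  - rewrite Nat.add_succ_r, !poch_S, IH, plus_INR, RtoC_plus. ring.
Qed.

Lemma not_nonpos_int_plus (z : C) (n : nat) :
  not_nonpos_int z -> (z + RtoC (INR n))%C <> 0.
Proof.
  intros Hz E. apply (Hz n). rewrite RtoC_opp.
  replace z with (z + RtoC (INR n) - RtoC (INR n))%C by ring. rewrite E. ring.
Qed.

Lemma not_nonpos_int_neq_0 (z : C) : not_nonpos_int z -> z <> 0.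
Proof. intros Hz E. apply (Hz 0%nat). rewrite E. simpl. now rewrite Ropp_0. Qed.

Lemma not_nonpos_int_shift (z : C) (n : nat) :
  not_nonpos_int z -> not_nonpos_int (z + RtoC (INR n))%C.
Proof.
  intros Hz m E. apply (Hz (n + m)%nat).
  replace z with (z + RtoC (INR n) - RtoC (INR n))%C by ring.
  rewrite E, <- RtoC_minus. f_equal. rewrite plus_INR. ring.
Qed.

Lemma poch_neq_0 (z : C) (n : nat) : not_nonpos_int z -> poch z n <> 0.
Proof.
  intros Hz. induction n as [|n IH].
  - simpl. intros E. apply RtoC_inj in E. lra.
  - rewrite poch_S. apply Cmult_neq_0; [exact IH|]. now apply not_nonpos_int_plus.
Qed.

Lemma poch_1 (n : nat) : poch 1 n = RtoC (INR (fact n)).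
Proof.
  induction n as [|n IH]; [reflexivity|].
  rewrite poch_S, IH, <- RtoC_plus, <- RtoC_mult. f_equal.
  change (fact (S n)) with (S n * fact n)%nat. rewrite mult_INR, S_INR. ring.
Qed.

Lemma not_nonpos_int_pos (t : R) : 0 < t -> not_nonpos_int (RtoC t).
Proof. intros Ht n E. apply RtoC_inj in E. generalize (pos_INR n). lra. Qed.

Lemma fact_C_neq_0 (n : nat) : RtoC (INR (fact n)) <> 0.
Proof. intros E. apply RtoC_inj in E. now apply (INR_fact_neq_0 n). Qed.

(** The ratio test for domination: from N on the quotient u / b does not grow, and
    before N there are finitely many quotients. *)
Lemma eventually_bounded_by (u : nat -> R) (b : nat -> R) (N : nat) :
  (forall n, 0 < b n) -> (forall n, (N <= n)%nat -> u (S n) * b n <= u n * b (S n)) ->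
  exists M, 0 < M /\ forall n, u n <= M * b n.
Proof.
  intros Hb Hstep.
  assert (HN : forall N', exists M, 0 < M /\ forall n, (n <= N')%nat -> u n <= M * b n).
  { induction N' as [|N' [M [HM IH]]].
    - exists (Rmax 1 (u 0%nat / b 0%nat)). split.
      + apply Rlt_le_trans with 1; [lra|apply Rmax_l].
      + intros n Hn. replace n with 0%nat by lia.
        replace (u 0%nat) with (u 0%nat / b 0%nat * b 0%nat) at 1
          by (field; apply Rgt_not_eq, Hb).
        apply Rmult_le_compat_r; [left; apply Hb|apply Rmax_r].
    - exists (Rmax M (u (S N') / b (S N'))). split.
      + apply Rlt_le_trans with M; [lra|apply Rmax_l].
      + intros n Hn. destruct (Nat.eq_dec n (S N')) as [->|Hne].
        * replace (u (S N')) with (u (S N') / b (S N') * b (S N')) at 1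
            by (field; apply Rgt_not_eq, Hb).
          apply Rmult_le_compat_r; [left; apply Hb|apply Rmax_r].
        * apply Rle_trans with (M * b n); [apply IH; lia|].
          apply Rmult_le_compat_r; [left; apply Hb|apply Rmax_l]. }
  destruct (HN N) as [M [HM H]]. exists M. split; [exact HM|].
  intros n. destruct (le_lt_dec n N) as [Hn|Hn]; [now apply H|].
  induction Hn as [|n Hn IH].
  - assert (H1 := Hstep N (le_n N)). assert (H2 := H N (le_n N)).
    assert (B1 := Hb N). assert (B2 := Hb (S N)).
    apply Rmult_le_reg_r with (b N); [exact B1|]. nra.
  - assert (H1 := Hstep n ltac:(lia)).
    assert (B1 := Hb n). assert (B2 := Hb (S n)).
    apply Rmult_le_reg_r with (b n); [exact B1|]. nra.
Qed.

Lemma exists_nat_ge (x : R) : exists N : nat, x <= INR N.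
Proof.
  destruct (INR_unbounded x) as [N HN]. exists N. lra.
Qed.

(** The quotient of consecutive terms is (a+n)/(b+n), which tends to 1. *)
Lemma poch_ratio (a b : C) (q : R) : not_nonpos_int b -> 1 < q ->
  exists M, 0 < M /\ forall n, Cmod (poch a n / poch b n) <= M * q ^ n.
Proof.
  intros Hb Hq.
  destruct (exists_nat_ge ((Cmod a + q * Cmod b) / (q - 1))) as [N HN].
  destruct (eventually_bounded_by (fun n => Cmod (poch a n / poch b n)) (fun n => q ^ n) N)
    as [M HM].
  - intros n. apply pow_lt; lra.
  - intros n Hn. rewrite !poch_S.
    assert (Hp := poch_neq_0 b n Hb). assert (Hn0 := not_nonpos_int_plus b n Hb).
    replace (poch a n * (a + RtoC (INR n)) / (poch b n * (b + RtoC (INR n))))%C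
      with (poch a n / poch b n * ((a + RtoC (INR n)) / (b + RtoC (INR n))))%C
      by (field; now split).
    rewrite Cmod_mult. simpl.
    assert (Hr : Cmod ((a + RtoC (INR n)) / (b + RtoC (INR n))) <= q).
    { rewrite Cmod_div by exact Hn0.
      assert (Hpos := proj1 (Cmod_gt_0 _) Hn0).
      apply Rmult_le_reg_r with (Cmod (b + RtoC (INR n))); [exact Hpos|].
      unfold Rdiv. rewrite Rmult_assoc, Rinv_l, Rmult_1_r by lra.
      assert (HnR : INR N <= INR n) by now apply le_INR.
      assert (Hn' : Cmod a + q * Cmod b <= INR n * (q - 1)).
      { apply Rmult_le_reg_r with (/ (q - 1)).
        - apply Rinv_0_lt_compat; lra.
        - rewrite Rmult_assoc, Rinv_r by lra. unfold Rdiv in HN. lra. }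
      assert (T1 := Cmod_triangle a (RtoC (INR n))).
      assert (T2 := Cmod_triangle (b + RtoC (INR n)) (- b)).
      replace (b + RtoC (INR n) + - b)%C with (RtoC (INR n)) in T2 by ring.
      rewrite Cmod_opp in T2. rewrite Cmod_R, Rabs_pos_eq in T1, T2 by apply pos_INR. nra. }
    assert (Hc := Cmod_ge_0 (poch a n / poch b n)).
    assert (Hqn : 0 < q ^ n) by (apply pow_lt; lra).
    assert (Cmod (poch a n / poch b n) * Cmod ((a + RtoC (INR n)) / (b + RtoC (INR n)))
      <= Cmod (poch a n / poch b n) * q) by (apply Rmult_le_compat_l; assumption).
    nra.
  - exists M. exact HM.
Qed.

Lemma poch_fact_ratio (a : C) (q : R) : 1 < q ->
  exists M, 0 < M /\ forall n, Cmod (poch a n / RtoC (INR (fact n))) <= M * q ^ n.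
Proof.
  intros Hq. destruct (poch_ratio a 1 q) as [M [HM H]]; [|exact Hq|].
  - apply not_nonpos_int_pos; lra.
  - exists M. split; [exact HM|]. intros n. rewrite <- poch_1. apply H.
Qed.

Lemma Cmod_poch_le (a : C) (A : R) (n : nat) : Cmod a <= A ->
  Cmod (poch a n) <= Cmod (poch (RtoC A) n).
Proof.
  intros H. assert (Ha := Cmod_ge_0 a). induction n as [|n IH]; [apply Rle_refl|].
  rewrite !poch_S, !Cmod_mult.
  apply Rmult_le_compat; [apply Cmod_ge_0|apply Cmod_ge_0|exact IH|].
  rewrite <- RtoC_plus, Cmod_R. assert (Hn := pos_INR n). rewrite Rabs_pos_eq by lra.
  eapply Rle_trans; [apply Cmod_triangle|]. rewrite Cmod_R, Rabs_pos_eq by lra. lra.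
Qed.

Lemma poch_real_nonneg (A : R) (n : nat) : 0 <= A ->
  poch (RtoC A) n = RtoC (Cmod (poch (RtoC A) n)).
Proof.
  intros HA. induction n as [|n IH].
  - simpl. now rewrite Cmod_1.
  - rewrite poch_S, Cmod_mult, RtoC_mult, <- IH. f_equal.
    rewrite <- RtoC_plus, Cmod_R, Rabs_pos_eq; [reflexivity|].
    generalize (pos_INR n); lra.
Qed.

(** * Complex-valued functions of a real variable *)

Definition is_Cderive (f : R -> C) (t : R) (l : C) : Prop :=
  is_derive (fun s => Re (f s)) t (Re l) /\ is_derive (fun s => Im (f s)) t (Im l).

Lemma Cderive_const (c : C) (t : R) : is_Cderive (fun _ => c) t 0.
Proof. split; apply (is_derive_const (V := R_NormedModule)). Qed.

Lemma Cderive_RtoC (f : R -> R) (t l : R) : is_derive f t l -> is_Cderive (fun s => RtoC (f s)) t (RtoC l).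
Proof. intros H. split; simpl; [exact H|]. apply (is_derive_const (V := R_NormedModule)). Qed.

Lemma Cderive_ext (f g : R -> C) (t : R) (l : C) :
  locally t (fun s => f s = g s) -> is_Cderive f t l -> is_Cderive g t l.
Proof.
  intros He [H1 H2]. split.
  - revert H1. apply is_derive_ext_loc. revert He. apply filter_imp. now intros s ->.
  - revert H2. apply is_derive_ext_loc. revert He. apply filter_imp. now intros s ->.
Qed.

Lemma Cderive_eq (f : R -> C) (t : R) (l m : C) : l = m -> is_Cderive f t l -> is_Cderive f t m.
Proof. now intros ->. Qed.

Lemma Cderive_plus (f g : R -> C) (t : R) (l m : C) :
  is_Cderive f t l -> is_Cderive g t m -> is_Cderive (fun s => f s + g s)%C t (l + m)%C.
Proof. intros [H1 H2] [H3 H4]. split; now apply (is_derive_plus (V := R_NormedModule)). Qed.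

Lemma Cderive_opp (f : R -> C) (t : R) (l : C) : is_Cderive f t l -> is_Cderive (fun s => - f s)%C t (- l)%C.
Proof. intros [H1 H2]. split; now apply (is_derive_opp (V := R_NormedModule)). Qed.

Lemma Cderive_minus (f g : R -> C) (t : R) (l m : C) :
  is_Cderive f t l -> is_Cderive g t m -> is_Cderive (fun s => f s - g s)%C t (l - m)%C.
Proof. intros H1 H2. apply Cderive_plus; [exact H1|]. now apply Cderive_opp. Qed.

Lemma Cderive_mult (f g : R -> C) (t : R) (l m : C) :
  is_Cderive f t l -> is_Cderive g t m -> is_Cderive (fun s => f s * g s)%C t (l * g t + f t * m)%C.
Proof.
  intros [H1 H2] [H3 H4]. split.
  - replace (Re (l * g t + f t * m)%C)
      with ((Re l * Re (g t) + Re (f t) * Re m) - (Im l * Im (g t) + Im (f t) * Im m))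
      by (unfold Re, Im; simpl; ring).
    apply (is_derive_minus (fun s => Re (f s) * Re (g s)) (fun s => Im (f s) * Im (g s)));
      apply (is_derive_mult (K := R_AbsRing)); try assumption; intros; apply Rmult_comm.
  - replace (Im (l * g t + f t * m)%C)
      with ((Re l * Im (g t) + Re (f t) * Im m) + (Im l * Re (g t) + Im (f t) * Re m))
      by (unfold Re, Im; simpl; ring).
    apply (is_derive_plus (fun s => Re (f s) * Im (g s)) (fun s => Im (f s) * Re (g s)));
      apply (is_derive_mult (K := R_AbsRing)); try assumption; intros; apply Rmult_comm.
Qed.

Lemma Cderive_scal (c : C) (f : R -> C) (t : R) (l : C) :
  is_Cderive f t l -> is_Cderive (fun s => c * f s)%C t (c * l)%C.
Proof.
  intros H. apply Cderive_eq with (0 * f t + c * l)%C; [ring|].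
  apply Cderive_mult; [apply Cderive_const|exact H].
Qed.

Lemma Cderive_comp (f : R -> C) (g : R -> R) (t d : R) (l : C) :
  is_Cderive f (g t) l -> is_derive g t d -> is_Cderive (fun s => f (g s)) t (RtoC d * l)%C.
Proof.
  intros [H1 H2] Hg. split.
  - replace (Re (RtoC d * l)%C) with (d * Re l) by (unfold Re; simpl; ring).
    apply (is_derive_comp (fun s => Re (f s)) g t (Re l) d H1 Hg).
  - replace (Im (RtoC d * l)%C) with (d * Im l) by (unfold Im; simpl; ring).
    apply (is_derive_comp (fun s => Im (f s)) g t (Im l) d H2 Hg).
Qed.

Lemma Cderive_Cexp (f : R -> C) (t : R) (l : C) :
  is_Cderive f t l -> is_Cderive (fun s => Cexp (f s)) t (l * Cexp (f t))%C.
Proof.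
  intros [H1 H2].
  assert (E : is_derive (fun s => exp (Re (f s))) t (Re l * exp (Re (f t)))).
  { apply (is_derive_comp exp (fun s => Re (f s)) t); [apply is_derive_exp|exact H1]. }
  assert (Ec : is_derive (fun s => cos (Im (f s))) t (Im l * - sin (Im (f t)))).
  { apply (is_derive_comp cos (fun s => Im (f s)) t); [apply is_derive_cos|exact H2]. }
  assert (Es : is_derive (fun s => sin (Im (f s))) t (Im l * cos (Im (f t)))).
  { apply (is_derive_comp sin (fun s => Im (f s)) t); [apply is_derive_sin|exact H2]. }
  split.
  - replace (Re (l * Cexp (f t))%C) with (Re l * exp (Re (f t)) * cos (Im (f t))
      + exp (Re (f t)) * (Im l * - sin (Im (f t)))) by (unfold Cexp, Re, Im; simpl; ring).
    apply (is_derive_mult (K := R_AbsRing) (fun s => exp (Re (f s))) (fun s => cos (Im (f s))));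
      try assumption; intros; apply Rmult_comm.
  - replace (Im (l * Cexp (f t))%C) with (Re l * exp (Re (f t)) * sin (Im (f t))
      + exp (Re (f t)) * (Im l * cos (Im (f t)))) by (unfold Cexp, Re, Im; simpl; ring).
    apply (is_derive_mult (K := R_AbsRing) (fun s => exp (Re (f s))) (fun s => sin (Im (f s))));
      try assumption; intros; apply Rmult_comm.
Qed.

Lemma Cderive_Cps (p : nat -> C) (r t : R) : Rabs t < r ->
  summable (fun n => p n * RtoC r ^ n)%C ->
  is_Cderive (fun s => Cps p (RtoC s)) t (Cps (fun n => RtoC (INR (S n)) * p (S n))%C (RtoC t)).
Proof.
  intros Ht H. assert (Hr : 0 <= r) by (generalize (Rabs_pos t); lra).
  destruct (summable_CV_radius p r Hr H) as [H1 H2].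
  assert (L : forall a, Rbar_le r (CV_radius a) -> Rbar_lt (Rabs t) (CV_radius a)).
  { intros a Ha. apply Rbar_lt_le_trans with (2 := Ha). exact Ht. }
  split.
  - rewrite Re_Cps. rewrite (PSeries_ext _ (PS_derive (fun n => Re (p n)))).
    + apply is_derive_ext with (PSeries (fun n => Re (p n))); [intros; now rewrite Re_Cps|].
      now apply is_derive_PSeries, L.
    + intros n. unfold PS_derive, Re. simpl. ring.
  - rewrite Im_Cps. rewrite (PSeries_ext _ (PS_derive (fun n => Im (p n)))).
    + apply is_derive_ext with (PSeries (fun n => Im (p n))); [intros; now rewrite Im_Cps|].
      now apply is_derive_PSeries, L.
    + intros n. unfold PS_derive, Im. simpl. ring.
Qed.

Lemma Cderive_unique (f : R -> C) (t : R) (l m : C) : is_Cderive f t l -> is_Cderive f t m -> l = m.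
Proof.
  intros [H1 H2] [H3 H4]. apply C_eq.
  - rewrite <- (is_derive_unique _ _ _ H1). now apply is_derive_unique.
  - rewrite <- (is_derive_unique _ _ _ H2). now apply is_derive_unique.
Qed.

Lemma is_derive_zero_const (f : R -> R) (a b : R) : a <= b ->
  (forall t, a <= t <= b -> is_derive f t 0) -> f a = f b.
Proof.
  intros Hab H.
  destruct (MVT_gen f a b (fun _ => 0)) as [c [_ Hc]].
  - intros t Ht. rewrite Rmin_left, Rmax_right in Ht by exact Hab. apply H; lra.
  - intros t Ht. rewrite Rmin_left, Rmax_right in Ht by exact Hab.
    apply derivable_continuous_pt. exists 0. apply is_derive_Reals. apply H; lra.
  - lra.
Qed.

Lemma Cderive_zero_const (f : R -> C) (a b : R) : a <= b ->
  (forall t, a <= t <= b -> is_Cderive f t 0) -> f a = f b.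
Proof.
  intros Hab H. apply C_eq.
  - apply (is_derive_zero_const (fun t => Re (f t)) a b Hab). intros t Ht. apply (H t Ht).
  - apply (is_derive_zero_const (fun t => Im (f t)) a b Hab). intros t Ht. apply (H t Ht).
Qed.

Lemma Cderive_Clim (f : R -> C) (t : R) (l : C) : is_Cderive f t l -> Clim (locally t) f (f t).
Proof.
  intros [H1 H2]. apply Clim_Re_Im; [typeclasses eauto| |].
  - apply (ex_derive_continuous (V := R_NormedModule)). now exists (Re l).
  - apply (ex_derive_continuous (V := R_NormedModule)). now exists (Im l).
Qed.

(** * The binomial series *)

Definition bin (a : C) (n : nat) : C := (poch a n / RtoC (INR (fact n)))%C.

Lemma INR_S_C_neq_0 (n : nat) : RtoC (INR (S n)) <> 0.
Proof. intros E. apply RtoC_inj in E. now apply (not_0_INR (S n)). Qed.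

Lemma fact_S_C (n : nat) :
  RtoC (INR (fact (S n))) = (RtoC (INR (S n)) * RtoC (INR (fact n)))%C.
Proof. rewrite <- RtoC_mult, <- mult_INR. reflexivity. Qed.

Lemma bin_derive (a : C) (n : nat) :
  (RtoC (INR (S n)) * bin a (S n))%C = (a * bin (a + 1) n)%C.
Proof.
  unfold bin. rewrite poch_S_l, fact_S_C. field.
  split; [apply fact_C_neq_0|apply INR_S_C_neq_0].
Qed.

Lemma bin_0 (a : C) : bin a 0 = 1.
Proof. unfold bin. simpl. field. Qed.

Lemma exists_ratio_gt (x : R) : 0 <= x < 1 -> exists q, 1 < q /\ q * x < 1.
Proof.
  intros Hx. exists (2 / (1 + x)). split.
  - apply Rmult_lt_reg_r with (1 + x); [lra|]. unfold Rdiv.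
    rewrite Rmult_assoc, Rinv_l by lra. lra.
  - apply Rmult_lt_reg_r with (1 + x); [lra|].
    replace (2 / (1 + x) * x * (1 + x)) with (2 * x) by (field; lra). lra.
Qed.

Lemma bin_summable (a z : C) : Cmod z < 1 -> summable (fun n => bin a n * z ^ n)%C.
Proof.
  intros Hz. destruct (exists_ratio_gt (Cmod z)) as [q [Hq1 Hq2]].
  { split; [apply Cmod_ge_0|exact Hz]. }
  destruct (poch_fact_ratio a q Hq1) as [M [_ H]].
  apply summable_pow_geom with (2 := H); [lra|exact Hq2].
Qed.

(** The identity (1 - z) (1 - z)^(-a-1) = (1 - z)^(-a), read on coefficients as
    Pascal's rule. *)
Lemma bin_lower (a z : C) : Cmod z < 1 ->
  ((1 - z) * Cps (bin (a + 1)) z)%C = Cps (bin a) z.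
Proof.
  intros Hz. assert (A := bin_summable a z Hz). assert (A1 := bin_summable (a + 1) z Hz).
  assert (A0 := proj1 (summable_incr_1 _) A). assert (Az := summable_scal z _ A1).
  transitivity (Cps (bin (a + 1)) z - z * Cps (bin (a + 1)) z)%C; [ring|].
  unfold Cps. rewrite (CSeries_incr_1 _ A).
  rewrite (CSeries_incr_1 _ A1) at 1. rewrite <- (CSeries_scal z _ A1).
  rewrite (CSeries_ext (fun n => bin (a + 1) (S n) * z ^ S n)%C
    (fun n => z * (bin (a + 1) n * z ^ n) + bin a (S n) * z ^ S n)%C).
  - rewrite (CSeries_plus _ _ Az A0), !bin_0. simpl. ring.
  - intros n. unfold bin. rewrite (poch_S_l a), !poch_S, fact_S_C, S_INR, RtoC_plus, Cpow_S.
    assert (N := INR_S_C_neq_0 n). rewrite S_INR, RtoC_plus in N. field.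
    split; [apply fact_C_neq_0|exact N].
Qed.

Lemma bin_neq_0 (c : C) (n : nat) : not_nonpos_int c -> bin c n <> 0.
Proof.
  intros Hc E. apply (poch_neq_0 c n Hc).
  replace (poch c n) with (bin c n * RtoC (INR (fact n)))%C
    by (unfold bin; field; apply fact_C_neq_0).
  rewrite E. ring.
Qed.

(** The ray stays in the right half-plane, where the argument is an arctangent. *)
Lemma Cderive_CLog_ray (w : C) (t : R) : 0 < 1 + t * Re w ->
  is_Cderive (fun s => CLog (1 + RtoC s * w)%C) t (w / (1 + RtoC t * w))%C.
Proof.
  intros Ht. destruct w as [p q]. simpl in Ht.
  assert (Hloc : locally t (fun s => 0 < 1 + s * p)).
  { assert (Hc : continuous (fun s => 1 + s * p) t).
    { apply (ex_derive_continuous (V := R_NormedModule)). auto_derive. auto. }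
    apply (Hc (fun y => 0 < y)). apply (open_gt 0). exact Ht. }
  assert (Hpos : 0 < (1 + t * p) * (1 + t * p) + t * q * (t * q)) by nra.
  apply (Cderive_ext (fun s => (ln (sqrt ((1 + s * p) * (1 + s * p) + s * q * (s * q))),
                           atan (s * q / (1 + s * p))))).
  { revert Hloc. apply filter_imp. intros s Hs. unfold CLog.
    assert (HR : Re (1 + RtoC s * (p, q))%C = 1 + s * p) by (simpl; ring).
    assert (HI : Im (1 + RtoC s * (p, q))%C = s * q) by (simpl; ring).
    rewrite Arg_atan, HR, HI by (rewrite HR; exact Hs).
    f_equal. f_equal. unfold Cmod. f_equal.
    change (fst (1 + RtoC s * (p,q))%C) with (Re (1 + RtoC s * (p, q))%C).
    change (snd (1 + RtoC s * (p,q))%C) with (Im (1 + RtoC s * (p, q))%C).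
    rewrite HR, HI. ring. }
  assert (Hinv : ((p, q) / (1 + RtoC t * (p, q)))%C
     = ((p * (1 + t * p) + q * (t * q)) / ((1 + t * p) * (1 + t * p) + t * q * (t * q)),
        (q * (1 + t * p) - p * (t * q)) / ((1 + t * p) * (1 + t * p) + t * q * (t * q)))).
  { unfold Cdiv, Cinv, Cmult, Cplus, RtoC; simpl. f_equal; field; nra. }
  rewrite Hinv. split; simpl.
  - auto_derive.
    + split; [exact Hpos|]. split; [now apply sqrt_lt_R0|exact I].
    + set (A := (1 + t * p) * (1 + t * p) + t * q * (t * q)) in *.
      assert (HA : sqrt A * sqrt A = A) by (apply sqrt_sqrt; lra).
      assert (HA0 : 0 < sqrt A) by now apply sqrt_lt_R0.
      transitivity ((p * (1 + t * p) + q * (t * q)) / (sqrt A * sqrt A)).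
      * field. lra.
      * now rewrite HA.
  - auto_derive.
    + lra.
    + unfold Rsqr. field. split; nra.
Qed.

(** Along the ray s |-> s w the series solves the first-order equation of the
    power, so that their quotient is constant. *)
Lemma binomial_series (a w : C) : Cmod w < 1 ->
  Cps (bin a) (- w) = Cpower (1 + w) (- a).
Proof.
  intros Hw. assert (Hw0 := Cmod_ge_0 w).
  set (b := fun n => (bin a n * (- w) ^ n)%C).
  assert (Eb : forall s n, (bin a n * (- w * s) ^ n = b n * s ^ n)%C)
    by (intros; unfold b; rewrite Cpow_mult_l; ring).
  destruct (exists_ratio_gt (Cmod w)) as [r [Hr1 Hr2]]; [lra|].
  set (B := fun s : R => Cps b (RtoC s)).
  assert (HR : forall t, Re (1 + RtoC t * w)%C = 1 + t * Re w)
    by (intros; unfold Re; simpl; ring).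
  assert (Hre : forall t, 0 <= t <= 1 -> 0 < 1 + t * Re w).
  { intros t Ht. assert (H1 := re_le_Cmod w). apply Rabs_le_between in H1. nra. }
  assert (Hne : forall t, 0 <= t <= 1 -> (1 + RtoC t * w)%C <> 0).
  { intros t Ht E0. assert (Hz := Hre t Ht). rewrite <- HR, E0 in Hz. simpl in Hz. lra. }
  assert (HB : forall t, 0 <= t <= 1 -> is_Cderive B t (- a * w / (1 + RtoC t * w) * B t)%C).
  { intros t Ht.
    assert (Hrt : summable (fun n => b n * RtoC r ^ n)%C).
    { apply (summable_ext _ _ (Eb (RtoC r))), bin_summable.
      rewrite Cmod_mult, Cmod_opp, Cmod_R, Rabs_pos_eq; lra. }
    assert (Hzt : Cmod (- w * RtoC t)%C < 1).
    { rewrite Cmod_mult, Cmod_opp, Cmod_R, Rabs_pos_eq; nra. }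
    apply Cderive_eq with (2 := Cderive_Cps b r t ltac:(rewrite Rabs_pos_eq; lra) Hrt).
    transitivity (- a * w * Cps (bin (a + 1)) (- w * RtoC t))%C.
    - unfold Cps. rewrite <- (CSeries_scal _ _ (bin_summable (a + 1) _ Hzt)).
      apply CSeries_ext. intros n. unfold b.
      transitivity (RtoC (INR (S n)) * bin a (S n) * ((- w) ^ S n * RtoC t ^ n))%C; [ring|].
      rewrite bin_derive, Cpow_mult_l, Cpow_S. ring.
    - assert (HBt : B t = Cps (bin a) (- w * RtoC t))
        by (unfold B; apply CSeries_ext; intros n; now rewrite Eb).
      rewrite HBt, <- (bin_lower a _ Hzt). assert (N := Hne t Ht). field. exact N. }
  set (L := fun s : R => Cexp (a * CLog (1 + RtoC s * w))%C).
  assert (HK : (B 0 * L 0)%C = (B 1 * L 1)%C).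
  { apply (Cderive_zero_const (fun s => B s * L s)%C); [lra|]. intros t Ht.
    assert (HL : is_Cderive L t (a * (w / (1 + RtoC t * w)) * L t)%C).
    { apply Cderive_Cexp, Cderive_scal, Cderive_CLog_ray. now apply Hre. }
    apply Cderive_eq with (2 := Cderive_mult _ _ _ _ _ (HB t Ht) HL).
    assert (N := Hne t Ht). field. exact N. }
  assert (HB0 : B 0 = 1) by (unfold B; rewrite Cps_at_0; unfold b; rewrite bin_0; simpl; ring).
  assert (HL0 : L 0 = 1).
  { unfold L. replace (1 + RtoC 0 * w)%C with (RtoC 1) by ring.
    rewrite CLog_pos by lra. rewrite ln_1, Cmult_0_r. apply Cexp_0. }
  rewrite HB0, HL0 in HK.
  assert (HB1 : B 1 = Cps (bin a) (- w)).
  { unfold B, Cps. apply CSeries_ext. intros n. unfold b. rewrite Cpow_1_l. ring. }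
  assert (HL1 : L 1 = Cpower (1 + w) a) by (unfold L, Cpower; do 3 f_equal; ring).
  assert (HLn := Cpower_neq_0 (1 + w) a). rewrite HB1, HL1 in HK.
  rewrite Cpower_opp.
  transitivity (Cps (bin a) (- w) * Cpower (1 + w) a * / Cpower (1 + w) a)%C;
    [field; exact HLn|]. rewrite <- HK. ring.
Qed.

(** For real A all terms are nonnegative, so that the binomial series also
    evaluates the sum of the moduli. *)
Lemma bin_real_sum (A s : R) : 0 <= A -> 0 <= s < 1 ->
  is_series (fun j => Cmod (bin (RtoC A) j) * s ^ j) (Rpower (1 - s) (- A)).
Proof.
  intros HA0 Hs.
  assert (Hz : Cmod (RtoC s) < 1) by (rewrite Cmod_R, Rabs_pos_eq; lra).
  assert (HA := bin_summable (RtoC A) (RtoC s) Hz).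
  assert (E : forall j, Re (bin (RtoC A) j * RtoC s ^ j)%C = Cmod (bin (RtoC A) j) * s ^ j).
  { intros j. rewrite <- RtoC_pow, Re_mult_RtoC. f_equal. unfold bin.
    assert (Hf : 0 < INR (fact j)) by (apply lt_0_INR, lt_O_fact).
    rewrite Cmod_div, Cmod_R, Rabs_pos_eq by (try apply fact_C_neq_0; lra).
    rewrite poch_real_nonneg by exact HA0. rewrite <- RtoC_div by lra.
    simpl. now rewrite Cmod_R, (Rabs_pos_eq (Cmod _)) by apply Cmod_ge_0. }
  assert (H1 : Re (Cps (bin (RtoC A)) (RtoC s)) = Rpower (1 - s) (- A)).
  { replace (RtoC s) with (- RtoC (- s))%C by (rewrite RtoC_opp; ring).
    rewrite binomial_series by (rewrite RtoC_opp, Cmod_opp; exact Hz).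
    rewrite <- RtoC_plus. unfold Cpower. rewrite CLog_pos by lra.
    rewrite <- RtoC_opp, <- RtoC_mult. unfold Cexp; simpl. now rewrite cos_0, Rmult_1_r. }
  rewrite <- H1. apply is_series_ext with (1 := E). apply (Series_correct _ (summable_Re _ HA)).
Qed.

Lemma bin_nat_sum (A : nat) (s : R) : 0 <= s < 1 ->
  is_series (fun j => Cmod (bin (RtoC (INR A)) j) * s ^ j) ((/ (1 - s)) ^ A).
Proof.
  intros Hs. rewrite pow_inv, <- Rpower_pow, <- Rpower_Ropp by lra.
  apply bin_real_sum; [apply pos_INR|exact Hs].
Qed.

Lemma bin_le (a : C) (A : nat) (j : nat) : Cmod a <= INR A ->
  Cmod (bin a j) <= Cmod (bin (RtoC (INR A)) j).
Proof.
  intros H. unfold bin. rewrite !Cmod_div by apply fact_C_neq_0.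
  apply Rmult_le_compat_r.
  - left. apply Rinv_0_lt_compat, Cmod_gt_0, fact_C_neq_0.
  - exact (Cmod_poch_le a (INR A) j H).
Qed.

(** A single term of the binomial series at 1/2, whose sum is 2^A. *)
Lemma bin_le_pow2 (a : C) (A : nat) (j : nat) : Cmod a <= INR A ->
  Cmod (bin a j) <= 2 ^ A * 2 ^ j.
Proof.
  intros H. eapply Rle_trans; [exact (bin_le a A j H)|].
  assert (Hs := bin_nat_sum A (1/2) ltac:(lra)).
  replace (/ (1 - 1/2)) with 2 in Hs by field.
  assert (P : forall k, 0 <= Cmod (bin (RtoC (INR A)) k) * (1/2) ^ k).
  { intros k. apply Rmult_le_pos; [apply Cmod_ge_0|apply pow_le; lra]. }
  assert (H1 : Cmod (bin (RtoC (INR A)) j) * (1/2) ^ j <= 2 ^ A).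
  { rewrite <- (is_series_unique _ _ Hs).
    eapply Rle_trans; [apply (term_le_sum_n _ j j P (le_n j))|].
    apply sum_n_le_Series; [exact P|]. now exists (2 ^ A). }
  assert (H2 : 0 < 2 ^ j) by (apply pow_lt; lra).
  replace (Cmod (bin (RtoC (INR A)) j))
    with (Cmod (bin (RtoC (INR A)) j) * (1/2) ^ j * 2 ^ j).
  - now apply Rmult_le_compat_r; [lra|].
  - rewrite Rmult_assoc, <- Rpow_mult_distr. replace (1/2*2) with 1 by field.
    rewrite pow1. ring.
Qed.

(** Functions z^(-a) S(1/z): analytic off the cut, by expanding each power
    z^(-a-k) about z0 with the binomial series. *)
Lemma analytic1_power_series (al : nat -> C) (a : C) (M rho : R) (z0 : C) :
  (forall k, Cmod (al k) <= M * rho ^ k) -> 0 <= rho < Cmod z0 -> Rabs (Arg z0) < PI ->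
  analytic1_at (fun z => Cpower z (- a) * Cps al (/ z))%C z0.
Proof.
  intros Hal Hrho HArg.
  assert (Hz0 : z0 <> 0) by (apply Cmod_gt_0; lra).
  (* d keeps arguments principal; (m - rho) / 2 keeps the double series convergent *)
  destruct (Arg_near_1 (PI - Rabs (Arg z0)) ltac:(lra)) as [d [Hd HAd]].
  destruct (exists_nat_ge (Cmod a)) as [A HA].
  set (m := Cmod z0) in *.
  set (r := Rmin ((m - rho) / 2) (d * m)).
  assert (Hr1 : r <= (m - rho) / 2) by apply Rmin_l.
  assert (Hr2 : r <= d * m) by apply Rmin_r.
  assert (Hr : 0 < r) by (apply Rmin_glb_lt; [lra|]; apply Rmult_lt_0_compat; lra).
  set (s := r / m).
  assert (Hsm : s * m = r) by (unfold s; field; lra).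
  assert (Hs0 : 0 < s) by (unfold s; apply Rdiv_lt_0_compat; lra).
  assert (Hs1 : s < 1) by nra.
  assert (HM : 0 <= M).
  { specialize (Hal 0%nat). simpl in Hal. assert (Hc := Cmod_ge_0 (al 0%nat)). lra. }
  set (u := fun k j => (al k * (Cpower z0 (- a) * (/ z0) ^ k)
                        * (bin (a + RtoC (INR k)) j * (- / z0) ^ j))%C).
  assert (Hinv : Cmod (/ z0) = / m) by (now rewrite Cmod_inv).
  assert (Hu : forall k j, Cmod (u k j * RtoC r ^ j) <=
      M * Cmod (Cpower z0 (- a)) * (rho / m) ^ k
      * (Cmod (bin (RtoC (INR (A + k))) j) * s ^ j)).
  { intros k j. unfold u. rewrite !Cmod_mult, !Cmod_pow, Cmod_opp, Hinv, Cmod_R, Rabs_pos_eq by lra.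
    assert (E1 : Cmod (bin (a + RtoC (INR k)) j) <= Cmod (bin (RtoC (INR (A + k))) j)).
    { apply bin_le. rewrite plus_INR. eapply Rle_trans; [apply Cmod_triangle|].
      rewrite Cmod_R, (Rabs_pos_eq (INR k)) by apply pos_INR. lra. }
    assert (E2 : (/ m) ^ j * r ^ j = s ^ j).
    { rewrite <- Rpow_mult_distr. f_equal. unfold s. field. lra. }
    assert (E3 : (rho / m) ^ k = rho ^ k * (/ m) ^ k) by apply Rpow_mult_distr.
    rewrite E3.
    assert (P1 : 0 <= (/ m) ^ k) by (apply pow_le; left; apply Rinv_0_lt_compat; lra).
    assert (P2 : 0 <= s ^ j) by (apply pow_le; lra).
    assert (P3 := Cmod_ge_0 (Cpower z0 (- a))).
    assert (P4 := Cmod_ge_0 (bin (a + RtoC (INR k)) j)).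
    assert (P5 := Cmod_ge_0 (al k)).
    replace (Cmod (al k) * (Cmod (Cpower z0 (- a)) * (/ m) ^ k)
       * (Cmod (bin (a + RtoC (INR k)) j) * (/ m) ^ j) * r ^ j)
      with ((Cmod (al k) * (Cmod (Cpower z0 (- a)) * (/ m) ^ k))
       * (Cmod (bin (a + RtoC (INR k)) j) * ((/ m) ^ j * r ^ j))) by ring.
    rewrite E2.
    replace (M * Cmod (Cpower z0 (- a)) * (rho ^ k * (/ m) ^ k))
      with ((M * rho ^ k) * (Cmod (Cpower z0 (- a)) * (/ m) ^ k)) by ring.
    apply Rmult_le_compat.
    - apply Rmult_le_pos; [exact P5|]. now apply Rmult_le_pos.
    - now apply Rmult_le_pos.
    - apply Rmult_le_compat_r; [now apply Rmult_le_pos|apply Hal].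
    - apply Rmult_le_compat_r; [exact P2|exact E1]. }
  assert (Hrow : forall k, is_series (fun j => M * Cmod (Cpower z0 (- a)) * (rho / m) ^ k
      * (Cmod (bin (RtoC (INR (A + k))) j) * s ^ j))
      (M * Cmod (Cpower z0 (- a)) * (rho / m) ^ k * (/ (1 - s)) ^ (A + k))).
  { intros k. apply (is_series_scal (V := R_NormedModule)
      (M * Cmod (Cpower z0 (- a)) * (rho / m) ^ k)). apply bin_nat_sum. lra. }
  apply (analytic1_double _ z0 u r Hr).
  - apply (summable2_of_rows _ (fun k => M * Cmod (Cpower z0 (- a)) * (/ (1 - s)) ^ A
                            * (rho / m * / (1 - s)) ^ k)).
    + intros k. apply summable_le with (1 := Hu k). eexists. apply Hrow.
    + intros k. eapply Rle_trans.
      * apply Series_le; [|eexists; apply (Hrow k)].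
        intros j. split; [apply Cmod_ge_0|apply Hu].
      * rewrite (is_series_unique _ _ (Hrow k)).
        rewrite pow_add, (Rpow_mult_distr (rho / m)). right. ring.
    + apply ex_series_geom_scal. rewrite Rabs_pos_eq.
      * apply Rmult_lt_reg_r with ((1 - s) * m); [apply Rmult_lt_0_compat; lra|].
        replace (rho / m * / (1 - s) * ((1 - s) * m)) with rho by (field; lra). nra.
      * apply Rmult_le_pos; [apply Rdiv_le_0_compat; lra|].
        left; apply Rinv_0_lt_compat; lra.
  - intros z Hz. set (h := (z - z0)%C) in *.
    assert (Hq : Cmod (h / z0) < s).
    { rewrite Cmod_div by exact Hz0. fold m. unfold s.
      apply Rmult_lt_compat_r; [apply Rinv_0_lt_compat; lra|exact Hz]. }
    set (v := (1 + h / z0)%C).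
    assert (Hzv : z = (z0 * v)%C) by (unfold v, h; field; exact Hz0).
    assert (Hv : v <> 0).
    { intros E. assert (T := Cmod_triangle_rev (RtoC 1) v).
      rewrite E, Cmod_0, Cmod_1 in T. unfold v in E.
      assert (h / z0 = -1)%C.
      { replace (h / z0)%C with (1 + h / z0 - 1)%C by ring. rewrite E. ring. }
      rewrite H in Hq. rewrite Cmod_R, Rabs_left in Hq; lra. }
    assert (Hzn : z <> 0) by (rewrite Hzv; now apply Cmult_neq_0).
    assert (HArgv : Rabs (Arg z0 + Arg v) < PI).
    { eapply Rle_lt_trans; [apply Rabs_triang|].
      assert (Rabs (Arg v) < PI - Rabs (Arg z0)); [|lra]. apply HAd.
      unfold v. replace (1 + h / z0 - 1)%C with (h / z0)%C by ring.
      apply Rlt_le_trans with (1 := Hq). apply Rmult_le_reg_r with m; lra. }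
    assert (Hzm : rho < Cmod z).
    { assert (T := Cmod_triangle_rev z0 (z0 - z)).
      replace (z0 - (z0 - z))%C with z in T by ring.
      rewrite (Cmod_minus_sym z0 z) in T. fold h in T. fold m in T. lra. }
    unfold Cps at 1. rewrite <- CSeries_scal.
    + apply CSeries_ext. intros k. unfold Cps.
      rewrite (CSeries_ext _ (fun j => al k * (Cpower z0 (- a) * (/ z0) ^ k)
                        * (bin (a + RtoC (INR k)) j * (- (h / z0)) ^ j))%C).
      2:{ intros j. unfold u.
          replace (- (h / z0))%C with ((- / z0) * h)%C by (field; exact Hz0).
          rewrite Cpow_mult_l. ring. }
      rewrite CSeries_scal.
      2:{ apply bin_summable. rewrite Cmod_opp. lra. }
      change (CSeries (fun n => bin (a + RtoC (INR k)) n * (- (h / z0)) ^ n)%C)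
        with (Cps (bin (a + RtoC (INR k))) (- (h / z0))).
      rewrite binomial_series by lra. fold v.
      replace (Cpower z (- a) * (al k * (/ z) ^ k))%C
        with (al k * (Cpower z (- a) * (/ z) ^ k))%C by ring.
      rewrite <- !Cpower_minus_INR by assumption. rewrite Hzv, Cpower_mult by assumption.
      replace (- (a + RtoC (INR k)))%C with (- a - RtoC (INR k))%C by ring. ring.
    + apply summable_pow_geom with (2 := Hal); [lra|]. rewrite Cmod_inv by exact Hzn.
      apply Rmult_lt_reg_r with (Cmod z); [lra|].
      rewrite Rmult_assoc, Rinv_l by lra. lra.
Qed.

(** * The reciprocal Gamma function *)

Lemma product_step_bound (P e : nat -> C) (n : nat) :
  (forall k, P (S k) = (P k * (1 + e k))%C) ->
  Cmod (P (S n)) <= Cmod (P 0%nat) * exp (sum_n (fun k => Cmod (e k)) n).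
Proof.
  intros H.
  assert (Hf : forall k, Cmod (P (S k)) <= Cmod (P k) * exp (Cmod (e k))).
  { intros k. rewrite H, Cmod_mult. apply Rmult_le_compat_l; [apply Cmod_ge_0|].
    eapply Rle_trans; [apply Cmod_triangle|]. rewrite Cmod_1. apply exp_ineq1_le. }
  induction n as [|n IH].
  - rewrite sum_O. apply Hf.
  - rewrite sum_n_R_S, exp_plus, <- Rmult_assoc.
    eapply Rle_trans; [apply Hf|]. apply Rmult_le_compat_r; [left; apply exp_pos|exact IH].
Qed.

(** The increments P_k e_k are summable because the products stay bounded. *)
Lemma product_converges (P e : nat -> C) :
  (forall k, P (S k) = (P k * (1 + e k))%C) -> summable e ->
  exists l, Clim eventually P l.
Proof.
  intros H He.
  set (B := Rmax (Cmod (P 0%nat)) (Cmod (P 0%nat) * exp (Series (fun k => Cmod (e k))))).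
  assert (HB : forall n, Cmod (P n) <= B).
  { intros [|n]; [apply Rmax_l|].
    eapply Rle_trans; [apply (product_step_bound P e n H)|].
    eapply Rle_trans; [|apply Rmax_r]. apply Rmult_le_compat_l; [apply Cmod_ge_0|].
    assert (Hs : sum_n (fun k => Cmod (e k)) n <= Series (fun k => Cmod (e k))).
    { apply (sum_n_le_Series (fun k => Cmod (e k))); [intros; apply Cmod_ge_0|exact He]. }
    destruct Hs as [Hs|Hs]; [left; now apply exp_increasing|right; now rewrite Hs]. }
  assert (HA : summable (fun k => P k * e k)%C).
  { apply summable_le with (fun k => B * Cmod (e k)).
    - intros k. rewrite Cmod_mult. apply Rmult_le_compat_r; [apply Cmod_ge_0|apply HB].
    - now apply (ex_series_scal (V := R_NormedModule) B). }
  assert (E : forall n, (P 0%nat + sum_n (fun k => P k * e k)%C n)%C = P (S n)).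
  { induction n as [|n IH].
    - rewrite sum_O, H. ring.
    - rewrite sum_n_Cplus_S, (H (S n)), <- IH. ring. }
  exists (P 0%nat + CSeries (fun k => P k * e k)%C)%C.
  intros eps Heps.
  assert (Hl : Clim eventually (fun n => P (S n)) (P 0%nat + CSeries (fun k => P k * e k)%C)%C).
  { apply (Clim_ext eventually _ _ _ E). clim.
    now apply CSeries_correct. }
  destruct (Hl eps Heps) as [N HN]. exists (S N). intros [|n] Hn; [lia|]. apply HN. lia.
Qed.

(** The reciprocals form a product of the same kind, with e replaced by
    - e / (1 + e), hence converge as well. *)
Lemma product_limit_neq_0 (P e : nat -> C) (l : C) :
  (forall k, P (S k) = (P k * (1 + e k))%C) -> summable e -> (forall k, P k <> 0) ->
  Clim eventually P l -> l <> 0.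
Proof.
  intros H He HP Hl.
  assert (Hex : exists N, forall n, (N <= n)%nat -> Cmod (e n) <= 1 / 2).
  { assert (Hz := ex_series_lim_0 _ He). apply is_lim_seq_spec in Hz.
    destruct (Hz (mkposreal (1/2) ltac:(lra))) as [N HN]. exists N. intros n Hn.
    specialize (HN n Hn). simpl in HN. rewrite Rminus_0_r, Rabs_pos_eq in HN by apply Cmod_ge_0.
    lra. }
  destruct Hex as [N HN].
  assert (Hne : forall k, (1 + e k)%C <> 0).
  { intros k E. apply (HP (S k)). rewrite H, E. ring. }
  destruct (product_converges (fun n => / P (N + n)%nat)%C
              (fun n => - e (N + n)%nat / (1 + e (N + n)%nat))%C) as [m Hm].
  - intros k. rewrite Nat.add_succ_r, H. field. split; [apply Hne|apply HP].
  - apply summable_le with (fun n => 2 * Cmod (e (N + n)%nat)).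
    + intros n. rewrite Cmod_div, Cmod_opp by apply Hne.
      assert (T := Cmod_triangle_rev (RtoC 1) (- e (N + n)%nat)).
      replace (1 - - e (N + n)%nat)%C with (1 + e (N + n)%nat)%C in T by ring.
      rewrite Cmod_1, Cmod_opp in T. specialize (HN (N + n)%nat ltac:(lia)).
      assert (P0 := Cmod_ge_0 (e (N + n)%nat)).
      apply Rmult_le_reg_r with (Cmod (1 + e (N + n)%nat)); [lra|].
      unfold Rdiv. rewrite Rmult_assoc, Rinv_l by lra. nra.
    + apply (ex_series_scal (V := R_NormedModule) 2 (fun n => Cmod (e (N + n)%nat))).
      now apply (ex_series_incr_n (V := R_NormedModule) (fun n => Cmod (e n)) N).
  - intros E. rewrite E in Hl.
    assert (H1 : Clim eventually (fun n => P (N + n)%nat * / P (N + n)%nat)%C (0 * m)%C).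
    { clim.
      intros eps Heps. destruct (Hl eps Heps) as [N' HN']. exists N'. intros n Hn.
      apply HN'. lia. }
    assert (H2 : Clim eventually (fun n => P (N + n)%nat * / P (N + n)%nat)%C 1).
    { apply (Clim_ext eventually (fun _ => RtoC 1)).
      - intros n. field. apply HP.
      - clim. }
    assert (H3 := Clim_unique eventually _ _ _ H1 H2).
    rewrite Cmult_0_l in H3. apply RtoC_inj in H3. lra.
Qed.

(** Telescoping comparison with 1/n - 1/(n+1). *)
Lemma ex_series_inv_sqr : ex_series (fun n => / (INR (n + 2)) ^ 2).
Proof.
  apply (ex_series_bounded _ 1).
  - intros n. left. apply Rinv_0_lt_compat, pow_lt, lt_0_INR. lia.
  - assert (H : forall n, sum_n (fun n => / (INR (n + 2)) ^ 2) n <= 1 - / INR (n + 2)).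
    { induction n as [|n IH].
      - rewrite sum_O. simpl. lra.
      - rewrite sum_n_R_S. replace (S n + 2)%nat with (S (n + 2)) by lia.
        rewrite S_INR. set (x := INR (n + 2)) in *.
        assert (Hx : 0 < x) by (apply lt_0_INR; lia).
        assert (/ (x + 1) ^ 2 <= / x - / (x + 1)); [|lra].
        replace (/ x - / (x + 1)) with (/ (x * (x + 1))) by (field; lra).
        apply Rinv_le_contravar; nra. }
    intros n. eapply Rle_trans; [apply H|].
    assert (0 < / INR (n + 2)) by (apply Rinv_0_lt_compat, lt_0_INR; lia). lra.
Qed.

Lemma Cpower_INR_base (n : nat) (z : C) : (0 < n)%nat ->
  Cpower (RtoC (INR n)) z = Cexp (z * RtoC (ln (INR n)))%C.
Proof. intros Hn. unfold Cpower. rewrite CLog_pos; [reflexivity|]. now apply lt_0_INR. Qed.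

(** Consecutive Gauss quotients differ by a factor 1 + O(1/n^2), by the
    binomial expansion of (1 - 1/n)^z. *)
Lemma rGamma_seq_ratio (z : C) : exists e : nat -> C,
  summable e /\ forall n, rGamma_seq z (S (S n)) = (rGamma_seq z (S n) * (1 + e n))%C.
Proof.
  set (R2 := fun k => Cps (fun n => bin (- z) (S (S n))) (RtoC (/ INR k))).
  exists (fun n => let k := RtoC (/ INR (n + 2)) in
    (k ^ 2 * (- z ^ 2 + (1 + z * k) * R2 (n + 2)%nat))%C).
  assert (Hhalf : summable (fun n => bin (- z) n * RtoC (1/2) ^ n)%C).
  { apply bin_summable. rewrite Cmod_R, Rabs_pos_eq; lra. }
  assert (H20 : RtoC (1/2) <> 0) by (intros E; apply RtoC_inj in E; lra).
  assert (Hhalf2 := summable_pow_shift _ _ H20 (summable_pow_shift _ _ H20 Hhalf)).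
  assert (Hk : forall n, 0 < / INR (n + 2) <= 1/2).
  { intros n. split; [apply Rinv_0_lt_compat, lt_0_INR; lia|].
    replace (1/2) with (/ 2) by lra. apply Rinv_le_contravar; [lra|].
    change 2 with (INR 2). apply le_INR. lia. }
  assert (HkC : forall n, Cmod (RtoC (/ INR (n + 2))) <= Cmod (RtoC (1/2))).
  { intros n. specialize (Hk n). rewrite !Cmod_R, !Rabs_pos_eq; lra. }
  split.
  - set (B := Series (fun n => Cmod (bin (- z) (S (S n)) * RtoC (1/2) ^ n))).
    apply summable_le with (fun n => (Cmod z ^ 2 + (1 + Cmod z) * B) * / (INR (n + 2)) ^ 2).
    + intros n. cbv zeta. specialize (Hk n).
      rewrite Cmod_mult, Cmod_pow, Cmod_R, Rabs_pos_eq, pow_inv, Rmult_comm by lra.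
      apply Rmult_le_compat_r.
      { left; apply Rinv_0_lt_compat, pow_lt, lt_0_INR; lia. }
      eapply Rle_trans; [apply Cmod_triangle|].
      rewrite Cmod_opp, Cmod_pow, Cmod_mult. apply Rplus_le_compat_l.
      apply Rmult_le_compat; try apply Cmod_ge_0.
      * eapply Rle_trans; [apply Cmod_triangle|]. rewrite Cmod_1, Cmod_mult, Cmod_R, Rabs_pos_eq by lra.
        assert (H0 := Cmod_ge_0 z). nra.
      * apply Cmod_CSeries_le; [|exact Hhalf2]. intros j.
        rewrite !Cmod_mult, !Cmod_pow. apply Rmult_le_compat_l; [apply Cmod_ge_0|].
        apply pow_incr. split; [apply Cmod_ge_0|apply HkC].
    + apply (ex_series_scal (V := R_NormedModule)). apply ex_series_inv_sqr.
  - intros n. cbv zeta. set (k := INR (n + 2)).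
    assert (Hkp : 0 < k) by (apply lt_0_INR; lia).
    assert (Hk2 : / k <= 1/2) by apply Hk.
    assert (Hik : 0 < / k) by now apply Rinv_0_lt_compat.
    set (w := RtoC (/ k)).
    assert (Hw : Cmod w <= 1/2) by (unfold w; rewrite Cmod_R, Rabs_pos_eq; lra).
    assert (Aw : summable (fun n => bin (- z) n * w ^ n)%C) by (apply bin_summable; lra).
    assert (Hw0 : w <> 0) by (unfold w; intros E; apply RtoC_inj in E; lra).
    assert (HR : Cpower (RtoC (1 - / k)) z = (1 - z * w + w ^ 2 * R2 (n + 2)%nat)%C).
    { assert (Hb := binomial_series (- z) (- w)). rewrite Cmod_opp in Hb.
      specialize (Hb ltac:(lra)).
      replace (- - w)%C with w in Hb by ring. replace (- - z)%C with z in Hb by ring.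
      replace (1 + - w)%C with (RtoC (1 - / k)) in Hb
        by (unfold w; rewrite RtoC_minus; ring).
      rewrite <- Hb. unfold R2. fold k. fold w.
      rewrite Cps_shift by (try exact Aw; now apply summable_pow_shift).
      rewrite (Cps_shift (fun n => bin (- z) (S n))).
      - unfold bin at 1 2. simpl. field.
      - now apply summable_pow_shift.
      - apply (summable_pow_shift (fun n => bin (- z) (S n))); [exact Hw0|]. now apply summable_pow_shift. }
    replace (1 + w ^ 2 * (- z ^ 2 + (1 + z * w) * R2 (n + 2)%nat))%C
      with ((1 + z * w) * (1 - z * w + w ^ 2 * R2 (n + 2)%nat))%C by ring.
    rewrite <- HR. unfold rGamma_seq.
    rewrite (poch_S z (S (S n))), fact_S_C.
    assert (Hk1 : INR (S (S n)) = k) by (unfold k; f_equal; lia).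
    assert (Hn1 : INR (S n) = k * (1 - / k)).
    { rewrite Rmult_minus_distr_l, Rinv_r by lra. rewrite <- Hk1, (S_INR (S n)). ring. }
    rewrite Hk1, Hn1, Cpower_mult_pos by lra.
    unfold w. rewrite RtoC_inv by lra.
    assert (Hkc : RtoC k <> 0) by (intros E; apply RtoC_inj in E; lra).
    field. repeat split; try apply Cpower_neq_0; try apply fact_C_neq_0; assumption.
Qed.

Lemma Clim_eventually_shift (u : nat -> C) (l : C) :
  Clim eventually (fun n => u (S n)) l <-> Clim eventually u l.
Proof.
  split; intros H eps Heps; destruct (H eps Heps) as [N HN].
  - exists (S N). intros [|n] Hn; [lia|]. apply HN. lia.
  - exists N. intros n Hn. apply HN. lia.
Qed.

Lemma rGamma_lim (z : C) : Clim eventually (rGamma_seq z) (rGamma z).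
Proof.
  destruct (rGamma_seq_ratio z) as [e [He H]].
  destruct (product_converges (fun n => rGamma_seq z (S n)) e H He) as [l Hl].
  apply (Clim_eventually_shift (rGamma_seq z)) in Hl.
  assert (E : rGamma z = l).
  { apply C_eq.
    - assert (H1 := Clim_Re eventually _ _ Hl).
      change (is_lim_seq (fun n => Re (rGamma_seq z n)) (Re l)) in H1.
      change (real (Lim_seq (fun n => Re (rGamma_seq z n))) = Re l).
      now rewrite (is_lim_seq_unique _ _ H1).
    - assert (H1 := Clim_Im eventually _ _ Hl).
      change (is_lim_seq (fun n => Im (rGamma_seq z n)) (Im l)) in H1.
      change (real (Lim_seq (fun n => Im (rGamma_seq z n))) = Im l).
      now rewrite (is_lim_seq_unique _ _ H1). }
  rewrite E. exact Hl.
Qed.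

Lemma rGamma_seq_neq_0 (z : C) (n : nat) : not_nonpos_int z -> rGamma_seq z n <> 0.
Proof.
  intros Hz. unfold rGamma_seq. apply Cmult_neq_0; [now apply poch_neq_0|].
  intros E. assert (H : (RtoC (INR (fact n)) * Cpower (RtoC (INR n)) z)%C <> 0).
  { apply Cmult_neq_0; [apply fact_C_neq_0|apply Cpower_neq_0]. }
  assert (H2 : (RtoC (INR (fact n)) * Cpower (RtoC (INR n)) z
     * / (RtoC (INR (fact n)) * Cpower (RtoC (INR n)) z))%C = 1) by now field; split;
      [apply Cpower_neq_0|apply fact_C_neq_0].
  rewrite E, Cmult_0_r in H2. apply RtoC_inj in H2. lra.
Qed.

Lemma rGamma_neq_0 (z : C) : not_nonpos_int z -> rGamma z <> 0.
Proof.
  intros Hz. destruct (rGamma_seq_ratio z) as [e [He H]].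
  apply (product_limit_neq_0 (fun n => rGamma_seq z (S n)) e); try assumption.
  - intros k. now apply rGamma_seq_neq_0.
  - apply Clim_eventually_shift, rGamma_lim.
Qed.

Lemma Clim_inv_INR : Clim eventually (fun n => RtoC (/ INR n)) 0.
Proof.
  apply (Clim_RtoC eventually). change (is_lim_seq (fun n => / INR n) 0).
  apply (is_lim_seq_inv INR p_infty); [apply is_lim_seq_INR|discriminate].
Qed.

(** Gauss' quotients at z and z + 1 differ by the factor (z + n + 1) / n. *)
Lemma rGamma_succ (z : C) : rGamma z = (z * rGamma (z + 1))%C.
Proof.
  apply (Clim_unique eventually (fun n => z * rGamma_seq (z + 1) n)%C).
  - apply (Clim_ext_loc eventually
      (fun n => rGamma_seq z n * (1 + (z + 1) * RtoC (/ INR n)))%C).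
    + exists 1%nat. intros n Hn. unfold rGamma_seq.
      assert (HnR : 0 < INR n) by (apply lt_0_INR; lia).
      assert (HnC : RtoC (INR n) <> 0) by (intros E; apply RtoC_inj in E; lra).
      rewrite Cpower_plus, Cpower_1, RtoC_inv by (try exact HnC; lra).
      assert (Hp : (z * poch (z + 1) (S n))%C = (poch z (S n) * (z + RtoC (INR n) + 1))%C).
      { rewrite <- poch_S_l, poch_S, S_INR, RtoC_plus. ring. }
      replace (z * (poch (z + 1) (S n) / (RtoC (INR (fact n))
         * (Cpower (RtoC (INR n)) z * RtoC (INR n)))))%C
        with ((z * poch (z + 1) (S n)) / (RtoC (INR (fact n))
         * (Cpower (RtoC (INR n)) z * RtoC (INR n))))%C
        by (field; repeat split; try assumption; try apply Cpower_neq_0; apply fact_C_neq_0).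
      rewrite Hp. field. repeat split; try assumption; try apply Cpower_neq_0; apply fact_C_neq_0.
    + replace (rGamma z) with (rGamma z * (1 + (z + 1) * 0))%C by ring.
      clim; [apply rGamma_lim|apply Clim_inv_INR].
  - clim. apply rGamma_lim.
Qed.

Lemma rGamma_poch (z : C) (n : nat) :
  rGamma z = (poch z n * rGamma (z + RtoC (INR n)))%C.
Proof.
  induction n as [|n IH].
  - simpl. rewrite Cplus_0_r. ring.
  - rewrite IH, (rGamma_succ (z + RtoC (INR n))), poch_S, S_INR, RtoC_plus, Cplus_assoc. ring.
Qed.

Lemma poch_rGamma_seq (z : C) (n : nat) : (0 < n)%nat ->
  poch z (S n) = (rGamma_seq z n * (RtoC (INR (fact n)) * Cpower (RtoC (INR n)) z))%C.
Proof.
  intros Hn. unfold rGamma_seq. field.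
  split; [apply Cpower_neq_0|apply fact_C_neq_0].
Qed.

(** Quotients of rising factorials behave like powers of n, with Gamma
    quotients as constants; [s] is the excess of the exponents. *)
Lemma poch_quotient (a b g c s : C) (n : nat) : (0 < n)%nat ->
  not_nonpos_int g -> not_nonpos_int c -> (a + b = g + c + s)%C ->
  (poch a (S n) * poch b (S n) / (poch g (S n) * poch c (S n)))%C
  = (rGamma_seq a n * rGamma_seq b n / (rGamma_seq g n * rGamma_seq c n)
     * Cpower (RtoC (INR n)) s)%C.
Proof.
  intros Hn Hg Hc E. rewrite !poch_rGamma_seq by exact Hn.
  assert (Hp : (Cpower (RtoC (INR n)) a * Cpower (RtoC (INR n)) b)%C
    = (Cpower (RtoC (INR n)) g * Cpower (RtoC (INR n)) c * Cpower (RtoC (INR n)) s)%C).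
  { rewrite <- !Cpower_plus. now rewrite E. }
  set (A := Cpower (RtoC (INR n)) a) in *. set (B := Cpower (RtoC (INR n)) b) in *.
  assert (G0 : Cpower (RtoC (INR n)) g <> 0) by apply Cpower_neq_0.
  assert (C0 : Cpower (RtoC (INR n)) c <> 0) by apply Cpower_neq_0.
  set (G := Cpower (RtoC (INR n)) g) in *. set (D := Cpower (RtoC (INR n)) c) in *.
  set (S := Cpower (RtoC (INR n)) s) in *.
  assert (Hf := fact_C_neq_0 n). set (f := RtoC (INR (fact n))) in *.
  assert (Hg' := rGamma_seq_neq_0 g n Hg). assert (Hc' := rGamma_seq_neq_0 c n Hc).
  replace (rGamma_seq a n * (f * A) * (rGamma_seq b n * (f * B))
    / (rGamma_seq g n * (f * G) * (rGamma_seq c n * (f * D))))%C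
    with (rGamma_seq a n * rGamma_seq b n * (A * B) / (rGamma_seq g n * rGamma_seq c n * (G * D)))%C
    by (field; repeat split; assumption).
  rewrite Hp. field. repeat split; assumption.
Qed.

Lemma Clim_rGamma_quotient (a b g c : C) : not_nonpos_int g -> not_nonpos_int c ->
  Clim eventually (fun n => rGamma_seq a n * rGamma_seq b n / (rGamma_seq g n * rGamma_seq c n))%C
   (rGamma a * rGamma b / (rGamma g * rGamma c))%C.
Proof.
  intros Hg Hc. assert (H := rGamma_lim).
  apply Clim_mult; clim; try apply H. apply Clim_inv; clim; try apply H.
  apply Cmult_neq_0; now apply rGamma_neq_0.
Qed.

Lemma poch_quotient_lim (a b g c : C) :
  not_nonpos_int g -> not_nonpos_int c -> (a + b = g + c)%C ->
  Clim eventually (fun n => poch a n * poch b n / (poch g n * poch c n))%C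
   (rGamma a * rGamma b / (rGamma g * rGamma c))%C.
Proof.
  intros Hg Hc E. apply Clim_eventually_shift.
  apply (Clim_ext_loc eventually (fun n =>
    rGamma_seq a n * rGamma_seq b n / (rGamma_seq g n * rGamma_seq c n))%C).
  - exists 1%nat. intros n Hn.
    rewrite (poch_quotient a b g c 0) by (try assumption; try lia; rewrite E; ring).
    rewrite Cpower_0. ring.
  - now apply Clim_rGamma_quotient.
Qed.

Lemma poch_quotient_lim_0 (a b g c : C) :
  not_nonpos_int g -> not_nonpos_int c -> (a + b = g + c - 1)%C ->
  Clim eventually (fun n => poch a n * poch b n / (poch g n * poch c n))%C 0.
Proof.
  intros Hg Hc E. apply Clim_eventually_shift.
  apply (Clim_ext_loc eventually (fun n =>
    rGamma_seq a n * rGamma_seq b n / (rGamma_seq g n * rGamma_seq c n) * RtoC (/ INR n))%C).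
  - exists 1%nat. intros n Hn.
    assert (HnR : 0 < INR n) by (apply lt_0_INR; lia).
    rewrite (poch_quotient a b g c (- (1))) by (try assumption; try lia; rewrite E; ring).
    rewrite Cpower_opp, Cpower_1, RtoC_inv; [reflexivity|lra|].
    intros E0. apply RtoC_inj in E0. lra.
  - replace (RtoC 0) with (rGamma a * rGamma b / (rGamma g * rGamma c) * 0)%C by ring.
    apply Clim_mult; [clim|now apply Clim_rGamma_quotient|apply Clim_inv_INR].
Qed.

(** Both sides are of the order n! n^(Re c - 1), by Gauss' limit for c and for Re c. *)
Lemma Cmod_poch_le_Re (c : C) : 0 < Re c ->
  exists K, 0 <= K /\ eventually (fun n =>
    Cmod (poch c n) <= K * Cmod (poch (RtoC (Re c)) n)).
Proof.
  intros Hc. set (s := RtoC (Re c)).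
  assert (Hs : not_nonpos_int s) by now apply not_nonpos_int_pos.
  set (q := fun n => (rGamma_seq c n * / rGamma_seq s n)%C).
  assert (Hq : Clim eventually q (rGamma c * / rGamma s)%C).
  { unfold q. clim; [apply rGamma_lim|].
    apply Clim_inv; [clim|now apply rGamma_neq_0|apply rGamma_lim]. }
  set (l := (rGamma c * / rGamma s)%C) in *.
  exists (Cmod l + 1). assert (Hl0 := Cmod_ge_0 l).
  split; [lra|].
  destruct (Hq 1 ltac:(lra)) as [N HN]. exists (S (S N)).
  intros [|n] Hn; [lia|]. specialize (HN n ltac:(lia)).
  assert (T := Cmod_triangle_rev (q n) l).
  assert (HnR : 0 < INR n) by (apply lt_0_INR; lia).
  rewrite !poch_rGamma_seq by lia. rewrite !Cmod_mult.
  rewrite !Cpower_INR_base, !Cmod_Cexp by lia.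
  replace (Re (c * RtoC (ln (INR n)))%C) with (Re c * ln (INR n)) by (unfold Re; simpl; ring).
  replace (Re (s * RtoC (ln (INR n)))%C) with (Re c * ln (INR n)) by (unfold s, Re; simpl; ring).
  set (X := Cmod (RtoC (INR (fact n))) * exp (Re c * ln (INR n))).
  assert (HX : 0 <= X) by (apply Rmult_le_pos; [apply Cmod_ge_0|left; apply exp_pos]).
  rewrite <- Rmult_assoc. apply Rmult_le_compat_r; [exact HX|].
  assert (Hs0 := rGamma_seq_neq_0 s n Hs).
  replace (rGamma_seq c n) with (q n * rGamma_seq s n)%C by (unfold q; field; exact Hs0).
  rewrite Cmod_mult. apply Rmult_le_compat_r; [apply Cmod_ge_0|]. lra.
Qed.

(** * Gauss' hypergeometric series *)

Definition hcoef (a b c : C) (n : nat) : C :=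
  (poch a n * poch b n / (poch c n * RtoC (INR (fact n))))%C.

Definition hyp (a b c z : C) : C := Cps (hcoef a b c) z.

Definition dhyp (a b c z : C) : C := (a * b / c * hyp (a + 1) (b + 1) (c + 1) z)%C.

Definition ddhyp (a b c z : C) : C :=
  (a * b / c * dhyp (a + 1) (b + 1) (c + 1) z)%C.

Lemma hcoef_bound (a b c : C) (q : R) : not_nonpos_int c -> 1 < q ->
  exists M, 0 < M /\ forall n, Cmod (hcoef a b c n) <= M * q ^ n.
Proof.
  intros Hc Hq.
  assert (Hs : 1 < sqrt q) by (rewrite <- sqrt_1; apply sqrt_lt_1; lra).
  destruct (poch_ratio a c (sqrt q) Hc Hs) as [M1 [HM1 H1]].
  destruct (poch_fact_ratio b (sqrt q) Hs) as [M2 [HM2 H2]].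
  exists (M1 * M2). split; [now apply Rmult_lt_0_compat|]. intros n.
  replace (hcoef a b c n) with (poch a n / poch c n * (poch b n / RtoC (INR (fact n))))%C
    by (unfold hcoef; field; split; [apply fact_C_neq_0|now apply poch_neq_0]).
  rewrite Cmod_mult.
  apply Rle_trans with ((M1 * sqrt q ^ n) * (M2 * sqrt q ^ n)).
  - apply Rmult_le_compat; auto; apply Cmod_ge_0.
  - right. replace (M1 * sqrt q ^ n * (M2 * sqrt q ^ n))
      with (M1 * M2 * (sqrt q ^ n * sqrt q ^ n)) by ring.
    rewrite <- Rpow_mult_distr, sqrt_sqrt by lra. reflexivity.
Qed.

Lemma not_nonpos_int_1 (z : C) : not_nonpos_int z -> not_nonpos_int (z + 1)%C.
Proof. intros H. apply (not_nonpos_int_shift z 1 H). Qed.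

Lemma hyp_summable (a b c z : C) : not_nonpos_int c -> Cmod z < 1 ->
  summable (fun n => hcoef a b c n * z ^ n)%C.
Proof.
  intros Hc Hz.
  destruct (exists_ratio_gt (Cmod z)) as [q [Hq1 Hq2]]; [split; [apply Cmod_ge_0|exact Hz]|].
  destruct (hcoef_bound a b c q Hc Hq1) as [M [_ H]].
  apply summable_pow_geom with (2 := H); [lra|exact Hq2].
Qed.

Lemma hcoef_0 (a b c : C) : hcoef a b c 0 = 1.
Proof. unfold hcoef. simpl. field. Qed.

Lemma hyp_0 (a b c : C) : hyp a b c 0 = 1.
Proof. unfold hyp. rewrite Cps_at_0. apply hcoef_0. Qed.

Lemma hcoef_S (a b c : C) (n : nat) : not_nonpos_int c ->
  hcoef a b c (S n) = (hcoef a b c n * ((a + RtoC (INR n)) * (b + RtoC (INR n)))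
    / ((c + RtoC (INR n)) * RtoC (INR (S n))))%C.
Proof.
  intros Hc. unfold hcoef. rewrite !poch_S, fact_S_C. field.
  repeat split; try apply fact_C_neq_0; try apply INR_S_C_neq_0;
    first [now apply poch_neq_0|now apply not_nonpos_int_plus].
Qed.

Lemma hcoef_derive (a b c : C) (n : nat) : not_nonpos_int c ->
  (RtoC (INR (S n)) * hcoef a b c (S n))%C
  = (a * b / c * hcoef (a + 1) (b + 1) (c + 1) n)%C.
Proof.
  intros Hc. unfold hcoef. rewrite !poch_S_l, fact_S_C. field.
  repeat split; try apply fact_C_neq_0; try apply INR_S_C_neq_0.
  - now apply poch_neq_0, not_nonpos_int_1.
  - now apply not_nonpos_int_neq_0.
Qed.

Lemma Cderive_hyp (a b c : C) (t : R) : not_nonpos_int c -> Rabs t < 1 ->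
  is_Cderive (fun s => hyp a b c (RtoC s)) t (dhyp a b c (RtoC t)).
Proof.
  intros Hc Ht. assert (H0 := Rabs_pos t).
  set (r := (1 + Rabs t) / 2).
  assert (Hr : summable (fun n => hcoef a b c n * RtoC r ^ n)%C).
  { apply hyp_summable; [exact Hc|]. rewrite Cmod_R, Rabs_pos_eq; unfold r; lra. }
  assert (Htr : Rabs t < r) by (unfold r; lra).
  apply Cderive_eq with (2 := Cderive_Cps (hcoef a b c) r t Htr Hr).
  unfold dhyp, hyp, Cps. rewrite <- CSeries_scal.
  - apply CSeries_ext. intros n. rewrite hcoef_derive by exact Hc. ring.
  - apply hyp_summable; [now apply not_nonpos_int_1|]. now rewrite Cmod_R.
Qed.

Lemma Cderive_dhyp (a b c : C) (t : R) : not_nonpos_int c -> Rabs t < 1 ->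
  is_Cderive (fun s => dhyp a b c (RtoC s)) t (ddhyp a b c (RtoC t)).
Proof.
  intros Hc Ht. apply Cderive_scal. apply Cderive_hyp; [now apply not_nonpos_int_1|exact Ht].
Qed.

Definition sums (p : nat -> C) (z s : C) : Prop :=
  summable (fun n => p n * z ^ n)%C /\ Cps p z = s.

Lemma sums_plus (p q : nat -> C) (z s t : C) :
  sums p z s -> sums q z t -> sums (fun n => p n + q n)%C z (s + t)%C.
Proof.
  intros [A <-] [A' <-].
  assert (E : forall n, (p n * z ^ n + q n * z ^ n = (p n + q n) * z ^ n)%C)
    by (intros; ring).
  split.
  - apply summable_ext with (1 := E). exact (summable_plus _ _ A A').
  - unfold Cps. rewrite <- (CSeries_ext _ _ E). exact (CSeries_plus _ _ A A').
Qed.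

Lemma sums_scal (k : C) (p : nat -> C) (z s : C) :
  sums p z s -> sums (fun n => k * p n)%C z (k * s)%C.
Proof.
  intros [A <-].
  assert (E : forall n, (k * (p n * z ^ n) = k * p n * z ^ n)%C) by (intros; ring).
  split.
  - apply summable_ext with (1 := E). exact (summable_scal k _ A).
  - unfold Cps. rewrite <- (CSeries_ext _ _ E). exact (CSeries_scal k _ A).
Qed.

Lemma sums_unique (p q : nat -> C) (z s t : C) :
  sums p z s -> sums q z t -> (forall n, p n = q n) -> s = t.
Proof.
  intros [_ <-] [_ <-] E. apply CSeries_ext. intros n. now rewrite E.
Qed.

Lemma sums_mult_z (p q : nat -> C) (z t : C) :
  sums q z t -> p 0%nat = 0 -> (forall n, p (S n) = q n) -> sums p z (z * t)%C.
Proof.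
  intros [A <-] H0 H.
  assert (E : forall n, (z * (q n * z ^ n) = p (S n) * z ^ S n)%C)
    by (intros; rewrite H, Cpow_S; ring).
  assert (A' : summable (fun n => p n * z ^ n)%C).
  { apply summable_incr_1, (summable_ext _ _ E). exact (summable_scal z _ A). }
  split; [exact A'|]. unfold Cps. rewrite (CSeries_incr_1 _ A'), H0.
  rewrite <- (CSeries_ext _ _ E), (CSeries_scal z _ A). ring.
Qed.

Lemma hyp_sums (a b c z : C) : not_nonpos_int c -> Cmod z < 1 ->
  sums (hcoef a b c) z (hyp a b c z).
Proof. intros Hc Hz. split; [now apply hyp_summable|reflexivity]. Qed.

(** The Euler operator z d/dz multiplies the n-th coefficient by n. *)
Lemma hyp_theta (a b c z : C) : not_nonpos_int c -> Cmod z < 1 ->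
  sums (fun n => RtoC (INR n) * hcoef a b c n)%C z (z * dhyp a b c z)%C.
Proof.
  intros Hc Hz. eapply sums_mult_z.
  - apply sums_scal, hyp_sums; [now apply not_nonpos_int_1|exact Hz].
  - simpl. ring.
  - intros n. now apply hcoef_derive.
Qed.

Lemma hyp_theta2 (a b c z : C) : not_nonpos_int c -> Cmod z < 1 ->
  sums (fun n => RtoC (INR n) * (RtoC (INR n) - 1) * hcoef a b c n)%C z
    (z * (a * b / c * (z * dhyp (a + 1) (b + 1) (c + 1) z)))%C.
Proof.
  intros Hc Hz. eapply sums_mult_z.
  - apply sums_scal, hyp_theta; [now apply not_nonpos_int_1|exact Hz].
  - simpl. ring.
  - intros n. cbv beta.
    transitivity ((RtoC (INR (S n)) * hcoef a b c (S n)) * (RtoC (INR (S n)) - 1))%C; [ring|].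
    rewrite hcoef_derive, S_INR, RtoC_plus by exact Hc. ring.
Qed.

(** Gauss' equation: after multiplication by z both sides are power series, and
    matching coefficients is the recurrence of [hcoef]. *)
Lemma hyp_ode (a b c z : C) : not_nonpos_int c -> Cmod z < 1 -> z <> 0 ->
  (z * (1 - z) * ddhyp a b c z + (c - (a + b + 1) * z) * dhyp a b c z
   - a * b * hyp a b c z)%C = 0.
Proof.
  intros Hc Hz Hz0.
  assert (S0 := hyp_sums a b c z Hc Hz). assert (S1 := hyp_theta a b c z Hc Hz).
  assert (S2 := hyp_theta2 a b c z Hc Hz).
  assert (HS := sums_unique _ _ _ _ _ (sums_plus _ _ _ _ _ S2 (sums_scal c _ _ _ S1))
    (sums_mult_z (fun n => RtoC (INR n) * (RtoC (INR n) - 1) * hcoef a b c n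
               + c * (RtoC (INR n) * hcoef a b c n))%C _ _ _
      (sums_plus _ _ _ _ _ S2 (sums_plus _ _ _ _ _
        (sums_scal (a + b + 1) _ _ _ S1) (sums_scal (a * b) _ _ _ S0)))
      ltac:(simpl; ring)
      ltac:(intros n; cbv beta; rewrite hcoef_S, S_INR, RtoC_plus by exact Hc;
            assert (N1 := not_nonpos_int_plus c n Hc); assert (N2 := INR_S_C_neq_0 n);
            rewrite S_INR, RtoC_plus in N2; field; now split))
    (fun n => eq_refl)).
  fold (ddhyp a b c z) in HS. unfold ddhyp.
  set (h0 := hyp a b c z) in *. set (h1 := dhyp a b c z) in *.
  set (h2 := dhyp (a + 1) (b + 1) (c + 1) z) in *.
  transitivity (/ z * (z * (a * b / c * (z * h2)) + c * (z * h1)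
    - z * (z * (a * b / c * (z * h2)) + ((a + b + 1) * (z * h1) + a * b * h0))))%C.
  - assert (N := not_nonpos_int_neq_0 c Hc). field. now split.
  - rewrite HS. ring.
Qed.

(** Raising c by one is undone by z d/dz + c. *)
Lemma hyp_lower_c (a b c z : C) : not_nonpos_int c -> Cmod z < 1 ->
  (z * dhyp a b (c + 1) z + c * hyp a b (c + 1) z)%C = (c * hyp a b c z)%C.
Proof.
  intros Hc Hz. assert (Hc1 := not_nonpos_int_1 c Hc).
  refine (sums_unique _ _ z _ _ (sums_plus _ _ _ _ _ (hyp_theta a b (c + 1) z Hc1 Hz)
    (sums_scal c _ _ _ (hyp_sums a b (c + 1) z Hc1 Hz)))
    (sums_scal c _ _ _ (hyp_sums a b c z Hc Hz)) _).
  intros n. cbv beta. unfold hcoef.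
  assert (E : poch (c + 1) n = (poch c n * (c + RtoC (INR n)) / c)%C).
  { rewrite <- poch_S, poch_S_l. field. now apply not_nonpos_int_neq_0. }
  rewrite E. field.
  repeat split; try apply fact_C_neq_0;
    first [now apply poch_neq_0|now apply not_nonpos_int_neq_0|now apply not_nonpos_int_plus].
Qed.

(** A contiguous relation: with z d/dz 2F1(a, b+1; c; z) added, both sides are
    z times (z d/dz + a) 2F1(a, b+1; c; z). *)
Lemma hyp_lower_b (a b c z : C) : not_nonpos_int c -> Cmod z < 1 ->
  ((b + 1 - c) * (hyp a b c z - hyp a (b + 1) c z))%C
  = (a * z * hyp a (b + 1) c z - (1 - z) * (z * dhyp a (b + 1) c z))%C.
Proof.
  intros Hc Hz.
  assert (S0 := hyp_sums a b c z Hc Hz). assert (S1 := hyp_sums a (b + 1) c z Hc Hz).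
  assert (S2 := hyp_theta a (b + 1) c z Hc Hz).
  set (h := hcoef a (b + 1) c) in *. set (k := (b + 1 - c)%C).
  assert (HS := sums_unique _ _ _ _ _ (sums_plus _ _ _ _ _ (sums_scal k _ _ _ S0)
      (sums_plus _ _ _ _ _ (sums_scal (- k) _ _ _ S1) S2))
    (sums_mult_z (fun n => k * hcoef a b c n + (- k * h n + RtoC (INR n) * h n))%C _ _ _
      (sums_plus _ _ _ _ _ (sums_scal a _ _ _ S1) S2)
      ltac:(unfold h; cbv beta; rewrite !hcoef_0; simpl; ring)
      ltac:(intros n; unfold k, h, hcoef; rewrite (poch_S_l b), !poch_S, fact_S_C, S_INR, RtoC_plus;
            assert (N4 := INR_S_C_neq_0 n); rewrite S_INR, RtoC_plus in N4; field;
            repeat split; try exact N4; try apply fact_C_neq_0;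
            first [now apply poch_neq_0|now apply not_nonpos_int_plus]))
    (fun n => eq_refl)).
  transitivity (k * hyp a b c z + (- k * hyp a (b + 1) c z + z * dhyp a (b + 1) c z)
    - z * dhyp a (b + 1) c z)%C; [ring|].
  rewrite HS. ring.
Qed.

(** Abel's theorem with the binomial series of (1 - v)^(-c) as comparison: the
    moduli of its terms sum to at most a constant times (1 - v)^(-Re c), so that
    a relatively small perturbation of the coefficients stays negligible. *)
Lemma abel_comparison (e : nat -> C) (c L : C) : 0 < Re c ->
  (forall v, 0 <= v < 1 -> summable (fun n => e n * RtoC v ^ n)%C) ->
  Clim eventually (fun n => e n / bin c n)%C L ->
  Clim (at_left 1) (fun v => Cpower (RtoC (1 - v)) c * Cps e (RtoC v))%C L.
Proof.
  intros Hc HA HL.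
  assert (Hcn : not_nonpos_int c).
  { intros n E. rewrite E in Hc. simpl in Hc. generalize (pos_INR n). lra. }
  assert (Hb0 := fun n => bin_neq_0 c n Hcn).
  destruct (Cmod_poch_le_Re c Hc) as [K [HK [N1 HN1]]].
  set (d := fun n => Cmod (bin (RtoC (Re c)) n)).
  assert (HdK : forall n, (N1 <= n)%nat -> Cmod (bin c n) <= K * d n).
  { intros n Hn. unfold d, bin. rewrite !Cmod_div by apply fact_C_neq_0.
    unfold Rdiv. rewrite <- Rmult_assoc. apply Rmult_le_compat_r; [|now apply HN1].
    left. apply Rinv_0_lt_compat, Cmod_gt_0, fact_C_neq_0. }
  assert (Hsum : forall s, 0 <= s < 1 ->
     is_series (fun j => d j * s ^ j) (Rpower (1 - s) (- Re c)))
    by (intros s Hs; apply bin_real_sum; lra).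
  intros eps Heps.
  set (eps1 := eps / (2 * (K + 1))).
  assert (He1 : 0 < eps1) by (apply Rdiv_lt_0_compat; lra).
  destruct (HL eps1 He1) as [N2 HN2].
  set (N := max N1 N2).
  set (g := fun n => (e n - L * bin c n)%C).
  assert (Hg : forall n, (N <= n)%nat -> Cmod (g n) <= eps1 * K * d n).
  { intros n Hn. unfold g.
    replace (e n - L * bin c n)%C with ((e n / bin c n - L) * bin c n)%C by (field; apply Hb0).
    rewrite Cmod_mult, Rmult_assoc. apply Rmult_le_compat; try apply Cmod_ge_0.
    - left. apply HN2. unfold N in Hn. lia.
    - apply HdK. unfold N in Hn. lia. }
  set (beta := fun n => if le_lt_dec n N then Cmod (g n) else 0).
  set (B := sum_n beta N).
  assert (Hbeta : forall n, 0 <= beta n).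
  { intros n. unfold beta. destruct (le_lt_dec n N); [apply Cmod_ge_0|lra]. }
  assert (Hd0 : forall n, 0 <= d n) by (intros; apply Cmod_ge_0).
  assert (Hgb : forall n, Cmod (g n) <= beta n + eps1 * K * d n).
  { intros n. assert (H0 : 0 <= eps1 * K * d n).
    { apply Rmult_le_pos; [|apply Hd0]. apply Rmult_le_pos; lra. }
    unfold beta. destruct (le_lt_dec n N) as [Hn|Hn]; [lra|].
    rewrite Rplus_0_l. apply Hg. lia. }
  assert (Hbs : is_series beta B).
  { apply filterlim_ext_loc with (fun _ : nat => B); [|apply filterlim_const].
    exists N. intros n Hn. induction Hn as [|n Hn IH]; [reflexivity|].
    rewrite sum_Sn, <- IH. unfold beta at 1. destruct (le_lt_dec (S n) N); [lia|].
    symmetry. apply Rplus_0_r. }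
  (* for v close to 1 the finitely many first terms are negligible *)
  assert (HB0 : 0 <= B) by (now apply sum_n_nonneg).
  set (eta := Rmin 1 (exp (ln (eps / (2 * (B + 1))) / Re c))).
  assert (Heta : 0 < eta) by (apply Rmin_glb_lt; [lra|apply exp_pos]).
  exists (mkposreal _ Heta). intros v Hv Hv1.
  unfold ball in Hv; simpl in Hv; unfold AbsRing_ball, minus, plus, opp, abs in Hv; simpl in Hv.
  apply Rabs_def2 in Hv.
  assert (Heta1 : eta <= 1) by apply Rmin_l.
  assert (Hv0 : 0 <= v < 1) by lra.
  assert (Hpow : Rpower (1 - v) (Re c) * B < eps / 2).
  { assert (Hlt : 1 - v < exp (ln (eps / (2 * (B + 1))) / Re c)).
    { apply Rlt_le_trans with eta; [lra|apply Rmin_r]. }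
    assert (Hp : Rpower (1 - v) (Re c) < eps / (2 * (B + 1))).
    { unfold Rpower. rewrite <- (exp_ln (eps / (2 * (B + 1)))) by (apply Rdiv_lt_0_compat; lra).
      apply exp_increasing.
      replace (ln (eps / (2 * (B + 1)))) with (Re c * (ln (eps / (2 * (B + 1))) / Re c))
        by (field; lra).
      apply Rmult_lt_compat_l; [exact Hc|].
      rewrite <- (ln_exp (ln (eps / (2 * (B + 1))) / Re c)). apply ln_increasing; lra. }
    assert (Hp0 : 0 < Rpower (1 - v) (Re c)) by apply exp_pos.
    apply Rle_lt_trans with (Rpower (1 - v) (Re c) * (B + 1)); [nra|].
    apply Rlt_le_trans with (eps / (2 * (B + 1)) * (B + 1)).
    - apply Rmult_lt_compat_r; lra.
    - right; field; lra. }
  assert (Hvc : Cmod (RtoC v) < 1) by (rewrite Cmod_R, Rabs_pos_eq; lra).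
  assert (Ab := bin_summable c (RtoC v) Hvc). assert (Ae := HA v Hv0).
  assert (Hone : (Cpower (RtoC (1 - v)) c * Cps (bin c) (RtoC v))%C = 1).
  { replace (RtoC v) with (- RtoC (- v))%C by (rewrite RtoC_opp; ring).
    rewrite binomial_series by (rewrite RtoC_opp, Cmod_opp; exact Hvc).
    rewrite <- RtoC_plus. replace (1 + - v) with (1 - v) by ring.
    rewrite Cpower_opp. field. apply Cpower_neq_0. }
  assert (Hgs : (Cpower (RtoC (1 - v)) c * Cps e (RtoC v) - L
       = Cpower (RtoC (1 - v)) c * CSeries (fun n => g n * RtoC v ^ n))%C).
  { assert (E : CSeries (fun n => g n * RtoC v ^ n)%C
       = (Cps e (RtoC v) + - L * Cps (bin c) (RtoC v))%C).
    { unfold Cps. rewrite <- CSeries_scal by exact Ab.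
      rewrite <- CSeries_plus by (try apply summable_scal; assumption).
      apply CSeries_ext. intros n. unfold g. ring. }
    rewrite E.
    transitivity (Cpower (RtoC (1 - v)) c * Cps e (RtoC v)
       - L * (Cpower (RtoC (1 - v)) c * Cps (bin c) (RtoC v)))%C; [|ring].
    rewrite Hone. ring. }
  rewrite Hgs, Cmod_mult.
  assert (HP : Cmod (Cpower (RtoC (1 - v)) c) = Rpower (1 - v) (Re c)).
  { unfold Cpower. rewrite CLog_pos, Cmod_Cexp by lra. unfold Rpower. f_equal.
    unfold Re; simpl; ring. }
  rewrite HP.
  assert (Hmaj : Cmod (CSeries (fun n => g n * RtoC v ^ n)%C)
       <= B + eps1 * K * Rpower (1 - v) (- Re c)).
  { assert (Hs2 := is_series_plus _ _ _ _ Hbs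
       (is_series_scal (V := R_NormedModule) (eps1 * K) _ _ (Hsum v Hv0))).
    eapply Rle_trans.
    - apply Cmod_CSeries_le; [|eexists; exact Hs2]. intros n.
      rewrite Cmod_mult, Cmod_pow, Cmod_R, Rabs_pos_eq by lra.
      assert (V0 : 0 <= v ^ n) by (apply pow_le; lra).
      assert (V1 : v ^ n <= 1) by (rewrite <- (pow1 n); apply pow_incr; lra).
      apply Rle_trans with ((beta n + eps1 * K * d n) * v ^ n).
      + apply Rmult_le_compat_r; [exact V0|apply Hgb].
      + unfold plus, scal; simpl; unfold mult; simpl.
        assert (H0 := Hbeta n). assert (beta n * v ^ n <= beta n) by nra. lra.
    - right. rewrite (is_series_unique _ _ Hs2). reflexivity. }
  assert (Hp0 : 0 < Rpower (1 - v) (Re c)) by apply exp_pos.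
  apply Rle_lt_trans with (Rpower (1 - v) (Re c) * (B + eps1 * K * Rpower (1 - v) (- Re c))).
  { apply Rmult_le_compat_l; lra. }
  replace (Rpower (1 - v) (Re c) * (B + eps1 * K * Rpower (1 - v) (- Re c)))
    with (Rpower (1 - v) (Re c) * B
      + eps1 * K * (Rpower (1 - v) (Re c) * Rpower (1 - v) (- Re c))) by ring.
  rewrite <- Rpower_plus. replace (Re c + - Re c) with 0 by ring.
  rewrite Rpower_O by lra.
  assert (eps1 * K <= eps / 2).
  { unfold eps1. apply Rmult_le_reg_r with (2 * (K + 1)); [lra|].
    replace (eps / (2 * (K + 1)) * K * (2 * (K + 1))) with (eps * K) by (field; lra). nra. }
  lra.
Qed.

(** * The connection formula *)

Lemma RtoC_neq_0 (t : R) : t <> 0 -> RtoC t <> 0.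
Proof. intros Ht E. apply RtoC_inj in E. contradiction. Qed.

(** Gauss' equation in the variable t = -X, as a first-order system. *)
Definition solves (a b c : C) (f f1 : R -> C) (t : R) : Prop :=
  is_Cderive f t (f1 t) /\ exists f2, is_Cderive f1 t f2 /\
    (RtoC (t * (1 + t)) * f2 + (c + (a + b + 1) * RtoC t) * f1 t + a * b * f t)%C = 0.

Lemma Clim_eq {T} (F : (T -> Prop) -> Prop) (f : T -> C) (l m : C) :
  l = m -> Clim F f l -> Clim F f m.
Proof. now intros ->. Qed.

(** The integrating factor in Abel's identity for Gauss' equation. *)
Definition weight (a b c : C) (t : R) : C :=
  (Cpower (RtoC t) c * Cpower (RtoC (1 + t)) (a + b + 1 - c))%C.

Definition wronskian (f f1 g g1 : R -> C) (t : R) : C := (f t * g1 t - f1 t * g t)%C.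

Lemma Cderive_Cpower_real (l : R -> R) (s : C) (t d : R) : 0 < l t -> is_derive l t d ->
  is_Cderive (fun x => Cpower (RtoC (l x)) s) t (s * RtoC (d / l t) * Cpower (RtoC (l t)) s)%C.
Proof.
  intros Hl Hd.
  apply (Cderive_ext (fun x => Cexp (s * RtoC (ln (l x))))%C).
  { assert (Hc : continuous l t) by (apply (ex_derive_continuous (V := R_NormedModule)); now exists d).
    assert (Hloc : locally t (fun x => 0 < l x)).
    { apply (Hc (fun y => 0 < y)). apply (open_gt 0). exact Hl. }
    revert Hloc. apply filter_imp. intros x Hx. unfold Cpower. now rewrite CLog_pos. }
  unfold Cpower. rewrite CLog_pos by exact Hl.
  apply (Cderive_Cexp (fun x => s * RtoC (ln (l x)))%C).
  apply Cderive_scal, Cderive_RtoC.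
  apply (is_derive_comp ln l t (/ l t) d); [|exact Hd]. now apply is_derive_ln.
Qed.

Lemma Cderive_weight (a b c : C) (t : R) : 0 < t ->
  is_Cderive (weight a b c) t
    ((c * RtoC (/ t) + (a + b + 1 - c) * RtoC (/ (1 + t))) * weight a b c t)%C.
Proof.
  intros Ht.
  assert (H1 : is_Cderive (fun x => Cpower (RtoC x) c) t (c * RtoC (1 / t) * Cpower (RtoC t) c)%C).
  { apply (Cderive_Cpower_real (fun x => x)); [exact Ht|apply (is_derive_id (K := R_AbsRing))]. }
  assert (H2 : is_Cderive (fun x => Cpower (RtoC (1 + x)) (a + b + 1 - c)) t
    ((a + b + 1 - c) * RtoC (1 / (1 + t)) * Cpower (RtoC (1 + t)) (a + b + 1 - c))%C).
  { apply (Cderive_Cpower_real (fun x => 1 + x)); [lra|]. auto_derive; [exact I|ring]. }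
  apply Cderive_eq with (2 := Cderive_mult _ _ _ _ _ H1 H2). unfold weight.
  replace (1 / t) with (/ t) by (unfold Rdiv; ring).
  replace (1 / (1 + t)) with (/ (1 + t)) by (unfold Rdiv; ring). ring.
Qed.

Lemma wronskian_constant (a b c : C) (f f1 g g1 : R -> C) (t1 t2 : R) :
  0 < t1 <= t2 ->
  (forall t, t1 <= t <= t2 -> solves a b c f f1 t) ->
  (forall t, t1 <= t <= t2 -> solves a b c g g1 t) ->
  (weight a b c t1 * wronskian f f1 g g1 t1)%C
  = (weight a b c t2 * wronskian f f1 g g1 t2)%C.
Proof.
  intros H12 Hf Hg.
  apply (Cderive_zero_const (fun t => weight a b c t * wronskian f f1 g g1 t)%C); [lra|].
  intros t Ht. destruct (Hf t Ht) as [Hf1 [f2 [Hf2 Ef]]].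
  destruct (Hg t Ht) as [Hg1 [g2 [Hg2 Eg]]].
  assert (Ht0 : 0 < t) by lra.
  apply Cderive_eq with (2 := Cderive_mult _ _ _ _ _ (Cderive_weight a b c t Ht0)
    (Cderive_minus _ _ _ _ _ (Cderive_mult _ _ _ _ _ Hf1 Hg2) (Cderive_mult _ _ _ _ _ Hf2 Hg1))).
  unfold wronskian. set (w := weight a b c t).
  assert (N1 : RtoC t <> 0) by (apply RtoC_neq_0; lra).
  assert (N2 : RtoC (1 + t) <> 0) by (apply RtoC_neq_0; lra).
  rewrite !RtoC_inv by lra.
  rewrite RtoC_mult in Ef, Eg. rewrite RtoC_plus in *.
  set (T := RtoC t) in *. set (F := f t) in *. set (F1 := f1 t) in *.
  set (G := g t) in *. set (G1 := g1 t) in *.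
  transitivity (w / (T * (1 + T)) *
     (F * (T * (1 + T) * g2 + (c + (a + b + 1) * T) * G1 + a * b * G)
      - G * (T * (1 + T) * f2 + (c + (a + b + 1) * T) * F1 + a * b * F)))%C.
  - field. now split.
  - rewrite Ef, Eg. ring.
Qed.

(** The Frobenius solution at infinity with exponent a, summed in the variable
    v = 1/(1+t) = 1/(1-X), which maps all of t > 0 into the unit disc. *)
Definition frob (a b c : C) (t : R) : C :=
  (Cpower (RtoC (1 + t)) (- a) * hyp a (c - b) (a - b + 1) (RtoC (/ (1 + t))))%C.

Definition dfrob (a b c : C) (t : R) : C :=
  (- Cpower (RtoC (1 + t)) (- a) * (RtoC (/ (1 + t)) *
     (a * hyp a (c - b) (a - b + 1) (RtoC (/ (1 + t)))
      + RtoC (/ (1 + t)) * dhyp a (c - b) (a - b + 1) (RtoC (/ (1 + t))))))%C.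

Lemma inv_1_plus (t : R) : 0 < t -> 0 < / (1 + t) < 1.
Proof.
  intros Ht. split; [apply Rinv_0_lt_compat; lra|].
  rewrite <- Rinv_1. apply Rinv_lt_contravar; lra.
Qed.

Lemma Cmod_inv_1_plus (t : R) : 0 < t -> Cmod (RtoC (/ (1 + t))) < 1.
Proof.
  intros Ht. assert (H := inv_1_plus t Ht). rewrite Cmod_R, Rabs_pos_eq; lra.
Qed.

Lemma frob_solves (a b c : C) (t : R) : not_nonpos_int (a - b + 1)%C -> 0 < t ->
  solves a b c (frob a b c) (dfrob a b c) t.
Proof.
  intros Hg Ht. set (v := / (1 + t)). assert (Hv := inv_1_plus t Ht). fold v in Hv.
  set (B := (c - b)%C). set (G := (a - b + 1)%C) in *.
  assert (HE : is_Cderive (fun x => Cpower (RtoC (1 + x)) (- a)) t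
     (- a * RtoC v * Cpower (RtoC (1 + t)) (- a))%C).
  { apply Cderive_eq with (- a * RtoC (1 / (1 + t)) * Cpower (RtoC (1 + t)) (- a))%C.
    - unfold v. do 3 f_equal. unfold Rdiv. ring.
    - apply (Cderive_Cpower_real (fun x => 1 + x)); [lra|]. auto_derive; [exact I|ring]. }
  assert (Hdv : is_derive (fun x => / (1 + x)) t (- (v * v))).
  { auto_derive; [lra|]. unfold v. field. lra. }
  assert (Hvabs : Rabs v < 1) by (rewrite Rabs_pos_eq; lra).
  assert (HV : is_Cderive (fun x => RtoC (/ (1 + x))) t (RtoC (- (v * v)))) by now apply Cderive_RtoC.
  assert (HH : is_Cderive (fun x => hyp a B G (RtoC (/ (1 + x)))) t
     (RtoC (- (v * v)) * dhyp a B G (RtoC v))%C).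
  { apply (Cderive_comp (fun s => hyp a B G (RtoC s)) (fun x => / (1 + x))); [|exact Hdv].
    now apply Cderive_hyp. }
  assert (HD : is_Cderive (fun x => dhyp a B G (RtoC (/ (1 + x)))) t
     (RtoC (- (v * v)) * ddhyp a B G (RtoC v))%C).
  { apply (Cderive_comp (fun s => dhyp a B G (RtoC s)) (fun x => / (1 + x))); [|exact Hdv].
    now apply Cderive_dhyp. }
  set (E := Cpower (RtoC (1 + t)) (- a)) in *.
  set (H := hyp a B G (RtoC v)) in *. set (D := dhyp a B G (RtoC v)) in *.
  assert (Nv : RtoC v <> 0) by (apply RtoC_neq_0; lra).
  assert (Hode : (RtoC v * (1 - RtoC v) * ddhyp a B G (RtoC v)
     + (G - (a + B + 1) * RtoC v) * D - a * B * H)%C = 0).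
  { apply hyp_ode; [exact Hg| |exact Nv]. now rewrite Cmod_R. }
  set (DD := ddhyp a B G (RtoC v)) in *.
  split.
  - apply Cderive_eq with (2 := Cderive_mult _ _ _ _ _ HE HH).
    unfold dfrob. fold v B G E H D. rewrite RtoC_opp, RtoC_mult. ring.
  - eexists. split.
    + apply (Cderive_mult (fun x => - Cpower (RtoC (1 + x)) (- a))%C).
      * apply Cderive_opp, HE.
      * apply (Cderive_mult (fun x => RtoC (/ (1 + x)))); [exact HV|].
        apply (Cderive_plus (fun x => a * hyp a B G (RtoC (/ (1 + x))))%C).
        -- apply Cderive_scal, HH.
        -- apply (Cderive_mult (fun x => RtoC (/ (1 + x)))); [exact HV|exact HD].
    + cbv beta. unfold frob, dfrob. fold v B G E H D DD.
      assert (E1 : RtoC (t * (1 + t)) = ((1 - RtoC v) / (RtoC v * RtoC v))%C).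
      { rewrite <- RtoC_mult, <- RtoC_minus, <- RtoC_div by nra. f_equal.
        unfold v. field. lra. }
      assert (E2 : RtoC t = ((1 - RtoC v) / RtoC v)%C).
      { rewrite <- RtoC_minus, <- RtoC_div by lra. f_equal. unfold v. field. lra. }
      rewrite E1, E2, !RtoC_opp, !RtoC_mult. set (V := RtoC v) in *.
      transitivity (E * V * (V * (1 - V) * DD + (G - (a + B + 1) * V) * D - a * B * H))%C.
      * unfold G, B. field. exact Nv.
      * rewrite Hode. ring.
Qed.

Lemma hyp_solves (a b c : C) (t : R) : not_nonpos_int c -> 0 < t < 1 ->
  solves a b c (fun t => hyp a b c (RtoC (- t))) (fun t => - dhyp a b c (RtoC (- t)))%C t.
Proof.
  intros Hc Ht.
  assert (Habs : Rabs (- t) < 1) by (rewrite Rabs_Ropp, Rabs_pos_eq; lra).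
  assert (Hd : is_derive (fun x => - x) t (-1)) by (auto_derive; [exact I|ring]).
  assert (HH := Cderive_comp (fun s => hyp a b c (RtoC s)) (fun x => - x) t (-1) _
     (Cderive_hyp a b c (- t) Hc Habs) Hd).
  assert (HD := Cderive_comp (fun s => dhyp a b c (RtoC s)) (fun x => - x) t (-1) _
     (Cderive_dhyp a b c (- t) Hc Habs) Hd).
  split.
  - apply Cderive_eq with (2 := HH). rewrite RtoC_opp. ring.
  - eexists. split; [apply Cderive_opp, HD|].
    assert (Hode := hyp_ode a b c (RtoC (- t)) Hc).
    rewrite Cmod_R in Hode.
    specialize (Hode Habs (RtoC_neq_0 (- t) ltac:(lra))).
    cbv beta. set (H := hyp a b c (RtoC (- t))) in *.
    set (D := dhyp a b c (RtoC (- t))) in *. set (DD := ddhyp a b c (RtoC (- t))) in *.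
    rewrite RtoC_opp in *. rewrite RtoC_mult, RtoC_plus.
    set (T := RtoC t) in *.
    transitivity (- (- T * (1 - - T) * DD + (c - (a + b + 1) * - T) * D - a * b * H))%C; [ring|].
    rewrite Hode. ring.
Qed.

(** For Re c > 0, up to sign, the weighted Wronskian of 2F1(a, b; c; -t) and [frob a b c]. *)
Definition kappa (a b c : C) : C :=
  (rGamma a * rGamma (c - b) / (rGamma (a - b + 1) * rGamma c))%C.

Lemma filterlim_v_at_0 : filterlim (fun t => / (1 + t)) (at_right 0) (at_left 1).
Proof.
  intros P [eps HP]. unfold filtermap.
  exists eps. intros t Ht Ht0. apply HP.
  - unfold ball in *; simpl in *; unfold AbsRing_ball, minus, plus, opp, abs in *; simpl in *.
    assert (Hv := inv_1_plus t Ht0).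
    assert (E : / (1 + t) + - (1) = - (t * / (1 + t))) by (field; lra).
    rewrite E, Rabs_Ropp, Rabs_pos_eq by nra.
    apply Rabs_def2 in Ht. nra.
  - now apply inv_1_plus.
Qed.

Lemma Clim_real_cont (f : R -> C) (x : R) (l : C) :
  is_Cderive f x l -> Clim (at_right x) f (f x).
Proof.
  intros H eps Heps. assert (H1 := Cderive_Clim f x l H eps Heps).
  revert H1. apply filter_le_within.
Qed.

Lemma one_minus_v (t : R) : 0 < t -> 1 - / (1 + t) = t * / (1 + t).
Proof. intros; field; lra. Qed.

Lemma weight_split (a b c : C) (t : R) : 0 < t ->
  weight a b c t = (Cpower (RtoC (1 - / (1 + t))) c * Cpower (RtoC (1 + t)) (a + b + 1))%C.
Proof.
  intros Ht. assert (Hv := inv_1_plus t Ht). rewrite one_minus_v by exact Ht.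
  rewrite Cpower_mult_pos by lra. unfold weight, Cminus.
  rewrite (Cpower_plus _ (a + b + 1) (- c)).
  assert (E : Cpower (RtoC (/ (1 + t))) c = Cpower (RtoC (1 + t)) (- c)).
  { unfold Cpower. rewrite !CLog_pos, ln_Rinv, RtoC_opp by lra. f_equal. ring. }
  rewrite E. ring.
Qed.

Section Constants.
Variables a b c : C.
Hypothesis Hg : not_nonpos_int (a - b + 1)%C.
Hypothesis Hc : not_nonpos_int c.

Lemma at0_factor (s : C) : Clim (at_right 0) (fun t => Cpower (RtoC (1 + t)) s) 1.
Proof.
  assert (H : is_Cderive (fun x => Cpower (RtoC (1 + x)) s) 0
     (s * RtoC (1 / (1 + 0)) * Cpower (RtoC (1 + 0)) s)%C).
  { apply (Cderive_Cpower_real (fun x => 1 + x)); [lra|]. auto_derive; [exact I|ring]. }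
  assert (H1 := Clim_real_cont _ _ _ H). cbv beta in H1.
  replace (Cpower (RtoC (1 + 0)) s) with (RtoC 1) in H1; [exact H1|].
  unfold Cpower. rewrite CLog_pos by lra. rewrite Rplus_0_r, ln_1, Cmult_0_r, Cexp_0.
  reflexivity.
Qed.

Lemma at0_v : Clim (at_right 0) (fun t => RtoC (/ (1 + t))) 1.
Proof.
  assert (H : is_Cderive (fun x => RtoC (/ (1 + x))) 0 (RtoC (-1))).
  { apply Cderive_RtoC. auto_derive; [lra|]. field. }
  assert (H1 := Clim_real_cont _ _ _ H). cbv beta in H1.
  replace (/ (1 + 0)) with 1 in H1 by field. exact H1.
Qed.

Hypothesis HRe : 0 < Re c.

(** The coefficients are o of those of (1 - v)^(-c), as their exponents differ
    by one; hence only the derivative contributes at t = 0. *)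
Lemma at0_hyp : Clim (at_right 0) (fun t => Cpower (RtoC (1 - / (1 + t))) c
  * hyp a (c - b) (a - b + 1) (RtoC (/ (1 + t))))%C 0.
Proof.
  apply (Clim_comp _ (at_left 1) (fun t => / (1 + t))
    (fun v => Cpower (RtoC (1 - v)) c * hyp a (c - b) (a - b + 1) (RtoC v))%C);
    [apply filterlim_v_at_0|].
  apply (abel_comparison (hcoef a (c - b) (a - b + 1)) c 0 HRe).
  - intros v Hv. apply hyp_summable; [exact Hg|]. rewrite Cmod_R, Rabs_pos_eq; lra.
  - apply (Clim_ext eventually (fun n => poch a n * poch (c - b) n
      / (poch (a - b + 1) n * poch c n))%C).
    + intros n. unfold hcoef, bin. field.
      repeat split; try apply fact_C_neq_0; now apply poch_neq_0.
    + apply poch_quotient_lim_0; [exact Hg|exact Hc|ring].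
Qed.

(** Here the exponents agree and the coefficient quotient tends to a quotient of
    Gamma values. *)
Lemma at0_dhyp : Clim (at_right 0) (fun t => Cpower (RtoC (1 - / (1 + t))) c
  * dhyp a (c - b) (a - b + 1) (RtoC (/ (1 + t))))%C (kappa a b c).
Proof.
  assert (Hg1 := not_nonpos_int_1 _ Hg).
  assert (H : Clim (at_left 1) (fun v => Cpower (RtoC (1 - v)) c
     * hyp (a + 1) (c - b + 1) (a - b + 1 + 1) (RtoC v))%C
     (rGamma (a + 1) * rGamma (c - b + 1) / (rGamma (a - b + 1 + 1) * rGamma c))%C).
  { apply (abel_comparison (hcoef (a + 1) (c - b + 1) (a - b + 1 + 1)) c _ HRe).
    - intros v Hv. apply hyp_summable; [exact Hg1|]. rewrite Cmod_R, Rabs_pos_eq; lra.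
    - apply (Clim_ext eventually (fun n => poch (a + 1) n * poch (c - b + 1) n
        / (poch (a - b + 1 + 1) n * poch c n))%C).
      + intros n. unfold hcoef, bin. field.
        repeat split; try apply fact_C_neq_0; now apply poch_neq_0.
      + apply poch_quotient_lim; [exact Hg1|exact Hc|ring]. }
  assert (H2 := Clim_comp _ _ _ _ _ filterlim_v_at_0 H).
  assert (Hgn := not_nonpos_int_neq_0 _ Hg).
  apply (Clim_ext (at_right 0) (fun t => a * (c - b) / (a - b + 1) *
    (Cpower (RtoC (1 - / (1 + t))) c
     * hyp (a + 1) (c - b + 1) (a - b + 1 + 1) (RtoC (/ (1 + t)))))%C).
  { intros t. unfold dhyp. ring. }
  replace (kappa a b c) with (a * (c - b) / (a - b + 1) *
     (rGamma (a + 1) * rGamma (c - b + 1) / (rGamma (a - b + 1 + 1) * rGamma c)))%C.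
  - clim.
  - unfold kappa. rewrite (rGamma_succ a), (rGamma_succ (c - b)), (rGamma_succ (a - b + 1)).
    field. repeat split; try exact Hgn; now apply rGamma_neq_0.
Qed.

(** The value of the constant is its limit at t = 0. *)
Lemma wronskian_hyp_frob (t : R) : 0 < t < 1 ->
  (weight a b c t * wronskian (fun t => hyp a b c (RtoC (- t)))
     (fun t => - dhyp a b c (RtoC (- t)))%C (frob a b c) (dfrob a b c) t)%C
  = (- kappa a b c)%C.
Proof.
  intros Ht. set (f := fun t => hyp a b c (RtoC (- t))).
  set (f1 := fun t => (- dhyp a b c (RtoC (- t)))%C).
  set (W := fun t => (weight a b c t * wronskian f f1 (frob a b c) (dfrob a b c) t)%C).
  change (W t = (- kappa a b c)%C).
  apply (Clim_unique (at_right 0) W).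
  - apply (Clim_ext_loc (at_right 0) (fun _ => W t)).
    2:{ clim. }
    exists (mkposreal t (proj1 Ht)). intros s Hs Hs0.
    unfold ball in Hs; simpl in Hs; unfold AbsRing_ball, minus, plus, opp, abs in Hs; simpl in Hs.
    apply Rabs_def2 in Hs. change (W t = W s). symmetry. unfold W.
    refine (wronskian_constant a b c f f1 (frob a b c) (dfrob a b c) s t _ _ _); [lra| |].
    + intros x Hx. apply hyp_solves; [exact Hc|lra].
    + intros x Hx. apply frob_solves; [exact Hg|lra].
  - assert (Hd : is_derive (fun x => - x) 0 (-1)) by (auto_derive; [exact I|ring]).
    assert (Habs : Rabs (- 0) < 1) by (rewrite Ropp_0, Rabs_R0; lra).
    assert (L1 := Clim_real_cont _ _ _ (Cderive_comp (fun s => hyp a b c (RtoC s)) (fun x => - x) 0 (-1) _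
       (Cderive_hyp a b c (- 0) Hc Habs) Hd)).
    assert (L2 := Clim_real_cont _ _ _ (Cderive_comp (fun s => dhyp a b c (RtoC s)) (fun x => - x) 0 (-1) _
       (Cderive_dhyp a b c (- 0) Hc Habs) Hd)).
    cbv beta in L1, L2. rewrite Ropp_0, hyp_0 in L1. set (d0 := dhyp a b c (RtoC (- 0))) in *.
    apply (Clim_ext_loc (at_right 0) (fun t =>
      - Cpower (RtoC (1 + t)) (b + 1) *
      (hyp a b c (RtoC (- t)) * (RtoC (/ (1 + t)) *
        (a * (Cpower (RtoC (1 - / (1 + t))) c * hyp a (c - b) (a - b + 1) (RtoC (/ (1 + t))))
         + RtoC (/ (1 + t)) *
           (Cpower (RtoC (1 - / (1 + t))) c * dhyp a (c - b) (a - b + 1) (RtoC (/ (1 + t))))))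
       - dhyp a b c (RtoC (- t)) *
         (Cpower (RtoC (1 - / (1 + t))) c * hyp a (c - b) (a - b + 1) (RtoC (/ (1 + t))))))%C).
    + exists (mkposreal _ Rlt_0_1). intros s _ Hs0. unfold W.
      rewrite weight_split by exact Hs0. unfold wronskian, f, f1, frob, dfrob.
      replace (a + b + 1)%C with (a + (b + 1))%C by ring.
      rewrite (Cpower_plus _ a (b + 1)), Cpower_opp. field. apply Cpower_neq_0.
    + replace (- kappa a b c)%C
        with (- (1) * (1 * (1 * (a * 0 + 1 * kappa a b c)) - d0 * 0))%C by ring.
      assert (L3 := at0_factor (b + 1)). assert (L4 := at0_v).
      assert (L5 := at0_hyp). assert (L6 := at0_dhyp).
      apply Clim_mult; [clim..|].
      apply Clim_minus; [clim| |exact (Clim_mult _ _ _ _ _ L2 L5)].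
      apply Clim_mult; [clim|exact L1|]. apply Clim_mult; [clim|exact L4|].
      apply Clim_plus; [clim| |exact (Clim_mult _ _ _ _ _ L4 L6)].
      apply Clim_mult; [clim..|exact L5].
Qed.
End Constants.

Lemma filterlim_v_at_infty :
  filterlim (fun t => / (1 + t)) (Rbar_locally p_infty) (locally 0).
Proof.
  intros P [eps HP]. unfold filtermap. exists (/ eps). intros t Ht. apply HP.
  assert (He := cond_pos eps). assert (Hie : 0 < / eps) by now apply Rinv_0_lt_compat.
  unfold ball; simpl; unfold AbsRing_ball, minus, plus, opp, abs; simpl.
  rewrite Ropp_0, Rplus_0_r, Rabs_pos_eq by (left; apply Rinv_0_lt_compat; lra).
  rewrite <- (Rinv_inv eps). apply Rinv_lt_contravar; [|lra].
  apply Rmult_lt_0_compat; lra.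
Qed.

(** The value of the constant is its limit at t = oo, where v = 0. *)
Lemma wronskian_frob_frob (a b c : C) (t : R) :
  not_nonpos_int (a - b + 1)%C -> not_nonpos_int (b - a + 1)%C -> 0 < t ->
  (weight a b c t * wronskian (frob a b c) (dfrob a b c) (frob b a c) (dfrob b a c) t)%C
  = (a - b)%C.
Proof.
  intros Hab Hba Ht.
  set (W := fun t => (weight a b c t
    * wronskian (frob a b c) (dfrob a b c) (frob b a c) (dfrob b a c) t)%C).
  change (W t = (a - b)%C).
  assert (Hsol : forall x, 0 < x -> solves a b c (frob b a c) (dfrob b a c) x).
  { intros x Hx. destruct (frob_solves b a c x Hba Hx) as [H1 [f2 [H2 E]]].
    split; [exact H1|]. exists f2. split; [exact H2|]. rewrite <- E. ring. }
  apply (Clim_unique (Rbar_locally p_infty) W).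
  - apply (Clim_ext_loc (Rbar_locally p_infty) (fun _ => W t)).
    2:{ clim. }
    exists t. intros s Hs. change (W t = W s). unfold W.
    refine (wronskian_constant a b c (frob a b c) (dfrob a b c) (frob b a c) (dfrob b a c)
      t s _ _ _); [lra| |].
    + intros x Hx. apply frob_solves; [exact Hab|lra].
    + intros x Hx. apply Hsol; lra.
  - assert (Habs : Rabs 0 < 1) by (rewrite Rabs_R0; lra).
    assert (LH : forall A B G, not_nonpos_int G ->
      Clim (Rbar_locally p_infty) (fun t => hyp A B G (RtoC (/ (1 + t)))) 1).
    { intros A B G HG. rewrite <- (hyp_0 A B G).
      apply (Clim_comp _ (locally 0) (fun t => / (1 + t)) (fun s => hyp A B G (RtoC s)));
        [apply filterlim_v_at_infty|].
      exact (Cderive_Clim _ _ _ (Cderive_hyp A B G 0 HG Habs)). }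
    assert (LD : forall A B G, not_nonpos_int G ->
      Clim (Rbar_locally p_infty) (fun t => dhyp A B G (RtoC (/ (1 + t)))) (dhyp A B G 0)).
    { intros A B G HG.
      apply (Clim_comp _ (locally 0) (fun t => / (1 + t)) (fun s => dhyp A B G (RtoC s)));
        [apply filterlim_v_at_infty|].
      exact (Cderive_Clim _ _ _ (Cderive_dhyp A B G 0 HG Habs)). }
    assert (LV : Clim (Rbar_locally p_infty) (fun t => RtoC (/ (1 + t))) 0).
    { apply Clim_RtoC; [typeclasses eauto|apply filterlim_v_at_infty]. }
    assert (LP : Clim (Rbar_locally p_infty) (fun t => Cpower (RtoC (1 - / (1 + t))) c) 1).
    { assert (H : is_Cderive (fun x => Cpower (RtoC (1 - x)) c) 0
        (c * RtoC (-1 / (1 - 0)) * Cpower (RtoC (1 - 0)) c)%C).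
      { apply (Cderive_Cpower_real (fun x => 1 - x)); [lra|]. auto_derive; [exact I|ring]. }
      assert (H1 := Cderive_Clim _ _ _ H). cbv beta in H1.
      replace (Cpower (RtoC (1 - 0)) c) with (RtoC 1) in H1.
      - apply (Clim_comp _ (locally 0) (fun t => / (1 + t)) (fun x => Cpower (RtoC (1 - x)) c));
          [apply filterlim_v_at_infty|exact H1].
      - unfold Cpower. rewrite CLog_pos by lra.
        rewrite Rminus_0_r, ln_1, Cmult_0_r, Cexp_0. reflexivity. }
    apply (Clim_ext_loc (Rbar_locally p_infty) (fun t =>
      Cpower (RtoC (1 - / (1 + t))) c *
      ((a * hyp a (c - b) (a - b + 1) (RtoC (/ (1 + t)))
        + RtoC (/ (1 + t)) * dhyp a (c - b) (a - b + 1) (RtoC (/ (1 + t))))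
       * hyp b (c - a) (b - a + 1) (RtoC (/ (1 + t)))
       - hyp a (c - b) (a - b + 1) (RtoC (/ (1 + t))) *
       (b * hyp b (c - a) (b - a + 1) (RtoC (/ (1 + t)))
        + RtoC (/ (1 + t)) * dhyp b (c - a) (b - a + 1) (RtoC (/ (1 + t))))))%C).
    + exists 0. intros s Hs. unfold W. rewrite weight_split by exact Hs.
      unfold wronskian, frob, dfrob.
      rewrite (Cpower_plus _ (a + b) 1), (Cpower_plus _ a b), !Cpower_opp.
      rewrite Cpower_1 by (apply RtoC_neq_0; lra).
      assert (Hi : RtoC (/ (1 + s)) = (/ RtoC (1 + s))%C) by (apply RtoC_inv; lra).
      rewrite !Hi. field. repeat split; try apply Cpower_neq_0. apply RtoC_neq_0; lra.
    + apply Clim_eq with (1 * ((a * 1 + 0 * dhyp a (c - b) (a - b + 1) 0) * 1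
               - 1 * (b * 1 + 0 * dhyp b (c - a) (b - a + 1) 0)))%C; [ring|].
      apply Clim_mult; [clim|exact LP|].
      assert (LS : forall a b, not_nonpos_int (a - b + 1)%C ->
        Clim (Rbar_locally p_infty) (fun t =>
          a * hyp a (c - b) (a - b + 1) (RtoC (/ (1 + t)))
          + RtoC (/ (1 + t)) * dhyp a (c - b) (a - b + 1) (RtoC (/ (1 + t))))%C
          (a * 1 + 0 * dhyp a (c - b) (a - b + 1) 0)%C).
      { intros a0 b0 G. apply Clim_plus; [clim| |]; (apply Clim_mult; [clim..|]).
        - apply LH, G.
        - apply LD, G. }
      apply Clim_minus; [clim| |]; (apply Clim_mult; [clim| |]).
      * exact (LS a b Hab).
      * exact (LH _ _ _ Hba).
      * exact (LH _ _ _ Hab).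
      * exact (LS b a Hba).
Qed.

Definition connection_at (a b c : C) : Prop := forall t, 0 < t < 1 ->
  hyp a b c (RtoC (- t)) = (frakf c b a * frob a b c t + frakf c a b * frob b a c t)%C.

Lemma not_int_not_nonpos (z : C) : not_int z -> not_nonpos_int z.
Proof.
  intros H n E. apply (H (- Z.of_nat n)%Z). rewrite E. f_equal.
  rewrite opp_IZR, <- INR_IZR_INZ. reflexivity.
Qed.

Lemma not_int_opp (z : C) : not_int z -> not_int (- z)%C.
Proof.
  intros H k E. apply (H (- k)%Z). rewrite opp_IZR, RtoC_opp, <- E. ring.
Qed.

Lemma not_int_plus (z : C) (n : Z) : not_int z -> not_int (z + RtoC (IZR n))%C.
Proof.
  intros H k E. apply (H (k - n)%Z). rewrite minus_IZR, RtoC_minus, <- E. ring.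
Qed.

Lemma frakf_kappa (a b c : C) : not_int (a - b)%C -> not_nonpos_int c ->
  frakf c a b = (kappa a b c / (a - b))%C.
Proof.
  intros Hab Hc. unfold frakf, kappa, Gamma.
  assert (H0 := not_int_not_nonpos _ Hab).
  assert (N := not_nonpos_int_neq_0 _ H0).
  assert (E := rGamma_succ (a - b)).
  assert (N1 := rGamma_neq_0 _ (not_nonpos_int_1 _ H0)).
  assert (N2 := rGamma_neq_0 _ Hc).
  rewrite E. field. repeat split; assumption.
Qed.

(** Cramer's rule: three solutions of a second-order equation are linearly
    dependent with their Wronskians as coefficients. *)
Lemma connection_Re_pos (a b c : C) : not_int (a - b)%C -> 0 < Re c -> connection_at a b c.
Proof.
  intros Hab HRe t Ht.
  assert (Hc : not_nonpos_int c).
  { intros n E. rewrite E in HRe. simpl in HRe. assert (H := pos_INR n). lra. }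
  assert (Hba : not_int (b - a)%C).
  { replace (b - a)%C with (- (a - b))%C by ring. now apply not_int_opp. }
  assert (G1 := not_nonpos_int_1 _ (not_int_not_nonpos _ Hab)).
  assert (G2 := not_nonpos_int_1 _ (not_int_not_nonpos _ Hba)).
  assert (N := not_nonpos_int_neq_0 _ (not_int_not_nonpos _ Hab)).
  rewrite (frakf_kappa a b c Hab Hc), (frakf_kappa b a c Hba Hc).
  assert (W1 := wronskian_hyp_frob a b c G1 Hc HRe t Ht).
  assert (W2 := wronskian_hyp_frob b a c G2 Hc HRe t Ht).
  assert (W0 := wronskian_frob_frob a b c t G1 G2 (proj1 Ht)).
  assert (Hw : weight b a c t = weight a b c t).
  { unfold weight. do 2 f_equal. ring. }
  assert (Hsym : forall z, hyp b a c z = hyp a b c z).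
  { intros z. unfold hyp, Cps. apply CSeries_ext. intros n. unfold hcoef.
    now rewrite (Cmult_comm (poch b n)). }
  assert (Hsym' : forall z, dhyp b a c z = dhyp a b c z).
  { intros z. unfold dhyp. f_equal; [now rewrite (Cmult_comm b)|].
    unfold hyp, Cps. apply CSeries_ext. intros n. unfold hcoef.
    now rewrite (Cmult_comm (poch (b + 1) n)). }
  rewrite Hw in W2. unfold wronskian in *. rewrite Hsym, Hsym' in W2.
  set (f := hyp a b c (RtoC (- t))) in *. set (f1 := dhyp a b c (RtoC (- t))) in *.
  set (w := weight a b c t) in *.
  set (u := frob a b c t) in *. set (u1 := dfrob a b c t) in *.
  set (s := frob b a c t) in *. set (s1 := dfrob b a c t) in *.
  assert (E : ((a - b) * f)%C = (kappa a b c * s - kappa b a c * u)%C).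
  { rewrite <- W0. 
    replace (kappa a b c) with (- (w * (f * u1 - - f1 * u)))%C by (rewrite W1; ring).
    replace (kappa b a c) with (- (w * (f * s1 - - f1 * s)))%C by (rewrite W2; ring).
    ring. }
  assert (N' : (b - a)%C <> 0).
  { apply not_nonpos_int_neq_0. now apply not_int_not_nonpos. }
  replace f with ((a - b) * f / (a - b))%C by (field; exact N).
  rewrite E. field. split; assumption.
Qed.

(** (z d/dz + c) lowers c by one on all three functions, with the factors that
    the Gamma quotients absorb. *)
Lemma connection_lower (a b c : C) : not_int (a - b)%C -> not_nonpos_int c ->
  connection_at a b (c + 1) -> connection_at a b c.
Proof.
  intros Hab Hc H t Ht.
  assert (Hc1 := not_nonpos_int_1 c Hc).
  assert (Hba : not_int (b - a)%C).
  { replace (b - a)%C with (- (a - b))%C by ring. now apply not_int_opp. }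
  assert (G1 := not_nonpos_int_1 _ (not_int_not_nonpos _ Hab)).
  assert (G2 := not_nonpos_int_1 _ (not_int_not_nonpos _ Hba)).
  assert (Nc := not_nonpos_int_neq_0 c Hc).
  assert (Hlow : forall a b, not_nonpos_int (a - b + 1)%C ->
    (RtoC t * dfrob a b (c + 1) t + c * frob a b (c + 1) t)%C = ((c - a) * frob a b c t)%C).
  { intros a0 b0 G. unfold frob, dfrob. assert (Hv := inv_1_plus t (proj1 Ht)).
    assert (NV : RtoC (/ (1 + t)) <> 0) by (apply RtoC_neq_0; lra).
    assert (Hr := hyp_lower_b a0 (c - b0) (a0 - b0 + 1) (RtoC (/ (1 + t))) G
      (Cmod_inv_1_plus t (proj1 Ht))).
    replace (c - b0 + 1)%C with (c + 1 - b0)%C in Hr by ring.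
    replace (c + 1 - b0 - (a0 - b0 + 1))%C with (c - a0)%C in Hr by ring.
    assert (E2 : RtoC t = ((1 - RtoC (/ (1 + t))) / RtoC (/ (1 + t)))%C).
    { rewrite <- RtoC_minus, <- RtoC_div by lra. f_equal. field. lra. }
    rewrite E2. set (V := RtoC (/ (1 + t))) in *.
    set (E := Cpower (RtoC (1 + t)) (- a0)).
    set (h := hyp a0 (c - b0) (a0 - b0 + 1) V) in *.
    set (k := hyp a0 (c + 1 - b0) (a0 - b0 + 1) V) in *.
    set (d := dhyp a0 (c + 1 - b0) (a0 - b0 + 1) V) in *.
    transitivity (E * ((a0 * V * k - (1 - V) * (V * d)) + (c - a0) * k))%C.
    - field. exact NV.
    - rewrite <- Hr. ring. }
  assert (Habs : Rabs (- t) < 1) by (rewrite Rabs_Ropp, Rabs_pos_eq; lra).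
  assert (Hder : (- dhyp a b (c + 1) (RtoC (- t)))%C
    = (frakf (c + 1) b a * dfrob a b (c + 1) t + frakf (c + 1) a b * dfrob b a (c + 1) t)%C).
  { apply (Cderive_unique (fun t => hyp a b (c + 1) (RtoC (- t))) t).
    - apply (hyp_solves a b (c + 1) t Hc1 Ht).
    - apply (Cderive_ext (fun t => frakf (c + 1) b a * frob a b (c + 1) t
                     + frakf (c + 1) a b * frob b a (c + 1) t)%C).
      + assert (Hl : locally t (fun s => 0 < s < 1)).
        { apply (filter_and (F := locally t)); [now apply (open_gt 0)|now apply (open_lt 1)]. }
        revert Hl. apply filter_imp. intros s Hs. symmetry. now apply H.
      + apply Cderive_plus; apply Cderive_scal; apply frob_solves; try assumption; apply Ht. }
  assert (Hl := hyp_lower_c a b c (RtoC (- t)) Hc ltac:(now rewrite Cmod_R)).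
  assert (F : forall a b, (frakf (c + 1) b a * (c - a))%C = (c * frakf c b a)%C).
  { intros a0 b0. unfold frakf, Gamma.
    assert (N1 := rGamma_neq_0 _ Hc1). 
    rewrite (rGamma_succ (c - a0)), (rGamma_succ c).
    replace (c + 1 - a0)%C with (c - a0 + 1)%C by ring.
    assert (HH : forall x y z w : C, x <> 0 -> c <> 0 ->
      (/ x * y * z * w * (c - a0) = c * (/ (c * x) * y * z * ((c - a0) * w)))%C)
      by (intros; field; now split).
    apply HH; assumption. }
  assert (E : (c * hyp a b c (RtoC (- t)))%C
    = (c * (frakf c b a * frob a b c t + frakf c a b * frob b a c t))%C).
  { rewrite <- Hl, H by exact Ht. rewrite RtoC_opp.
    replace (dhyp a b (c + 1) (- RtoC t))
      with (- (- dhyp a b (c + 1) (RtoC (- t))))%C by (rewrite RtoC_opp; ring).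
    rewrite Hder.
    transitivity (frakf (c + 1) b a * (RtoC t * dfrob a b (c + 1) t + c * frob a b (c + 1) t)
      + frakf (c + 1) a b * (RtoC t * dfrob b a (c + 1) t + c * frob b a (c + 1) t))%C; [ring|].
    rewrite !Hlow by assumption.
    transitivity (frakf (c + 1) b a * (c - a) * frob a b c t
      + frakf (c + 1) a b * (c - b) * frob b a c t)%C; [ring|].
    rewrite !F. ring. }
  replace (hyp a b c (RtoC (- t))) with (/ c * (c * hyp a b c (RtoC (- t))))%C
    by (field; exact Nc).
  rewrite E. field. exact Nc.
Qed.

(** Induction on the number of unit steps from c to the half-plane Re c > 0. *)
Theorem connection (a b c : C) : not_int (a - b)%C -> not_nonpos_int c -> connection_at a b c.
Proof.
  intros Hab Hc. destruct (exists_nat_ge (1 - Re c)) as [N HN].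
  revert c Hc HN. induction N as [|N IH]; intros c Hc HN.
  - apply connection_Re_pos; [exact Hab|]. simpl in HN. lra.
  - apply connection_lower; [exact Hab|exact Hc|].
    apply IH; [now apply not_nonpos_int_1|]. rewrite S_INR in HN.
    unfold Re in *; simpl. lra.
Qed.

(** * Pfaff's transformation: passing from 1/(1-X) to 1/X *)

Lemma sum_n_C_first (u : nat -> C) (n : nat) :
  sum_n u (S n) = (u 0%nat + sum_n (fun k => u (S k)) n)%C.
Proof.
  induction n as [|n IH].
  - rewrite sum_n_Cplus_S, !sum_O. reflexivity.
  - rewrite sum_n_Cplus_S, IH, (sum_n_Cplus_S (fun k => u (S k))). Cring.
Qed.

Lemma sum_n_Cplus (u v : nat -> C) (n : nat) :
  sum_n (fun k => u k + v k)%C n = (sum_n u n + sum_n v n)%C.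
Proof.
  induction n as [|n IH]; [now rewrite !sum_O|].
  rewrite !sum_n_Cplus_S, IH. Cring.
Qed.

Lemma sum_n_C_ext (u v : nat -> C) (n : nat) :
  (forall k, (k <= n)%nat -> u k = v k) -> sum_n u n = sum_n v n.
Proof. intros H. now apply sum_n_ext_loc. Qed.

(** The summand of the Chu-Vandermonde sum, with binomial coefficients written
    out and the factor m! removed. *)
Definition vterm (b c : C) (m k : nat) : C :=
  ((-1) ^ k * poch b k / (poch c k * RtoC (INR (fact k)) * RtoC (INR (fact (m - k)))))%C.

Lemma chu_vandermonde (m : nat) (b c : C) : not_nonpos_int c ->
  sum_n (vterm b c m) m = (poch (c - b) m / (poch c m * RtoC (INR (fact m))))%C.
Proof.
  revert b c. induction m as [|m IH]; intros b c Hc.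
  - rewrite sum_O. unfold vterm. simpl. field.
  - assert (Hc1 := not_nonpos_int_1 c Hc).
    assert (Hm := INR_S_C_neq_0 m).
    (* m + 1 = (m + 1 - k) + k distributes over the factorials as in Pascal's rule *)
    assert (E : (RtoC (INR (S m)) * sum_n (vterm b c (S m)) (S m))%C
       = (sum_n (vterm b c m) m + - (b / c) * sum_n (vterm (b + 1) (c + 1) m) m)%C).
    { rewrite <- sum_n_Cscal.
      rewrite (sum_n_C_ext _ (fun k => RtoC (INR (S m - k)) * vterm b c (S m) k
                                  + RtoC (INR k) * vterm b c (S m) k)%C).
      2:{ intros k Hk. rewrite minus_INR, RtoC_minus by exact Hk. ring. }
      rewrite sum_n_Cplus. f_equal.
      - rewrite sum_n_Cplus_S, Nat.sub_diag. simpl (INR 0).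
        rewrite (sum_n_C_ext _ (vterm b c m)).
        + Cring.
        + intros k Hk. unfold vterm. replace (S m - k)%nat with (S (m - k)) by lia.
          rewrite fact_S_C. field.
          repeat split; try apply fact_C_neq_0; try apply INR_S_C_neq_0. now apply poch_neq_0.
      - rewrite sum_n_C_first. simpl (INR 0). rewrite <- sum_n_Cscal.
        rewrite (sum_n_C_ext (fun k => RtoC (INR (S k)) * vterm b c (S m) (S k))%C
                  (fun k => - (b / c) * vterm (b + 1) (c + 1) m k)%C).
        + Cring.
        + intros k Hk. unfold vterm. replace (S m - S k)%nat with (m - k)%nat by lia.
          rewrite fact_S_C, !poch_S_l, Cpow_S. field.
          repeat split; try apply fact_C_neq_0; try apply INR_S_C_neq_0.
          * now apply poch_neq_0.
          * now apply not_nonpos_int_neq_0. }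
    rewrite !IH in E by assumption.
    replace (c + 1 - (b + 1))%C with (c - b)%C in E by ring.
    assert (Ec : (c * poch (c + 1) m)%C = (poch c m * (c + RtoC (INR m)))%C)
      by (rewrite <- poch_S_l; reflexivity).
    assert (N1 := poch_neq_0 c m Hc). assert (N2 := poch_neq_0 _ m Hc1).
    assert (N3 := not_nonpos_int_neq_0 c Hc). assert (N4 := not_nonpos_int_plus c m Hc).
    assert (N5 := fact_C_neq_0 m).
    assert (E3 : (b / c * (poch (c - b) m / (poch (c + 1) m * RtoC (INR (fact m)))))%C
       = (b * poch (c - b) m / (poch c m * (c + RtoC (INR m)) * RtoC (INR (fact m))))%C).
    { rewrite <- Ec. field. repeat split; assumption. }
    transitivity (/ RtoC (INR (S m)) * (RtoC (INR (S m)) * sum_n (vterm b c (S m)) (S m)))%C.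
    { rewrite Cmult_assoc, Cinv_l, Cmult_1_l by exact Hm. reflexivity. }
    rewrite E. match goal with |- @eq _ ?l ?r => change (@eq C l r) end.
    transitivity (/ RtoC (INR (S m)) * (poch (c - b) m / (poch c m * RtoC (INR (fact m)))
      - b / c * (poch (c - b) m / (poch (c + 1) m * RtoC (INR (fact m))))))%C; [ring|].
    rewrite E3, !poch_S, fact_S_C. field. repeat split; assumption.
Qed.

Lemma Cpow_m1_sub (m k : nat) : (k <= m)%nat -> ((-1) ^ (m - k) = (-1) ^ m * (-1) ^ k)%C.
Proof.
  intros Hk. replace m with (m - k + k)%nat at 2 by lia. rewrite Cpow_add_r.
  assert (E : ((-1) ^ k * (-1) ^ k)%C = 1).
  { rewrite <- Cpow_mult_l. replace (-1 * -1)%C with (RtoC 1) by ring. apply Cpow_1_l. }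
  rewrite <- Cmult_assoc, E. ring.
Qed.

(** Coefficient of z^m in the k-th term of the expanded left-hand side. *)
Definition pfaff_term (a b c : C) (k m : nat) : C :=
  if le_lt_dec k m
  then (hcoef a b c k * bin (a + RtoC (INR k)) (m - k) * (-1) ^ (m - k))%C
  else RtoC 0.

(** The finite sums collapse by Chu-Vandermonde. *)
Lemma pfaff_column (a b c : C) (m : nat) : not_nonpos_int c ->
  CSeries (fun k => pfaff_term a b c k m) = (hcoef a (c - b) c m * (-1) ^ m)%C.
Proof.
  intros Hc. rewrite (CSeries_finite _ m).
  2:{ intros k Hk. unfold pfaff_term. destruct (le_lt_dec k m); [lia|reflexivity]. }
  rewrite (sum_n_C_ext _ (fun k => ((-1) ^ m * poch a m) * vterm b c m k)%C).
  - rewrite sum_n_Cscal, chu_vandermonde by exact Hc. unfold hcoef. field.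
    split; [apply fact_C_neq_0|now apply poch_neq_0].
  - intros k Hk. unfold pfaff_term. destruct (le_lt_dec k m) as [_|Hlt]; [|lia].
    rewrite Cpow_m1_sub by exact Hk. unfold hcoef, bin, vterm.
    assert (E : poch a m = (poch a k * poch (a + RtoC (INR k)) (m - k))%C).
    { rewrite <- poch_plus. f_equal. lia. }
    rewrite E. field. repeat split; try apply fact_C_neq_0. now apply poch_neq_0.
Qed.

(** Expand each z^k (1 + z)^(-a-k) by the binomial series and collect powers of
    z. The bound on z makes the double series absolutely convergent. *)
Lemma pfaff (a b c : C) (z : R) : not_nonpos_int c -> 0 < z < 1 / 8 ->
  (Cpower (RtoC (1 + z)) (- a) * hyp a b c (RtoC (z / (1 + z))))%C
  = hyp a (c - b) c (RtoC (- z)).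
Proof.
  intros Hc Hz.
  destruct (hcoef_bound a b c 2 Hc ltac:(lra)) as [M [HM Hh]].
  destruct (exists_nat_ge (Cmod a)) as [A HA].
  set (u := fun k m => (pfaff_term a b c k m * RtoC z ^ m)%C).
  assert (HD : summable2 u).
  { apply (summable2_geom u (M * 2 ^ A) (1/2) (8 * z)); [lra|lra|].
    intros k m. unfold u, pfaff_term. destruct (le_lt_dec k m) as [Hkm|Hkm].
    2:{ rewrite Cmult_0_l, Cmod_0. repeat apply Rmult_le_pos; try apply pow_le; lra. }
    rewrite !Cmod_mult, !Cmod_pow, !Cmod_R, (Rabs_pos_eq z), (Rabs_left (-1)) by lra.
    replace (- -1) with 1 by ring. rewrite pow1, Rmult_1_r.
    assert (B1 : Cmod (bin (a + RtoC (INR k)) (m - k)) <= 2 ^ A * 2 ^ m).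
    { replace (2 ^ A * 2 ^ m) with (2 ^ (A + k) * 2 ^ (m - k))
        by (rewrite <- !pow_add; f_equal; lia).
      apply bin_le_pow2. rewrite plus_INR. eapply Rle_trans; [apply Cmod_triangle|].
      rewrite Cmod_R, (Rabs_pos_eq (INR k)) by apply pos_INR. lra. }
    apply Rle_trans with (M * 2 ^ k * (2 ^ A * 2 ^ m) * z ^ m).
    { apply Rmult_le_compat_r; [apply pow_le; lra|].
      apply Rmult_le_compat; try apply Cmod_ge_0; [apply Hh|exact B1]. }
    replace (8 * z) with (4 * (2 * z)) by ring. rewrite !Rpow_mult_distr.
    replace (M * 2 ^ k * (2 ^ A * 2 ^ m) * z ^ m) with (M * 2 ^ A * (2 ^ m * z ^ m) * 2 ^ k) by ring.
    replace (M * 2 ^ A * (1/2) ^ k * (4 ^ m * (2 ^ m * z ^ m)))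
      with (M * 2 ^ A * (2 ^ m * z ^ m) * ((1/2) ^ k * 4 ^ m)) by ring.
    apply Rmult_le_compat_l.
    { repeat apply Rmult_le_pos; try apply pow_le; lra. }
    replace (2 ^ k) with ((1/2) ^ k * 4 ^ k)
      by (rewrite <- Rpow_mult_distr; f_equal; field).
    apply Rmult_le_compat_l; [apply pow_le; lra|]. apply Rle_pow; [lra|exact Hkm]. }
  assert (HF := Fubini u HD).
  assert (Hzc : Cmod (RtoC z) < 1) by (rewrite Cmod_R, Rabs_pos_eq; lra).
  assert (Nz : RtoC (1 + z) <> 0) by (apply RtoC_neq_0; lra).
  transitivity (CSeries (fun k => CSeries (fun m => u k m))).
  - unfold hyp, Cps. rewrite <- CSeries_scal.
    2:{ apply hyp_summable; [exact Hc|]. rewrite Cmod_R, Rabs_pos_eq.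
        - apply Rmult_lt_reg_r with (1 + z); [lra|]. unfold Rdiv.
          rewrite Rmult_assoc, Rinv_l by lra. lra.
        - apply Rdiv_le_0_compat; lra. }
    apply CSeries_ext. intros k.
    assert (Ej : forall j, u k (k + j)%nat = (hcoef a b c k * RtoC z ^ k
        * (bin (a + RtoC (INR k)) j * (- RtoC z) ^ j))%C).
    { intros j. unfold u, pfaff_term. destruct (le_lt_dec k (k + j)) as [_|Hlt]; [|lia].
      replace (k + j - k)%nat with j by lia.
      replace (- RtoC z)%C with (-1 * RtoC z)%C by ring.
      rewrite Cpow_add_r, Cpow_mult_l. ring. }
    assert (Hbin : summable (fun j => bin (a + RtoC (INR k)) j * (- RtoC z) ^ j)%C)
      by (apply bin_summable; now rewrite Cmod_opp).
    rewrite (CSeries_shift (fun m => u k m) k).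
    + rewrite (CSeries_ext _ _ Ej), CSeries_scal by exact Hbin.
      change (CSeries (fun n => bin (a + RtoC (INR k)) n * (- RtoC z) ^ n)%C)
        with (Cps (bin (a + RtoC (INR k))) (- RtoC z)).
      rewrite binomial_series by exact Hzc.
      replace (- (a + RtoC (INR k)))%C with (- a - RtoC (INR k))%C by ring.
      rewrite <- RtoC_plus, Cpower_minus_INR by exact Nz.
      rewrite RtoC_div by lra. unfold Cdiv. rewrite Cpow_mult_l. ring.
    + intros m Hm. unfold u, pfaff_term. destruct (le_lt_dec k m); [lia|ring].
    + apply (summable_ext _ _ (fun j => eq_sym (Ej j))). now apply summable_scal.
  - rewrite HF. unfold hyp, Cps. apply CSeries_ext. intros m.
    assert (AC : summable (fun k => pfaff_term a b c k m)).
    { apply summable_finite with m. intros k Hk. unfold pfaff_term.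
      destruct (le_lt_dec k m); [lia|reflexivity]. }
    unfold u. rewrite (CSeries_ext _ (fun k => RtoC z ^ m * pfaff_term a b c k m)%C)
      by (intros; ring).
    rewrite CSeries_scal, pfaff_column by assumption.
    rewrite RtoC_opp. replace (- RtoC z)%C with (-1 * RtoC z)%C by ring.
    rewrite Cpow_mult_l. ring.
Qed.

(** The Frobenius solution with exponent a at infinity, in the variable 1/X. *)
Definition frobX (a b c X : C) : C :=
  (Cpower (- X) (- a) * hyp a (1 - c + a) (1 - b + a) (/ X))%C.

Lemma frob_frobX (a b c : C) (t : R) : not_nonpos_int (a - b + 1)%C -> 8 < t ->
  frob a b c t = frobX a b c (RtoC (- t)).
Proof.
  intros Hg Ht. unfold frob, frobX.
  assert (Hz : 0 < / t < 1 / 8).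
  { split; [apply Rinv_0_lt_compat; lra|]. unfold Rdiv. rewrite Rmult_1_l.
    apply Rinv_lt_contravar; lra. }
  assert (P := pfaff a (c - b) (a - b + 1) (/ t) Hg Hz).
  replace (a - b + 1 - (c - b))%C with (1 - c + a)%C in P by ring.
  replace (1 - b + a)%C with (a - b + 1)%C by ring.
  assert (E1 : RtoC (/ t / (1 + / t)) = RtoC (/ (1 + t))) by (f_equal; field; lra).
  assert (E2 : (/ RtoC (- t))%C = RtoC (- / t)).
  { rewrite <- RtoC_inv by lra. f_equal. field. lra. }
  rewrite E1 in P. rewrite E2, <- P.
  replace (- RtoC (- t))%C with (RtoC t) by (rewrite RtoC_opp; ring).
  assert (EP : Cpower (RtoC (1 + t)) (- a)
     = (Cpower (RtoC t) (- a) * Cpower (RtoC (1 + / t)) (- a))%C).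
  { rewrite <- Cpower_mult_pos by lra. do 2 f_equal. field. lra. }
  rewrite EP. ring.
Qed.

(** * Taylor coefficients of Psi_1 in y and their continuation in X *)

Lemma slit_iff (z : C) : z <> 0 -> Rabs (Arg z) < PI <-> (Im z <> 0 \/ 0 < Re z).
Proof.
  intros Hz. assert (HPI := PI_RGT_0). assert (E := Cexp_CLog z Hz).
  assert (Hm := exp_pos (Re (CLog z))).
  assert (HR : Re z = exp (Re (CLog z)) * cos (Arg z)) by (rewrite <- E at 1; reflexivity).
  assert (HI : Im z = exp (Re (CLog z)) * sin (Arg z)) by (rewrite <- E at 1; reflexivity).
  split.
  - intros H. apply Rabs_def2 in H.
    destruct (Req_dec (Im z) 0) as [H0|H0]; [right|now left].
    assert (Hs : sin (Arg z) = 0) by (rewrite H0 in HI; nra).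
    assert (HA : Arg z = 0).
    { destruct (Rtotal_order (Arg z) 0) as [G|[G|G]]; [|exact G|].
      - assert (sin (Arg z) < 0) by (apply sin_lt_0_var; lra). lra.
      - assert (0 < sin (Arg z)) by (apply sin_gt_0; lra). lra. }
    rewrite HA, cos_0 in HR. lra.
  - intros H. assert (HB := Arg_bound z). destruct HB as [HB|HB]; [exact HB|exfalso].
    assert (HG := Arg_gt z Hz).
    assert (HA : Arg z = PI).
    { unfold Rabs in HB. destruct (Rcase_abs (Arg z)); lra. }
    rewrite HA, cos_PI in HR. rewrite HA, sin_PI in HI. destruct H as [H|H]; nra.
Qed.

Lemma region_slit (X y : C) : X <> 0 -> Rabs (Arg (- X)) < PI -> Psi1_region X y.
Proof.
  intros HX H.
  assert (HX' : (- X)%C <> 0).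
  { intros E. apply HX. replace X with (- - X)%C by ring. rewrite E. ring. }
  apply (slit_iff _ HX') in H.
  assert (E1 : Im (1 - X)%C = Im (- X)%C) by (unfold Im; simpl; ring).
  assert (E2 : Re (1 - X)%C = 1 + Re (- X)%C) by (unfold Re; simpl; ring).
  assert (H1 : (1 - X)%C <> 0).
  { intros E. rewrite E in E1, E2.
    change (0 = Im (- X)%C) in E1. change (0 = 1 + Re (- X)%C) in E2.
    destruct H as [H|H]; [|lra]. apply H. now rewrite <- E1. }
  split.
  - intros E. apply H1. rewrite E. ring.
  - apply slit_iff; [exact H1|]. rewrite E1, E2. destruct H as [H|H]; [now left|right; lra].
Qed.

Lemma summable_columns (u : nat -> nat -> C) (w : C) : w <> 0 ->
  summable2 (fun k j => u k j * w ^ j)%C -> forall j, summable (fun k => u k j).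
Proof.
  intros Hw H j. assert (Hj := summable2_row _ (summable2_sym _ H) j). simpl in Hj.
  apply (summable_scal (/ w ^ j)%C) in Hj. revert Hj. apply summable_ext.
  intros k. field. now apply Cpow_nz.
Qed.

(** At fixed x the double series is a power series in y whose coefficients are
    power series in x. *)
Lemma analytic2_slices (F : C -> C -> C) (x0 y0 : C) : analytic2_at F x0 y0 ->
  exists (p : nat -> nat -> C) (r : R), 0 < r /\
  forall x, Cmod (x - x0) < r ->
    (forall k, summable (fun j => p j k * (x - x0) ^ j)%C) /\
    forall y, Cmod (y - y0) < r ->
      summable (fun k => Cps (fun j => p j k) (x - x0) * (y - y0) ^ k)%C /\
      F x y = Cps (fun k => Cps (fun j => p j k) (x - x0)) (y - y0).
Proof.
  intros [p [r [Hr H]]]. exists p, r. split; [exact Hr|]. intros x Hx.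
  assert (HA : forall y, Cmod (y - y0) < r ->
    summable2 (fun j k => p j k * (x - x0) ^ j * (y - y0) ^ k)%C /\
    F x y = CSeries (fun j => Cps (fun k => p j k * (x - x0) ^ j)%C (y - y0))).
  { intros y Hy. specialize (H x y Hx Hy). apply is_double_series_iff in H.
    destruct H as [H1 H2].
    assert (E : forall j k, (p j k * ((x - x0) ^ j * (y - y0) ^ k)
        = p j k * (x - x0) ^ j * (y - y0) ^ k)%C) by (intros; ring).
    split.
    - destruct H1 as [M HM]. apply summable2_le with (2 := HM).
      intros j k. rewrite E. apply Rle_refl.
    - rewrite H2. apply CSeries_ext. intros j. apply CSeries_ext. intros k. apply E. }
  assert (Hcol : forall k, summable (fun j => p j k * (x - x0) ^ j)%C).
  { apply (summable_columns (fun j k => p j k * (x - x0) ^ j)%C (RtoC (r / 2))).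
    - apply RtoC_neq_0; lra.
    - destruct (HA (y0 + RtoC (r / 2))%C) as [H1 _].
      + replace (y0 + RtoC (r/2) - y0)%C with (RtoC (r/2)) by ring.
        rewrite Cmod_R, Rabs_pos_eq; lra.
      + replace (y0 + RtoC (r/2) - y0)%C with (RtoC (r/2)) in H1 by ring. exact H1. }
  split; [exact Hcol|]. intros y Hy. destruct (HA y Hy) as [H1 H2].
  destruct (Cps_double (fun j k => p j k * (x - x0) ^ j)%C (y - y0) H1 Hcol) as [H3 H4].
  split; [exact H3|]. rewrite H2. exact H4.
Qed.

Lemma analytic1_reflect (f : C -> C) (s z0 : C) :
  analytic1_at f (s - z0) -> analytic1_at (fun z => f (s - z))%C z0.
Proof.
  intros [p [r [Hr H]]]. exists (fun n => p n * (-1) ^ n)%C, r. split; [exact Hr|].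
  intros z Hz.
  assert (E0 : (s - z - (s - z0))%C = (-1 * (z - z0))%C) by ring.
  destruct (H (s - z)%C) as [A E].
  { rewrite E0, Cmod_mult, Cmod_R, Rabs_left by lra. lra. }
  rewrite E0 in A, E.
  assert (En : forall n, (p n * (-1 * (z - z0)) ^ n = p n * (-1) ^ n * (z - z0) ^ n)%C).
  { intros n. rewrite Cpow_mult_l. ring. }
  split.
  - now apply summable_ext with (1 := En).
  - rewrite E. now apply CSeries_ext.
Qed.

Definition frobC (a b c X : C) : C :=
  (Cpower (1 - X) (- a) * hyp a (c - b) (a - b + 1) (/ (1 - X)))%C.

Lemma frobC_real (a b c : C) (t : R) : 0 < t -> frobC a b c (RtoC (- t)) = frob a b c t.
Proof.
  intros Ht. unfold frobC, frob.
  replace (1 - RtoC (- t))%C with (RtoC (1 + t)) by (rewrite RtoC_plus, RtoC_opp; ring).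
  now rewrite RtoC_inv by lra.
Qed.

Lemma analytic1_frobC (a b c : C) (t : R) : not_nonpos_int (a - b + 1)%C -> 1 / 2 <= t ->
  analytic1_at (frobC a b c) (RtoC (- t)).
Proof.
  intros Hg Ht. unfold frobC.
  destruct (hcoef_bound a (c - b) (a - b + 1) (5/4) Hg ltac:(lra)) as [M [HM H]].
  apply (analytic1_reflect (fun z => Cpower z (- a) * hyp a (c - b) (a - b + 1) (/ z))%C 1).
  assert (E : (1 - RtoC (- t))%C = RtoC (1 + t)) by (rewrite RtoC_plus, RtoC_opp; ring).
  rewrite E. apply (analytic1_power_series _ a M (5/4)).
  - exact H.
  - rewrite Cmod_R, Rabs_pos_eq; lra.
  - rewrite Arg_pos, Rabs_R0 by lra. apply PI_RGT_0.
Qed.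

Lemma analytic1_frobX (a b c X : C) : not_nonpos_int (1 - b + a)%C -> 2 < Cmod X ->
  Rabs (Arg (- X)) < PI -> analytic1_at (frobX a b c) X.
Proof.
  intros Hg HX HA.
  destruct (hcoef_bound a (1 - c + a) (1 - b + a) 2 Hg ltac:(lra)) as [M [HM H]].
  set (al := fun n => (hcoef a (1 - c + a) (1 - b + a) n * (-1) ^ n)%C).
  apply (analytic1_ext (fun z => (fun w => Cpower w (- a) * Cps al (/ w)) (0 - z))%C _ _ 1);
    [lra| |].
  - intros z Hz. cbv beta. unfold frobX. replace (0 - z)%C with (- z)%C by ring. f_equal.
    unfold hyp, Cps. apply CSeries_ext. intros n. unfold al.
    assert (Hz0 : z <> 0).
    { apply Cmod_gt_0. assert (T := Cmod_triangle_rev X (X - z)).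
      replace (X - (X - z))%C with z in T by ring. rewrite (Cmod_minus_sym X z) in T. lra. }
    rewrite <- Cmult_assoc, <- Cpow_mult_l. do 2 f_equal. field. exact Hz0.
  - apply (analytic1_reflect (fun w => Cpower w (- a) * Cps al (/ w))%C 0).
    replace (0 - X)%C with (- X)%C by ring.
    apply (analytic1_power_series al a M 2).
    + intros n. unfold al. rewrite Cmod_mult, Cmod_pow, Cmod_R, Rabs_left by lra.
      replace (- -1) with 1 by ring. rewrite pow1, Rmult_1_r. apply H.
    + rewrite Cmod_opp. lra.
    + exact HA.
Qed.

Section Humbert.
Variables (a b c c' : C) (Psi1 : C -> C -> C).
Hypothesis Hc : not_nonpos_int c.
Hypothesis Hc' : not_nonpos_int c'.
Hypothesis Hab : not_int (a - b)%C.
Hypothesis HPsi : is_Psi1 a b c c' Psi1.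

Definition ycoef (k : nat) (X : C) : C := taylor_coef (Psi1 X) k.

Lemma ycoef_analytic (k : nat) (X : C) : Psi1_region X 0 -> analytic1_at (ycoef k) X.
Proof.
  intros HX. destruct (analytic2_slices _ _ _ (proj2 HPsi X 0 HX)) as [p [r [Hr H]]].
  exists (fun j => p j k), r. split; [exact Hr|]. intros Z HZ.
  destruct (H Z HZ) as [HA HF]. split; [apply HA|].
  unfold ycoef.
  apply (taylor_coef_unique _ (fun k => Cps (fun j => p j k) (Z - X)) r k Hr).
  intros y Hy. specialize (HF y). replace (y - 0)%C with y in HF by ring. now apply HF.
Qed.

Lemma ycoef_germ (X : C) : Psi1_region X 0 -> exists r, 0 < r /\
  forall y, Cmod y < r ->
    summable (fun k => ycoef k X * y ^ k)%C /\ Psi1 X y = Cps (fun k => ycoef k X) y.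
Proof.
  intros HX. destruct (analytic2_slices _ _ _ (proj2 HPsi X 0 HX)) as [p [r [Hr H]]].
  exists r. split; [exact Hr|].
  destruct (H X) as [_ HF].
  { replace (X - X)%C with (RtoC 0) by ring. rewrite Cmod_0. exact Hr. }
  assert (E : forall k, ycoef k X = Cps (fun j => p j k) (X - X)).
  { intros k. apply (taylor_coef_unique _ (fun k => Cps (fun j => p j k) (X - X)) r k Hr).
    intros y Hy. specialize (HF y). replace (y - 0)%C with y in HF by ring. now apply HF. }
  intros y Hy. specialize (HF y). replace (y - 0)%C with y in HF by ring.
  destruct (HF Hy) as [H1 H2]. split.
  - revert H1. apply summable_ext. intros k. now rewrite E.
  - rewrite H2. apply CSeries_ext. intros k. now rewrite E.
Qed.

Lemma Psi1_analytic_y (X y : C) : Psi1_region X y -> analytic1_at (Psi1 X) y.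
Proof.
  intros HX. destruct (analytic2_slices _ _ _ (proj2 HPsi X y HX)) as [p [r [Hr H]]].
  destruct (H X) as [_ HF].
  { replace (X - X)%C with (RtoC 0) by ring. rewrite Cmod_0. exact Hr. }
  exists (fun k => Cps (fun j => p j k) (X - X)), r. split; [exact Hr|exact HF].
Qed.

(** The n-th coefficient is [yfac n] times 2F1(a+n, b; c; X). *)
Definition yfac (n : nat) : C := (poch a n / (poch c' n * RtoC (INR (fact n))))%C.

(** Summing the defining series over m first. *)
Lemma ycoef_disc (n : nat) (X : C) : Cmod X < 1 ->
  ycoef n X = (yfac n * hyp (a + RtoC (INR n)) b c X)%C.
Proof.
  intros HX.
  set (u := fun m n => (yfac n * (hcoef (a + RtoC (INR n)) b c m * X ^ m))%C).
  assert (Eu : forall y m n, Psi1_term a b c c' X y m n = (u m n * y ^ n)%C).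
  { intros y m k. unfold Psi1_term, u, yfac, hcoef. rewrite (Nat.add_comm m k), poch_plus.
    field. repeat split; try apply fact_C_neq_0; now apply poch_neq_0. }
  assert (HD : forall y, summable2 (fun m n => u m n * y ^ n)%C /\
     Psi1 X y = CSeries (fun m => Cps (u m) y)).
  { intros y. assert (H := proj1 HPsi X y HX). apply is_double_series_iff in H.
    destruct H as [[M HM] H2]. split.
    - apply summable2_le with (2 := HM). intros i j. rewrite Eu. apply Rle_refl.
    - rewrite H2. apply CSeries_ext. intros m. apply CSeries_ext. intros k. apply Eu. }
  assert (Hcol : forall k, summable (fun m => u m k)).
  { apply (summable_columns u 1); [apply RtoC_neq_0; lra|]. apply (HD 1). }
  assert (Hval : forall k, CSeries (fun m => u m k) = (yfac k * hyp (a + RtoC (INR k)) b c X)%C).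
  { intros k. unfold u. rewrite CSeries_scal; [reflexivity|]. now apply hyp_summable. }
  rewrite <- Hval. apply (taylor_coef_unique _ (fun k => CSeries (fun m => u m k)) 1 n Rlt_0_1).
  intros y _. destruct (HD y) as [H1 H2].
  destruct (Cps_double u y H1 Hcol) as [H3 H4]. split; [exact H3|]. rewrite H2. exact H4.
Qed.

Lemma not_int_an (n : nat) : not_int (a + RtoC (INR n) - b)%C.
Proof.
  replace (a + RtoC (INR n) - b)%C with (a - b + RtoC (IZR (Z.of_nat n)))%C
    by (rewrite <- INR_IZR_INZ; ring).
  now apply not_int_plus.
Qed.

Lemma exponents_generic (n : nat) :
  not_nonpos_int (a + RtoC (INR n) - b + 1)%C /\ not_nonpos_int (b - (a + RtoC (INR n)) + 1)%C.
Proof.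
  split; apply not_nonpos_int_1, not_int_not_nonpos.
  - apply not_int_an.
  - replace (b - (a + RtoC (INR n)))%C with (- (a + RtoC (INR n) - b))%C by ring.
    apply not_int_opp, not_int_an.
Qed.

Definition yexp (n : nat) (X : C) : C :=
  (yfac n * (frakf c b (a + RtoC (INR n)) * frobX (a + RtoC (INR n)) b c X
           + frakf c (a + RtoC (INR n)) b * frobX b (a + RtoC (INR n)) c X))%C.

(** Along the negative axis the continuation is forced by the coincidence on
    the unit disc, where the connection formula applies. *)
Lemma ycoef_negative_axis (n : nat) (T : R) : 8 < T ->
  ycoef n (RtoC (- T)) = yexp n (RtoC (- T)).
Proof.
  intros HT. set (an := (a + RtoC (INR n))%C).
  destruct (exponents_generic n) as [G1 G2]. fold an in G1, G2.
  set (Q := fun X => (yfac n * (frakf c b an * frobC an b c X + frakf c an b * frobC b an c X))%C).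
  set (gam := fun s => RtoC (- (1 / 2 + s * (T - 1 / 2)))).
  assert (HQ : ycoef n (gam 1) = Q (gam 1)).
  { apply (identity_along_path (ycoef n) Q gam (/ (4 * T))).
    - intros t Ht. apply ycoef_analytic. apply region_slit.
      + apply RtoC_neq_0. nra.
      + unfold gam. replace (- RtoC (- (1 / 2 + t * (T - 1 / 2))))%C
          with (RtoC (1 / 2 + t * (T - 1 / 2))) by (rewrite RtoC_opp; ring).
        rewrite Arg_pos, Rabs_R0 by nra. apply PI_RGT_0.
    - intros t Ht. apply analytic1_scal, analytic1_plus; apply analytic1_scal;
        apply analytic1_frobC; try assumption; nra.
    - intros t Ht eps Heps. exists (eps / T). split; [apply Rdiv_lt_0_compat; lra|].
      intros s Hs Hst. unfold gam. rewrite <- RtoC_minus, Cmod_R.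
      replace (- (1 / 2 + s * (T - 1 / 2)) - - (1 / 2 + t * (T - 1 / 2)))
        with (- ((s - t) * (T - 1 / 2))) by ring.
      rewrite Rabs_Ropp, Rabs_mult, (Rabs_pos_eq (T - 1/2)) by lra.
      apply Rle_lt_trans with (Rabs (s - t) * T).
      + apply Rmult_le_compat_l; [apply Rabs_pos|lra].
      + apply Rlt_le_trans with (eps / T * T); [apply Rmult_lt_compat_r; lra|].
        right; field; lra.
    - intros s t Hst Ht E. apply RtoC_inj in E. nra.
    - apply Rinv_0_lt_compat; lra.
    - intros t Ht _. unfold gam.
      assert (HtT : t * T <= 1 / 4).
      { apply Rle_trans with (/ (4 * T) * T); [apply Rmult_le_compat_r; lra|].
        right; field; lra. }
      set (s := 1 / 2 + t * (T - 1 / 2)).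
      assert (Hs : 0 < s < 1) by (unfold s; nra).
      rewrite ycoef_disc by (rewrite Cmod_R, Rabs_Ropp, Rabs_pos_eq; lra).
      unfold Q. rewrite !frobC_real by lra. f_equal.
      apply connection; [apply not_int_an|exact Hc|exact Hs]. }
  assert (E1 : gam 1 = RtoC (- T)) by (unfold gam; f_equal; field).
  rewrite E1 in HQ. rewrite HQ. unfold Q, yexp. fold an.
  rewrite !frobC_real by lra. rewrite !frob_frobX by assumption. reflexivity.
Qed.

Lemma yexp_analytic (n : nat) (X : C) : 2 < Cmod X -> Rabs (Arg (- X)) < PI ->
  analytic1_at (yexp n) X.
Proof.
  intros HX HA. destruct (exponents_generic n) as [G1 G2].
  apply analytic1_scal, analytic1_plus; apply analytic1_scal; apply analytic1_frobX;
    try assumption.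
  - replace (1 - b + (a + RtoC (INR n)))%C with (a + RtoC (INR n) - b + 1)%C by ring.
    exact G1.
  - replace (1 - (a + RtoC (INR n)) + b)%C with (b - (a + RtoC (INR n)) + 1)%C by ring.
    exact G2.
Qed.

(** From the negative axis to an arbitrary argument, along the circle. *)
Lemma ycoef_infinity (n : nat) (X : C) : 8 < Cmod X -> Rabs (Arg (- X)) < PI ->
  ycoef n X = yexp n X.
Proof.
  intros HX HA. set (T := Cmod X) in *. set (th := Arg (- X)) in *.
  assert (HX0 : X <> 0) by (apply Cmod_gt_0; fold T; lra).
  assert (HmX0 : (- X)%C <> 0).
  { intros E. apply HX0. replace X with (- - X)%C by ring. rewrite E. ring. }
  set (cir := fun s : R => Cexp (ln T, s * th)).
  set (gam := fun s : R => (- cir s)%C).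
  assert (HT : exp (ln T) = T) by (apply exp_ln; lra).
  assert (Hmod : forall s, Cmod (gam s) = T).
  { intros s. unfold gam, cir. rewrite Cmod_opp, Cmod_Cexp. exact HT. }
  assert (Hth : forall s, 0 <= s <= 1 -> Rabs (s * th) < PI).
  { intros s Hs. rewrite Rabs_mult, (Rabs_pos_eq s) by lra. assert (H0 := Rabs_pos th). nra. }
  assert (HLog : forall s, 0 <= s <= 1 -> CLog (cir s) = (ln T, s * th)).
  { intros s Hs. apply CLog_Cexp. simpl. assert (H1 := Hth s Hs). apply Rabs_def2 in H1. lra. }
  assert (Hnn : forall s, (- gam s)%C = cir s) by (intros; unfold gam; ring).
  assert (HArg : forall s, 0 <= s <= 1 -> Rabs (Arg (- gam s)) < PI).
  { intros s Hs. rewrite Hnn. change (Arg (cir s)) with (Im (CLog (cir s))).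
    rewrite HLog by exact Hs. now apply Hth. }
  assert (Hreg : forall s, 0 <= s <= 1 -> Psi1_region (gam s) 0).
  { intros s Hs. apply region_slit; [|now apply HArg].
    apply Cmod_gt_0. rewrite Hmod. lra. }
  assert (Hg0 : gam 0 = RtoC (- T)).
  { unfold gam, cir. rewrite Rmult_0_l. unfold Cexp. simpl. rewrite HT, cos_0, sin_0.
    apply C_eq; simpl; ring. }
  assert (Hg1 : gam 1 = X).
  { unfold gam, cir. rewrite Rmult_1_l.
    replace (ln T, th) with (CLog (- X)) by (unfold CLog, T, th; now rewrite Cmod_opp).
    rewrite Cexp_CLog by exact HmX0. ring. }
  assert (Hcont : forall t, forall eps, 0 < eps -> exists d, 0 < d /\
     forall s, Rabs (s - t) < d -> Cmod (gam s - gam t) < eps).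
  { intros t eps Heps.
    assert (HD : is_Cderive gam t (- ((0, th) * cir t))%C).
    { apply Cderive_opp, Cderive_Cexp. split; simpl.
      - apply (is_derive_const (V := R_NormedModule)).
      - auto_derive; [exact I|ring]. }
    destruct (Cderive_Clim _ _ _ HD eps Heps) as [d Hd]. exists d. split; [apply cond_pos|].
    intros s Hs. apply Hd. exact Hs. }
  (* near the negative axis the two functions agree on a whole disc *)
  destruct (analytic1_coincide (ycoef n) (yexp n) (gam 0)) as [r [Hr Hloc]].
  { apply ycoef_analytic, Hreg. lra. }
  { apply yexp_analytic; [rewrite Hmod; lra|apply HArg; lra]. }
  { intros eps Heps. exists (RtoC (- (T + eps / 2))). split.
    - rewrite Hg0, <- RtoC_minus, Cmod_R.
      replace (- (T + eps / 2) - - T) with (- (eps / 2)) by ring.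
      rewrite Rabs_Ropp, Rabs_pos_eq; lra.
    - apply ycoef_negative_axis. lra. }
  destruct (Req_dec th 0) as [H0|H0].
  { rewrite <- Hg1. apply Hloc. replace (gam 1) with (gam 0).
    - replace (gam 0 - gam 0)%C with (RtoC 0) by ring. now rewrite Cmod_0.
    - unfold gam, cir. rewrite H0. now rewrite !Rmult_0_r. }
  rewrite <- Hg1. destruct (Hcont 0 r Hr) as [d [Hd Hdr]].
  apply (identity_along_path (ycoef n) (yexp n) gam (d / 2)).
  - intros t Ht. now apply ycoef_analytic, Hreg.
  - intros t Ht. apply yexp_analytic; [rewrite Hmod; lra|now apply HArg].
  - intros t Ht eps Heps. destruct (Hcont t eps Heps) as [d' [Hd' H]].
    exists d'. split; [exact Hd'|]. intros s _. apply H.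
  - intros s t Hst Ht E.
    assert (E2 : cir s = cir t) by (rewrite <- !Hnn, E; reflexivity).
    assert (E3 := HLog s ltac:(lra)). rewrite E2, (HLog t) in E3 by lra.
    injection E3 as E3. assert (Hz : (t - s) * th = 0) by lra.
    apply Rmult_integral in Hz. destruct Hz; lra.
  - lra.
  - intros t Ht _. apply Hloc, Hdr. rewrite Rminus_0_r, Rabs_pos_eq; lra.
Qed.
End Humbert.

(** * The double series at infinity *)

(** With [s = 0] and [s = a - b] these are the coefficients of X^(-K) y^l in the
    two expansions, apart from the prefactors. *)
Definition dcoef (s al be ga c' : C) (K l : nat) : C :=
  (bin (s - RtoC (INR K)) l * hcoef al be ga K / poch c' l)%C.

Lemma dcoef_bound (s al be ga c' : C) : not_nonpos_int ga -> not_nonpos_int c' ->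
  exists M, 0 < M /\ forall K l, Cmod (dcoef s al be ga c' K l) <= M * 4 ^ K * 4 ^ l.
Proof.
  intros Hg Hc'.
  destruct (hcoef_bound al be ga 2 Hg ltac:(lra)) as [M1 [HM1 H1]].
  destruct (poch_ratio 1 c' 2 Hc' ltac:(lra)) as [M2 [HM2 H2]].
  destruct (exists_nat_ge (Cmod s)) as [A HA].
  assert (P2 : 0 < 2 ^ A) by (apply pow_lt; lra).
  exists (2 ^ A * M1 * M2). split; [now repeat apply Rmult_lt_0_compat|].
  intros K l. unfold dcoef, Cdiv. rewrite Cmod_mult, Cmod_mult.
  assert (B1 : Cmod (bin (s - RtoC (INR K)) l) <= 2 ^ A * 2 ^ K * 2 ^ l).
  { rewrite <- pow_add. apply bin_le_pow2. rewrite plus_INR.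
    eapply Rle_trans; [apply Cmod_triangle|].
    rewrite Cmod_opp, Cmod_R, (Rabs_pos_eq (INR K)) by apply pos_INR. lra. }
  assert (B2 : Cmod (/ poch c' l) <= M2 * 2 ^ l).
  { apply Rle_trans with (2 := H2 l). rewrite poch_1. unfold Cdiv. rewrite Cmod_mult.
    rewrite <- (Rmult_1_l (Cmod (/ poch c' l))) at 1.
    apply Rmult_le_compat_r; [apply Cmod_ge_0|].
    rewrite Cmod_R, Rabs_pos_eq by apply pos_INR.
    apply (le_INR 1). apply lt_O_fact. }
  specialize (H1 K).
  replace (2 ^ A * M1 * M2 * 4 ^ K * 4 ^ l)
    with ((2 ^ A * 2 ^ K * 2 ^ l * (M1 * 2 ^ K)) * (M2 * 2 ^ l)).
  - apply Rmult_le_compat; try apply Cmod_ge_0; [| |exact B2].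
    + apply Rmult_le_pos; apply Cmod_ge_0.
    + apply Rmult_le_compat; try apply Cmod_ge_0; assumption.
  - replace 4 with (2 * 2) by ring. rewrite !Rpow_mult_distr. ring.
Qed.

Lemma poch_reflect (z : C) (n : nat) :
  poch (z - RtoC (INR n)) n = ((-1) ^ n * poch (1 - z) n)%C.
Proof.
  induction n as [|n IH].
  - simpl. ring.
  - rewrite poch_S_l, poch_S, Cpow_S, S_INR, RtoC_plus.
    replace (z - (RtoC (INR n) + 1) + 1)%C with (z - RtoC (INR n))%C by ring.
    rewrite IH. ring.
Qed.

(** For the first expansion (-K)_n / K! reduces to (-1)^n / (K-n)!. *)
Lemma poch_neg_int (n k : nat) :
  (poch (0 - RtoC (INR (n + k))) n * RtoC (INR (fact k)))%C
  = ((-1) ^ n * RtoC (INR (fact (n + k))))%C.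
Proof.
  induction n as [|n IH].
  - simpl. ring.
  - rewrite poch_S_l. simpl (S n + k)%nat. rewrite fact_S_C, S_INR, RtoC_plus, Cpow_S.
    replace (0 - (RtoC (INR (n + k)) + 1) + 1)%C with (0 - RtoC (INR (n + k)))%C by ring.
    replace ((0 - (RtoC (INR (n + k)) + 1)) * poch (0 - RtoC (INR (n + k))) n
       * RtoC (INR (fact k)))%C with ((0 - (RtoC (INR (n + k)) + 1)) *
       (poch (0 - RtoC (INR (n + k))) n * RtoC (INR (fact k))))%C by ring.
    rewrite IH. ring.
Qed.

Lemma poch_neg_int_0 (K n : nat) : (K < n)%nat -> poch (0 - RtoC (INR K)) n = 0.
Proof.
  intros H. replace n with (S K + (n - S K))%nat by lia.
  rewrite poch_plus, poch_S. ring.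
Qed.

Lemma rGamma_sub (z : C) (n : nat) :
  rGamma (z - RtoC (INR n)) = ((-1) ^ n * poch (1 - z) n * rGamma z)%C.
Proof.
  rewrite (rGamma_poch _ n), poch_reflect. do 2 f_equal. ring.
Qed.

Lemma Cpow_m1_sqr (n : nat) : ((-1) ^ n * (-1) ^ n)%C = 1.
Proof.
  rewrite <- Cpow_mult_l. replace (-1 * -1)%C with (RtoC 1) by ring. apply Cpow_1_l.
Qed.

Section Coefficients.
Variables a b c c' : C.
Hypothesis Hc : not_nonpos_int c.
Hypothesis Hc' : not_nonpos_int c'.
Hypothesis Hab : not_int (a - b)%C.

Lemma not_int_ba : not_int (b - a)%C.
Proof.
  replace (b - a)%C with (- (a - b))%C by ring. now apply not_int_opp.
Qed.

Lemma first_denominator : not_nonpos_int (1 - b + a)%C.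
Proof.
  replace (1 - b + a)%C with (a - b + 1)%C by ring.
  now apply not_nonpos_int_1, not_int_not_nonpos.
Qed.

Lemma second_denominator : not_nonpos_int (1 - a + b)%C.
Proof.
  replace (1 - a + b)%C with (b - a + 1)%C by ring.
  apply not_nonpos_int_1, not_int_not_nonpos, not_int_ba.
Qed.

Lemma first_gamma (n : nat) :
  frakf c b (a + RtoC (INR n)) = (frakf c b a * (poch (1 - c + a) n / poch (1 - b + a) n))%C.
Proof.
  unfold frakf, Gamma.
  replace (b - (a + RtoC (INR n)))%C with (b - a - RtoC (INR n))%C by ring.
  replace (c - (a + RtoC (INR n)))%C with (c - a - RtoC (INR n))%C by ring.
  rewrite !rGamma_sub.
  replace (1 - (b - a))%C with (1 - b + a)%C by ring.
  replace (1 - (c - a))%C with (1 - c + a)%C by ring.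
  assert (N1 := rGamma_neq_0 _ (not_int_not_nonpos _ not_int_ba)).
  assert (N2 := poch_neq_0 _ n first_denominator). assert (N3 := rGamma_neq_0 _ Hc).
  assert (N4 : ((-1) ^ n)%C <> 0).
  { apply Cpow_nz. apply RtoC_neq_0. lra. }
  field. repeat split; assumption.
Qed.

Lemma second_gamma (n : nat) :
  (poch a n * frakf c (a + RtoC (INR n)) b)%C = (frakf c a b * poch (a - b) n)%C.
Proof.
  unfold frakf, Gamma. rewrite (rGamma_poch a n), (rGamma_poch (a - b) n).
  replace (a + RtoC (INR n) - b)%C with (a - b + RtoC (INR n))%C by ring.
  assert (N1 := rGamma_neq_0 _ (not_nonpos_int_shift _ n (not_int_not_nonpos _ Hab))).
  assert (N2 := poch_neq_0 _ n (not_int_not_nonpos _ Hab)).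
  assert (N3 := rGamma_neq_0 _ Hc).
  field. repeat split; assumption.
Qed.

Lemma first_coef (n k : nat) :
  (yfac a c' n * frakf c b (a + RtoC (INR n)) * (-1) ^ n
   * hcoef (a + RtoC (INR n)) (1 - c + (a + RtoC (INR n))) (1 - b + (a + RtoC (INR n))) k)%C
  = (frakf c b a * dcoef 0 a (1 - c + a) (1 - b + a) c' (n + k) n)%C.
Proof.
  rewrite first_gamma. unfold yfac, dcoef, hcoef, bin. rewrite !poch_plus.
  replace (1 - c + (a + RtoC (INR n)))%C with (1 - c + a + RtoC (INR n))%C by ring.
  replace (1 - b + (a + RtoC (INR n)))%C with (1 - b + a + RtoC (INR n))%C by ring.
  assert (F := poch_neg_int n k).
  assert (N1 := fact_C_neq_0 n). assert (N2 := fact_C_neq_0 k).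
  assert (N3 := fact_C_neq_0 (n + k)).
  assert (N4 := poch_neq_0 _ n Hc'). assert (N5 := poch_neq_0 _ n first_denominator).
  assert (N6 := poch_neq_0 _ k (not_nonpos_int_shift _ n first_denominator)).
  assert (F2 : poch (0 - RtoC (INR (n + k))) n
     = ((-1) ^ n * RtoC (INR (fact (n + k))) / RtoC (INR (fact k)))%C).
  { rewrite <- F. field. exact N2. }
  rewrite F2. field. repeat split; assumption.
Qed.

Lemma second_coef (n k : nat) :
  (yfac a c' n * frakf c (a + RtoC (INR n)) b
   * hcoef b (1 - c + b) (1 - (a + RtoC (INR n)) + b) k)%C
  = (frakf c a b * dcoef (a - b) b (1 - c + b) (1 - a + b) c' k n)%C.
Proof.
  assert (S2 := second_gamma n).
  assert (N1 := fact_C_neq_0 n). assert (N2 := fact_C_neq_0 k).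
  assert (N4 := poch_neq_0 _ n Hc'). assert (N5 := poch_neq_0 _ k second_denominator).
  assert (G3 : not_nonpos_int (1 - (a + RtoC (INR n)) + b)%C).
  { replace (1 - (a + RtoC (INR n)) + b)%C with (b - (a + RtoC (INR n)) + 1)%C by ring.
    now apply (exponents_generic a b Hab n). }
  assert (N6 := poch_neq_0 _ k G3).
  (* up to the sign (-1)^k both sides are (a-b-k)_(n+k) *)
  assert (E : (poch (a - b) n * poch (1 - a + b) k)%C
     = (poch (a - b - RtoC (INR k)) n * poch (1 - (a + RtoC (INR n)) + b) k)%C).
  { assert (E1 := poch_plus (a - b - RtoC (INR k)) k n).
    assert (E2 := poch_plus (a - b - RtoC (INR k)) n k).
    rewrite (Nat.add_comm n k), E1 in E2.
    replace (a - b - RtoC (INR k) + RtoC (INR k))%C with (a - b)%C in E2 by ring.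
    replace (a - b - RtoC (INR k) + RtoC (INR n))%C
      with (a - b + RtoC (INR n) - RtoC (INR k))%C in E2 by ring.
    rewrite (poch_reflect (a - b) k), (poch_reflect (a - b + RtoC (INR n)) k) in E2.
    replace (1 - (a - b))%C with (1 - a + b)%C in E2 by ring.
    replace (1 - (a - b + RtoC (INR n)))%C with (1 - (a + RtoC (INR n)) + b)%C in E2 by ring.
    set (sg := ((-1) ^ k)%C) in *. assert (Hsg : (sg * sg)%C = 1) by apply Cpow_m1_sqr.
    transitivity (sg * (sg * poch (1 - a + b) k * poch (a - b) n))%C.
    { transitivity (sg * sg * (poch (1 - a + b) k * poch (a - b) n))%C; [rewrite Hsg|]; ring. }
    rewrite E2.
    transitivity (sg * sg * (poch (a - b - RtoC (INR k)) n
       * poch (1 - (a + RtoC (INR n)) + b) k))%C; [ring|rewrite Hsg; ring]. }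
  unfold yfac, dcoef, hcoef, bin.
  set (fr := frakf c (a + RtoC (INR n)) b) in *.
  set (q := poch (1 - (a + RtoC (INR n)) + b) k) in *.
  transitivity ((poch a n * fr) * (poch b k * poch (1 - c + b) k)
     / (poch c' n * RtoC (INR (fact n)) * (q * RtoC (INR (fact k)))))%C.
  { field. repeat split; assumption. }
  rewrite S2.
  assert (E3 : (poch (a - b) n / q)%C
     = (poch (a - b - RtoC (INR k)) n / poch (1 - a + b) k)%C).
  { transitivity ((poch (a - b) n * poch (1 - a + b) k) / (q * poch (1 - a + b) k))%C.
    - field. now split.
    - rewrite E. field. now split. }
  transitivity (frakf c a b * (poch (a - b) n / q) * (poch b k * poch (1 - c + b) k)
     / (poch c' n * RtoC (INR (fact n)) * RtoC (INR (fact k))))%C.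
  { field. repeat split; assumption. }
  rewrite E3. field. repeat split; assumption.
Qed.

Lemma coef1_dcoef (x : C) (m : nat) : x <> 0 ->
  coef1 a b c c' x m
  = sum_n (fun k => dcoef 0 a (1 - c + a) (1 - b + a) c' k (m - k) * (/ x) ^ k)%C m.
Proof.
  intros Hx. unfold coef1. apply sum_n_C_ext. intros k Hk. cbv zeta.
  unfold dcoef, hcoef, bin. rewrite Cpow_inv by exact Hx.
  replace (0 - RtoC (INR k))%C with (- RtoC (INR k))%C by ring.
  assert (N1 := poch_neq_0 _ (m - k) Hc'). assert (N2 := poch_neq_0 _ k first_denominator).
  field. repeat split; try apply fact_C_neq_0; try assumption. now apply Cpow_nz.
Qed.

Lemma coef2_dcoef (x : C) (m : nat) : x <> 0 ->
  coef2 a b c c' x m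
  = sum_n (fun k => dcoef (a - b) b (1 - c + b) (1 - a + b) c' k (m - k) * (/ x) ^ k)%C m.
Proof.
  intros Hx. unfold coef2. apply sum_n_C_ext. intros k Hk. cbv zeta.
  unfold dcoef, hcoef, bin. rewrite Cpow_inv by exact Hx.
  assert (N1 := poch_neq_0 _ (m - k) Hc'). assert (N2 := poch_neq_0 _ k second_denominator).
  field. repeat split; try apply fact_C_neq_0; try assumption. now apply Cpow_nz.
Qed.

(** The sum over n of the connected Taylor coefficients is, for each exponent,
    one double series in 1/X and y. *)
Lemma yexp_split (n : nat) (X : C) : 8 < Cmod X ->
  yexp a b c c' n X
  = (frakf c b a * Cpower (- X) (- a)
       * Cps (fun K => dcoef 0 a (1 - c + a) (1 - b + a) c' K n) (/ X)
     + frakf c a b * Cpower (- X) (- b)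
       * Cps (fun K => dcoef (a - b) b (1 - c + b) (1 - a + b) c' K n) (/ X))%C.
Proof.
  intros HX.
  assert (HX0 : X <> 0) by (apply Cmod_gt_0; lra).
  assert (HmX0 : (- X)%C <> 0).
  { intros E. apply HX0. replace X with (- - X)%C by ring. rewrite E. ring. }
  assert (HiX : Cmod (/ X) < 1 / 8).
  { rewrite Cmod_inv by exact HX0. unfold Rdiv. rewrite Rmult_1_l.
    apply Rinv_lt_contravar; lra. }
  set (an := (a + RtoC (INR n))%C).
  assert (Gn : not_nonpos_int (1 - b + an)%C).
  { unfold an. replace (1 - b + (a + RtoC (INR n)))%C with (1 - b + a + RtoC (INR n))%C by ring.
    apply not_nonpos_int_shift, first_denominator. }
  assert (Gn' : not_nonpos_int (1 - an + b)%C).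
  { replace (1 - an + b)%C with (b - an + 1)%C by ring.
    now apply (exponents_generic a b Hab n). }
  unfold yexp. fold an. rewrite Cmult_plus_distr_l. f_equal.
  - set (d := fun K => dcoef 0 a (1 - c + a) (1 - b + a) c' K n).
    set (hh := fun k => (hcoef an (1 - c + an) (1 - b + an) k * (/ X) ^ k)%C).
    assert (Ah : summable hh) by (apply hyp_summable; [exact Gn|lra]).
    assert (Ek : forall k, (yfac a c' n * frakf c b an * (-1) ^ n * (/ X) ^ n * hh k)%C
       = (frakf c b a * (d (n + k)%nat * (/ X) ^ (n + k)))%C).
    { intros k. unfold hh, d. rewrite Cpow_add_r.
      transitivity ((yfac a c' n * frakf c b an * (-1) ^ n
         * hcoef an (1 - c + an) (1 - b + an) k) * ((/ X) ^ n * (/ X) ^ k))%C; [ring|].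
      unfold an. rewrite first_coef. ring. }
    destruct (dcoef_bound 0 a (1 - c + a) (1 - b + a) c' first_denominator Hc') as [M [HM HB]].
    assert (Ad : summable (fun K => d K * (/ X) ^ K)%C).
    { apply (summable_pow_geom d (M * 4 ^ n) 4); [lra| |lra].
      intros K. unfold d. eapply Rle_trans; [apply HB|]. right. ring. }
    assert (Ads : summable (fun k => d (n + k)%nat * (/ X) ^ (n + k))%C).
    { apply (ex_series_incr_n (V := R_NormedModule) (fun K => Cmod (d K * (/ X) ^ K)) n).
      exact Ad. }
    assert (Hsum : (yfac a c' n * frakf c b an * (-1) ^ n * (/ X) ^ n * CSeries hh)%C
       = (frakf c b a * Cps d (/ X))%C).
    { rewrite <- CSeries_scal by exact Ah. rewrite (CSeries_ext _ _ Ek).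
      rewrite CSeries_scal by exact Ads. f_equal. unfold Cps.
      symmetry. apply (CSeries_shift (fun K => d K * (/ X) ^ K)%C); [|exact Ads].
      intros K HK. unfold d, dcoef, bin. rewrite poch_neg_int_0 by exact HK.
      unfold Cdiv. ring. }
    unfold frobX.
    replace (- an)%C with (- a - RtoC (INR n))%C by (unfold an; ring).
    rewrite Cpower_minus_INR by exact HmX0.
    replace (/ - X)%C with (-1 * / X)%C by (field; exact HX0).
    rewrite Cpow_mult_l. change (hyp an (1 - c + an) (1 - b + an) (/ X)) with (CSeries hh).
    transitivity (Cpower (- X) (- a) *
      (yfac a c' n * frakf c b an * (-1) ^ n * (/ X) ^ n * CSeries hh))%C; [ring|].
    rewrite Hsum. ring.
  - unfold frobX, hyp, Cps.
    assert (Ah : summable (fun k => hcoef b (1 - c + b) (1 - an + b) k * (/ X) ^ k)%C)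
      by (apply hyp_summable; [exact Gn'|lra]).
    destruct (dcoef_bound (a - b) b (1 - c + b) (1 - a + b) c' second_denominator Hc') as [M [HM HB]].
    assert (Ad : summable (fun K => dcoef (a - b) b (1 - c + b) (1 - a + b) c' K n * (/ X) ^ K)%C).
    { apply (summable_pow_geom _ (M * 4 ^ n) 4); [lra| |lra].
      intros K. eapply Rle_trans; [apply HB|]. right. ring. }
    transitivity (Cpower (- X) (- b) * (yfac a c' n * frakf c an b
      * CSeries (fun k => hcoef b (1 - c + b) (1 - an + b) k * (/ X) ^ k)))%C; [ring|].
    transitivity (Cpower (- X) (- b) * (frakf c a b
      * CSeries (fun K => dcoef (a - b) b (1 - c + b) (1 - a + b) c' K n * (/ X) ^ K)))%C; [|ring].
    f_equal. rewrite <- !CSeries_scal by assumption. apply CSeries_ext. intros k.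
    transitivity ((yfac a c' n * frakf c an b * hcoef b (1 - c + b) (1 - an + b) k)
      * (/ X) ^ k)%C; [ring|]. unfold an. rewrite second_coef. ring.
Qed.
End Coefficients.

(** Re-indexing a double series in 1/X = y/x and y by total degree in y. *)
Lemma antidiagonal_sum (e : nat -> nat -> C) (M : R) (x y : C) : 0 <= M -> x <> 0 ->
  (forall K l, Cmod (e K l) <= M * 4 ^ K * 4 ^ l) ->
  4 * (1 + 2 / Cmod x) * Cmod y < 1 ->
  summable (fun m => sum_n (fun k => e k (m - k)%nat * (/ x) ^ k)%C m * y ^ m)%C /\
  CSeries (fun K => Cps (fun l => e K l * (y / x) ^ K)%C y)
  = Cps (fun m => sum_n (fun k => e k (m - k)%nat * (/ x) ^ k)%C m) y.
Proof.
  intros HM Hx He Hy.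
  assert (Hx0 : 0 < Cmod x) by now apply Cmod_gt_0.
  assert (Hy0 := Cmod_ge_0 y).
  set (X2 := 2 / Cmod x) in *.
  assert (HX2 : 0 < X2) by (apply Rdiv_lt_0_compat; lra).
  set (w := fun K m => (if le_lt_dec K m then e K (m - K)%nat * (/ x) ^ K else RtoC 0)%C).
  assert (HD : summable2 (fun K m => w K m * y ^ m)%C).
  { apply (summable2_geom _ M (1/2) (4 * (1 + X2) * Cmod y)); [lra|split; [|exact Hy]|].
    { repeat apply Rmult_le_pos; lra. }
    intros K m. unfold w. destruct (le_lt_dec K m) as [Hk|Hk].
    2:{ rewrite Cmult_0_l, Cmod_0. repeat apply Rmult_le_pos; try apply pow_le; try lra.
        repeat apply Rmult_le_pos; lra. }
    rewrite !Cmod_mult, !Cmod_pow, Cmod_inv by exact Hx.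
    apply Rle_trans with (M * 4 ^ K * 4 ^ (m - K) * (/ Cmod x) ^ K * Cmod y ^ m).
    { apply Rmult_le_compat_r; [now apply pow_le|]. apply Rmult_le_compat_r; [|apply He].
      apply pow_le. left. now apply Rinv_0_lt_compat. }
    rewrite !Rpow_mult_distr.
    replace (M * 4 ^ K * 4 ^ (m - K)) with (M * 4 ^ m)
      by (rewrite Rmult_assoc, <- pow_add; do 2 f_equal; lia).
    replace ((/ Cmod x) ^ K) with ((1/2) ^ K * X2 ^ K)
      by (rewrite <- Rpow_mult_distr; f_equal; unfold X2; field; lra).
    replace (M * 4 ^ m * ((1 / 2) ^ K * X2 ^ K) * Cmod y ^ m)
      with (M * (1/2) ^ K * (4 ^ m * Cmod y ^ m) * X2 ^ K) by ring.
    replace (M * (1 / 2) ^ K * (4 ^ m * (1 + X2) ^ m * Cmod y ^ m))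
      with (M * (1/2) ^ K * (4 ^ m * Cmod y ^ m) * (1 + X2) ^ m) by ring.
    apply Rmult_le_compat_l.
    { repeat apply Rmult_le_pos; try apply pow_le; lra. }
    apply Rle_trans with ((1 + X2) ^ K).
    - apply pow_incr; lra.
    - apply Rle_pow; [lra|exact Hk]. }
  assert (Hcol : forall m, summable (fun K => w K m)).
  { intros m. apply summable_finite with m. intros K HK. unfold w.
    destruct (le_lt_dec K m); [lia|reflexivity]. }
  assert (Hval : forall m, CSeries (fun K => w K m)
     = sum_n (fun k => e k (m - k)%nat * (/ x) ^ k)%C m).
  { intros m. rewrite (CSeries_finite _ m).
    - apply sum_n_C_ext. intros k Hk. unfold w. destruct (le_lt_dec k m); [reflexivity|lia].
    - intros K HK. unfold w. destruct (le_lt_dec K m); [lia|reflexivity]. }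
  destruct (Cps_double w y HD Hcol) as [H1 H2]. split.
  - revert H1. apply summable_ext. intros m. now rewrite Hval.
  - transitivity (CSeries (fun K => Cps (w K) y)).
    + apply CSeries_ext. intros K. unfold Cps.
      assert (El : forall l, (w K (K + l)%nat * y ^ (K + l))%C = (e K l * (y / x) ^ K * y ^ l)%C).
      { intros l. unfold w. destruct (le_lt_dec K (K + l)); [|lia].
        replace (K + l - K)%nat with l by lia. unfold Cdiv.
        rewrite Cpow_add_r, Cpow_mult_l. ring. }
      rewrite (CSeries_shift (fun m => w K m * y ^ m)%C K).
      * symmetry. apply CSeries_ext, El.
      * intros m Hm. unfold w. destruct (le_lt_dec K m); [lia|ring].
      * assert (HR := summable2_row _ HD K). simpl in HR.
        apply (ex_series_incr_n (V := R_NormedModule) (fun m => Cmod (w K m * y ^ m)) K).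
        exact HR.
    + rewrite H2. apply CSeries_ext. intros m. now rewrite Hval.
Qed.

(** Splitting off one coefficient at a time divides the remainder by y. *)
Lemma Cps_tail (p : nat -> C) (w : C) (N : nat) : w <> 0 -> (0 < N)%nat ->
  summable (fun n => p n * w ^ n)%C ->
  exists B, 0 <= B /\ forall y, Cmod y <= Cmod w ->
    Cmod (Cps p y - sum_n (fun m => p m * y ^ m)%C (pred N)) <= B * Cmod y ^ N.
Proof.
  intros Hw HN. destruct N as [|N]; [lia|]. clear HN. simpl pred. revert p.
  induction N as [|N IH]; intros p Hp.
  - destruct (Cps_near_0 p w Hw Hp) as [B [HB H]]. exists B. split; [exact HB|].
    intros y Hy. rewrite sum_O. simpl. rewrite !Rmult_1_r, Cmult_1_r. now apply H.
  - assert (Hp' := summable_pow_shift p w Hw Hp).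
    destruct (IH _ Hp') as [B [HB H]]. exists B. split; [exact HB|].
    intros y Hy. rewrite Cps_shift by now apply summable_pow_le with w.
    rewrite sum_n_C_first.
    rewrite (sum_n_C_ext _ (fun k => y * (p (S k) * y ^ k))%C)
      by (intros; rewrite Cpow_S; ring).
    rewrite sum_n_Cscal.
    set (s := sum_n (fun k => p (S k) * y ^ k)%C N) in *.
    specialize (H y Hy). fold s in H.
    set (g := Cps (fun n => p (S n)) y) in *.
    replace (p 0%nat + y * g - (p 0%nat * y ^ 0 + y * s))%C with (y * (g - s))%C
      by (simpl; ring).
    rewrite Cmod_mult. change (Cmod y ^ S (S N)) with (Cmod y * Cmod y ^ S N).
    assert (Hy0 := Cmod_ge_0 y). nra.
Qed.

Section Expansion.
Variables (a b c c' : C) (Psi1 : C -> C -> C).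
Hypothesis Hc : not_nonpos_int c.
Hypothesis Hc' : not_nonpos_int c'.
Hypothesis Hab : not_int (a - b)%C.
Hypothesis HPsi : is_Psi1 a b c c' Psi1.

(** For fixed large X the Taylor series in y, which a priori represents Psi_1
    only near y = 0, does so on the fixed disc where it converges. *)
Lemma Psi1_taylor (X y : C) : 8 < Cmod X -> Rabs (Arg (- X)) < PI -> 0 < Cmod y < 1 / 4 ->
  Psi1 X y
  = (frakf c b a * Cpower (- X) (- a) * CSeries (fun K =>
       Cps (fun l => dcoef 0 a (1 - c + a) (1 - b + a) c' K l * (/ X) ^ K)%C y)
     + frakf c a b * Cpower (- X) (- b) * CSeries (fun K =>
       Cps (fun l => dcoef (a - b) b (1 - c + b) (1 - a + b) c' K l * (/ X) ^ K)%C y))%C.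
Proof.
  intros HX HA Hy.
  assert (HX0 : X <> 0) by (apply Cmod_gt_0; lra).
  assert (HiX : Cmod (/ X) < 1 / 8).
  { rewrite Cmod_inv by exact HX0. unfold Rdiv. rewrite Rmult_1_l.
    apply Rinv_lt_contravar; lra. }
  assert (HiX0 := Cmod_ge_0 (/ X)).
  assert (Hdouble : forall (e : nat -> nat -> C) (z : C), Cmod z < 1 / 4 ->
    (exists M, 0 < M /\ forall K l, Cmod (e K l) <= M * 4 ^ K * 4 ^ l) ->
    summable (fun l => Cps (fun K => e K l) (/ X) * z ^ l)%C /\
    CSeries (fun K => Cps (fun l => e K l * (/ X) ^ K)%C z)
    = Cps (fun l => Cps (fun K => e K l) (/ X)) z).
  { intros e z Hz [M [HM HB]]. assert (Hz0 := Cmod_ge_0 z).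
    apply (Cps_double (fun K l => e K l * (/ X) ^ K)%C z).
    - apply (summable2_geom _ M (4 * Cmod (/ X)) (4 * Cmod z)); [lra|lra|].
      intros K l. rewrite !Cmod_mult, !Cmod_pow, !Rpow_mult_distr.
      replace (M * (4 ^ K * Cmod (/ X) ^ K) * (4 ^ l * Cmod z ^ l))
        with (M * 4 ^ K * 4 ^ l * Cmod (/ X) ^ K * Cmod z ^ l) by ring.
      apply Rmult_le_compat_r; [now apply pow_le|].
      apply Rmult_le_compat_r; [now apply pow_le|]. apply HB.
    - intros l. apply (summable_pow_geom _ (M * 4 ^ l) 4); [lra| |lra].
      intros K. eapply Rle_trans; [apply HB|]. right; ring. }
  assert (D1 := fun z Hz => Hdouble _ z Hz (dcoef_bound 0 a (1 - c + a) (1 - b + a) c'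
     (first_denominator a b Hab) Hc')).
  assert (D2 := fun z Hz => Hdouble _ z Hz (dcoef_bound (a - b) b (1 - c + b) (1 - a + b) c'
     (second_denominator a b Hab) Hc')).
  set (F1 := (frakf c b a * Cpower (- X) (- a))%C).
  set (F2 := (frakf c a b * Cpower (- X) (- b))%C).
  set (s1 := fun l => Cps (fun K => dcoef 0 a (1 - c + a) (1 - b + a) c' K l) (/ X)) in *.
  set (s2 := fun l => Cps (fun K => dcoef (a - b) b (1 - c + b) (1 - a + b) c' K l) (/ X)) in *.
  assert (Hq : forall n, ycoef Psi1 n X = (F1 * s1 n + F2 * s2 n)%C).
  { intros n. rewrite (ycoef_infinity a b c c' Psi1 Hc Hc' Hab HPsi n X HX HA).
    now apply yexp_split. }
  assert (Hps : forall z, Cmod z < 1 / 4 -> summable (fun n => ycoef Psi1 n X * z ^ n)%C /\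
    Cps (fun n => ycoef Psi1 n X) z = (F1 * Cps s1 z + F2 * Cps s2 z)%C).
  { intros z Hz. assert (A1 := proj1 (D1 z Hz)). assert (A2 := proj1 (D2 z Hz)).
    fold (s1) in A1. fold (s2) in A2.
    assert (E : forall n, (F1 * (s1 n * z ^ n) + F2 * (s2 n * z ^ n)
        = ycoef Psi1 n X * z ^ n)%C) by (intros n; rewrite Hq; ring).
    assert (B1 := summable_scal F1 _ A1). assert (B2 := summable_scal F2 _ A2). split.
    - apply summable_ext with (1 := E). exact (summable_plus _ _ B1 B2).
    - transitivity (CSeries (fun n => F1 * (s1 n * z ^ n) + F2 * (s2 n * z ^ n))%C).
      { symmetry. exact (CSeries_ext _ _ E). }
      transitivity (CSeries (fun n => F1 * (s1 n * z ^ n))%C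
                    + CSeries (fun n => F2 * (s2 n * z ^ n))%C)%C.
      { exact (CSeries_plus _ _ B1 B2). }
      f_equal; [exact (CSeries_scal F1 _ A1)|exact (CSeries_scal F2 _ A2)]. }
  rewrite (proj2 (D1 y (proj2 Hy))), (proj2 (D2 y (proj2 Hy))).
  rewrite <- (proj2 (Hps y (proj2 Hy))).
  destruct (ycoef_germ a b c c' Psi1 HPsi X (region_slit X 0 HX0 HA)) as [r [Hr Hg]].
  set (gam := fun t : R => (RtoC t * y)%C).
  assert (Hgm : forall t, 0 <= t -> Cmod (gam t) = t * Cmod y).
  { intros t Ht. unfold gam. now rewrite Cmod_mult, Cmod_R, Rabs_pos_eq. }
  assert (Hid : Psi1 X (gam 1) = Cps (fun n => ycoef Psi1 n X) (gam 1)).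
  { apply (identity_along_path (Psi1 X) (Cps (fun n => ycoef Psi1 n X)) gam (r / 2)).
    - intros t Ht. apply (Psi1_analytic_y a b c c' Psi1 HPsi). now apply region_slit.
    - intros t Ht. apply (analytic1_Cps _ (fun n => ycoef Psi1 n X) (1/4)).
      + rewrite Hgm by lra. nra.
      + intros z Hz. split; [now apply Hps|reflexivity].
    - intros t Ht eps Heps. exists eps. split; [exact Heps|]. intros s Hs Hst.
      unfold gam. replace (RtoC s * y - RtoC t * y)%C with (RtoC (s - t) * y)%C
        by (rewrite RtoC_minus; ring).
      rewrite Cmod_mult, Cmod_R. assert (P0 := Rabs_pos (s - t)). nra.
    - intros s t Hst Ht E. assert (E2 := f_equal Cmod E).
      rewrite !Hgm in E2 by lra. nra.
    - lra.
    - intros t Ht Ht1. apply Hg. rewrite Hgm by lra. nra. }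
  unfold gam in Hid. rewrite Cmult_1_l in Hid. exact Hid.
Qed.
End Expansion.

Lemma Cmod_Cpower_ratio (x y s : C) : x <> 0 -> y <> 0 ->
  Cmod (Cpower (- (x / y)) (- s))
  <= Rpower (Cmod x) (- Re s) * exp (PI * Rabs (Im s)) * Rpower (Cmod y) (Re s).
Proof.
  intros Hx Hy.
  assert (Hx0 : 0 < Cmod x) by now apply Cmod_gt_0.
  assert (Hy0 : 0 < Cmod y) by now apply Cmod_gt_0.
  assert (Hm : Cmod (- (x / y)) = Cmod x / Cmod y) by now rewrite Cmod_opp, Cmod_div.
  eapply Rle_trans.
  - apply Cmod_Cpower. apply Cmod_gt_0. rewrite Hm. now apply Rdiv_lt_0_compat.
  - rewrite Hm. right.
    replace (Re (- s)%C) with (- Re s) by reflexivity.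
    replace (Im (- s)%C) with (- Im s) by reflexivity. rewrite Rabs_Ropp.
    assert (E : Rpower (Cmod x / Cmod y) (- Re s)
       = Rpower (Cmod x) (- Re s) * Rpower (Cmod y) (Re s)).
    { unfold Rpower. rewrite <- exp_plus. f_equal. unfold Rdiv.
      rewrite ln_mult, ln_Rinv by (try apply Rinv_0_lt_compat; assumption). ring. }
    rewrite E. ring.
Qed.

Theorem theorem3p6 :
  forall (a b c c' : C) (Psi1 : C -> C -> C),
    not_nonpos_int c -> not_nonpos_int c' -> not_int (a - b)%C ->
    is_Psi1 a b c c' Psi1 ->
    forall (N : nat) (x : C), (0 < N)%nat -> x <> RtoC 0 ->
    exists K delta : R, 0 < delta /\
      forall y : C, 0 < Cmod y < delta ->
        Rabs (Arg (- (x / y))%C) < PI ->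
        Cmod (Psi1 (x / y)%C y
              - (frakf c b a * Cpower (- (x / y)) (- a)
                   * sum_n (fun m => coef1 a b c c' x m * y ^ m)%C (pred N)
                 + frakf c a b * Cpower (- (x / y)) (- b)
                   * sum_n (fun m => coef2 a b c c' x m * y ^ m)%C (pred N)))%C
        <= K * (Rpower (Cmod y) (Re a + INR N) + Rpower (Cmod y) (Re b + INR N)).
Proof.
  intros a b c c' Psi1 Hc Hc' Hab HPsi N x HN Hx.
  assert (Hx0 : 0 < Cmod x) by now apply Cmod_gt_0.
  set (X2 := 2 / Cmod x).
  assert (HX2 : 0 < X2) by (apply Rdiv_lt_0_compat; lra).
  set (del := Rmin (/ (8 * (1 + X2))) (Cmod x / 8)).
  assert (Hd1 : del <= / (8 * (1 + X2))) by apply Rmin_l.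
  assert (Hd2 : del <= Cmod x / 8) by apply Rmin_r.
  assert (Hd : 0 < del).
  { apply Rmin_glb_lt; [apply Rinv_0_lt_compat; lra|lra]. }
  assert (Hd3 : 4 * (1 + X2) * del <= 1 / 2).
  { apply Rle_trans with (4 * (1 + X2) * / (8 * (1 + X2))).
    - apply Rmult_le_compat_l; lra.
    - right; field; lra. }
  assert (Hd4 : del < 1 / 4) by nra.
  destruct (dcoef_bound 0 a (1 - c + a) (1 - b + a) c' (first_denominator a b Hab) Hc') as [M1 [HM1 B1]].
  destruct (dcoef_bound (a - b) b (1 - c + b) (1 - a + b) c' (second_denominator a b Hab) Hc') as [M2 [HM2 B2]].
  assert (S1 := fun y Hy => antidiagonal_sum _ M1 x y (Rlt_le _ _ HM1) Hx B1 Hy).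
  assert (S2 := fun y Hy => antidiagonal_sum _ M2 x y (Rlt_le _ _ HM2) Hx B2 Hy).
  fold X2 in S1, S2.
  set (p1 := coef1 a b c c' x). set (p2 := coef2 a b c c' x).
  assert (Hp1 : forall m, sum_n (fun k => dcoef 0 a (1 - c + a) (1 - b + a) c' k (m - k)
     * (/ x) ^ k)%C m = p1 m) by (intros m; symmetry; now apply coef1_dcoef).
  assert (Hp2 : forall m, sum_n (fun k => dcoef (a - b) b (1 - c + b) (1 - a + b) c' k (m - k)
     * (/ x) ^ k)%C m = p2 m) by (intros m; symmetry; now apply coef2_dcoef).
  assert (Hdc : Cmod (RtoC del) = del) by (rewrite Cmod_R, Rabs_pos_eq; lra).
  assert (Hdn : RtoC del <> 0) by (apply RtoC_neq_0; lra).
  destruct (Cps_tail p1 (RtoC del) N Hdn HN) as [T1 [HT1 E1]].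
  { destruct (S1 (RtoC del)) as [HA _]; [rewrite Hdc; lra|].
    revert HA. apply summable_ext. intros m. now rewrite Hp1. }
  destruct (Cps_tail p2 (RtoC del) N Hdn HN) as [T2 [HT2 E2]].
  { destruct (S2 (RtoC del)) as [HA _]; [rewrite Hdc; lra|].
    revert HA. apply summable_ext. intros m. now rewrite Hp2. }
  rewrite Hdc in E1, E2.
  set (K1 := Cmod (frakf c b a) * (Rpower (Cmod x) (- Re a) * exp (PI * Rabs (Im a))) * T1).
  set (K2 := Cmod (frakf c a b) * (Rpower (Cmod x) (- Re b) * exp (PI * Rabs (Im b))) * T2).
  assert (HK1 : 0 <= K1).
  { apply Rmult_le_pos; [|exact HT1]. apply Rmult_le_pos; [apply Cmod_ge_0|].
    apply Rmult_le_pos; left; apply exp_pos. }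
  assert (HK2 : 0 <= K2).
  { apply Rmult_le_pos; [|exact HT2]. apply Rmult_le_pos; [apply Cmod_ge_0|].
    apply Rmult_le_pos; left; apply exp_pos. }
  exists (K1 + K2), del. split; [exact Hd|]. intros y Hy HA.
  assert (Hyn : y <> 0) by now apply Cmod_gt_0.
  assert (HXm : 8 < Cmod (x / y)).
  { rewrite Cmod_div by exact Hyn. apply Rmult_lt_reg_r with (Cmod y); [lra|].
    unfold Rdiv. rewrite Rmult_assoc, Rinv_l by lra. lra. }
  rewrite (Psi1_taylor a b c c' Psi1 Hc Hc' Hab HPsi (x / y) y HXm HA) by lra.
  replace (/ (x / y))%C with (y / x)%C by (field; now split).
  assert (Hys : 4 * (1 + X2) * Cmod y < 1) by nra.
  rewrite (proj2 (S1 y Hys)), (proj2 (S2 y Hys)).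
  assert (Q1 : Cps (fun m => sum_n (fun k => dcoef 0 a (1 - c + a) (1 - b + a) c' k (m - k)
     * (/ x) ^ k)%C m) y = Cps p1 y)
    by (apply CSeries_ext; intros m; now rewrite Hp1).
  assert (Q2 : Cps (fun m => sum_n (fun k => dcoef (a - b) b (1 - c + b) (1 - a + b) c' k (m - k)
     * (/ x) ^ k)%C m) y = Cps p2 y)
    by (apply CSeries_ext; intros m; now rewrite Hp2).
  rewrite Q1, Q2. specialize (E1 y ltac:(lra)). specialize (E2 y ltac:(lra)).
  set (t1 := sum_n (fun m => p1 m * y ^ m)%C (pred N)) in *.
  set (t2 := sum_n (fun m => p2 m * y ^ m)%C (pred N)) in *.
  assert (W1 := Cmod_Cpower_ratio x y a Hx Hyn). assert (W2 := Cmod_Cpower_ratio x y b Hx Hyn).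
  set (w1 := Cpower (- (x / y)) (- a)) in *. set (w2 := Cpower (- (x / y)) (- b)) in *.
  replace (frakf c b a * w1 * Cps p1 y + frakf c a b * w2 * Cps p2 y
      - (frakf c b a * w1 * t1 + frakf c a b * w2 * t2))%C
    with (frakf c b a * w1 * (Cps p1 y - t1) + frakf c a b * w2 * (Cps p2 y - t2))%C by ring.
  rewrite !Rpower_plus, !Rpower_pow by lra.
  eapply Rle_trans; [apply Cmod_triangle|]. rewrite !Cmod_mult.
  set (ya := Rpower (Cmod y) (Re a)) in *. set (yb := Rpower (Cmod y) (Re b)) in *.
  set (yN := Cmod y ^ N) in *.
  assert (Pa : 0 < ya) by apply exp_pos. assert (Pb : 0 < yb) by apply exp_pos.
  assert (PN : 0 <= yN) by (apply pow_le; lra).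
  assert (U1 : Cmod (frakf c b a) * Cmod w1 * Cmod (Cps p1 y - t1) <= K1 * (ya * yN)).
  { replace (K1 * (ya * yN)) with (Cmod (frakf c b a)
       * (Rpower (Cmod x) (- Re a) * exp (PI * Rabs (Im a)) * ya) * (T1 * yN))
      by (unfold K1; ring).
    apply Rmult_le_compat; try apply Cmod_ge_0; [|apply Rmult_le_compat_l|exact E1].
    - apply Rmult_le_pos; apply Cmod_ge_0.
    - apply Cmod_ge_0.
    - exact W1. }
  assert (U2 : Cmod (frakf c a b) * Cmod w2 * Cmod (Cps p2 y - t2) <= K2 * (yb * yN)).
  { replace (K2 * (yb * yN)) with (Cmod (frakf c a b)
       * (Rpower (Cmod x) (- Re b) * exp (PI * Rabs (Im b)) * yb) * (T2 * yN))
      by (unfold K2; ring).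
    apply Rmult_le_compat; try apply Cmod_ge_0; [|apply Rmult_le_compat_l|exact E2].
    - apply Rmult_le_pos; apply Cmod_ge_0.
    - apply Cmod_ge_0.
    - exact W2. }
  assert (V1 : 0 <= ya * yN) by (apply Rmult_le_pos; lra).
  assert (V2 : 0 <= yb * yN) by (apply Rmult_le_pos; lra).
  nra.
Qed.
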